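(* Let $\rho(r)$ be an arbitrary proximate order, $\rho=\rho(\infty)$, and $\mu\in\mathfrak M(\rho(r))$. Let $K(t)$ be a Borel function on $(0,\infty)$ such that $t^{\rho-1}\gamma(t)K(t)\in L_1(0,\infty)$. Put $$\Psi(r)=\int_0^\infty K\left(\frac tr\right)d\mu(t).$$ Then the measure $s$, $ds(u)=\Psi(u)\,du$, belongs to the class $\mathfrak M(\rho(r)+1)$, and its limit set $Fr[\rho(r)+1,s]$ consists of absolutely continuous measures, the set of whose densities (as functions of $u\in(0,\infty)$) coincides with the set $$\left\{\int_0^\infty K\left(\frac tu\right)d\nu(t):\ \nu\in Fr[\mu]\right\}.$$
   Context: Proximate orders: a zero proximate order is a real function $\hat\rho(r)$ on $(0,\infty)$ (possibly undefined at $r=1$) such that $\lim_{r\to\infty}\hat\rho(r)=0$; $\hat\rho(1/r)=-\hat\rho(r)$; $\hat\rho$ is continuously differentiable on $(0,\infty)\setminus\{1\}$; $\lim_{r\to\infty}r\ln r\,\hat\rho'(r)=0$; and $r^{\hat\rho(r)}$ extends continuously to $r=1$ with value $1$. A proximate order is $\rho(r)=\rho+\hat\rho(r)$ with $\rho\in\mathbb R$ and $\hat\rho$ a zero proximate order; $\rho=\rho(\infty)=\lim_{r\to\infty}\rho(r)$. Put $V(r)=r^{\rho(r)}$ and $$\gamma(t)=\sup_{r>0}\frac{V(rt)}{t^\rho V(r)},\qquad t>0.$$ Radon measures: a real Radon measure on $(0,\infty)$ is $\mu=\mu_1-\mu_2$ with $\mu_1,\mu_2$ mutually singular positive Borel measures,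 finite on compact subsets of $(0,\infty)$; a complex Radon measure is $\mu_1+i\mu_2$ with $\mu_1,\mu_2$ real Radon measures; $|\mu|$ is the total variation. Wide convergence $\mu_n\to\mu$ means $\int\varphi\,d\mu_n\to\int\varphi\,d\mu$ for every continuous $\varphi$ with compact support in $(0,\infty)$. $\mathfrak M(\rho(r))$ is the set of Radon measures on $(0,\infty)$ with $\sup_{r>0}|\mu|([r,er])/V(r)<\infty$. With $\mu_t(E)=\mu(tE)/V(t)$, the Azarin limit set $Fr[\mu]=Fr[\rho(r),\mu]$ is the set of all wide limits $\nu=\lim_{n\to\infty}\mu_{t_n}$ with $t_n\to+\infty$. $\mathfrak M(\rho(r)+1)$ and $Fr[\rho(r)+1,s]$ are defined in the same way with $\rho(r)$ replaced by $\rho(r)+1$, i.e. $V(r)$ replaced by $rV(r)$. Functions such as $\Psi(r)$ and densities are understood up to equality almost everywhere. *)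

(* Defs.v *)
From HB Require Import structures.
From mathcomp Require Import all_boot all_order all_algebra.
From mathcomp Require Import all_classical all_reals all_analysis.
From mathcomp Require Import measurable_realfun complex.

Set Implicit Arguments.
Unset Strict Implicit.
Unset Printing Implicit Defensive.
Import Order.TTheory GRing.Theory Num.Theory.
Import numFieldNormedType.Exports.

Local Open Scope classical_set_scope.
Local Open Scope ring_scope.
Local Open Scope complex_scope.

Definition halfline (R : realType) : set R := [set` `]0, +oo[ ].
Arguments halfline {R}.

Section proximate_orders.
Context {R : realType}.
Implicit Types rho rhat : R -> R.

(* The value at 1 is unconstrained: a zero proximate order may be undefined
   there. *)
Definition zero_proximate_order rhat : Prop :=
  [/\ rhat r @[r --> +oo] --> 0,
      forall r : R, 0 < r -> r != 1 -> rhat r^-1 = - rhat r,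
      forall r : R, 0 < r -> r != 1 ->
        derivable rhat r 1 /\ {for r, continuous (derive1 rhat)},
      r * ln r * derive1 rhat r @[r --> +oo] --> 0
    & r `^ rhat r @[r --> (1 : R)^'] --> (1 : R)].

Definition proximate_order rho : Prop :=
  exists (rho0 : R) rhat, zero_proximate_order rhat /\
    forall r : R, 0 < r -> r != 1 -> rho r = rho0 + rhat r.

Definition order_at_infinity rho : R := lim (rho r @[r --> +oo]).

(* Since 1 `^ a = 1 for every a, V takes at r = 1 the value of its continuous
   extension, whatever [rho 1] is. *)
Definition V rho (r : R) : R := r `^ rho r.

Lemma V_inv_ge0 rho r : 0 <= (V rho r)^-1.
Proof. by rewrite invr_ge0 powR_ge0. Qed.

(* The supremum is finite for every t > 0 when rho is a proximate order. *)
Definition gamma rho (t : R) : R :=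
  sup [set V rho (r * t) / (t `^ order_at_infinity rho * V rho r)
      | r in halfline].

End proximate_orders.

(* The image measure E |-> m (c E), for c > 0. *)
Section dilation.
Context {R : realType}.
Variables (m : {measure set (measurableTypeR R) -> \bar R}) (c : R).

Definition dilation : set (measurableTypeR R) -> \bar R :=
  pushforward m (fun x : measurableTypeR R => x / c : measurableTypeR R).

Let mdiv : measurable_fun [set: measurableTypeR R]
  (fun x : measurableTypeR R => x / c : measurableTypeR R).
Proof. exact: mulrr_measurable. Qed.

Let dilation0 : dilation set0 = 0%E.
Proof. by rewrite /dilation /pushforward preimage_set0 measure0. Qed.

Let dilation_ge0 A : (0 <= dilation A)%E.
Proof. exact: measure_ge0. Qed.

Let dilation_sigma_additive : semi_sigma_additive dilation.
Proof.
exact: measure_semi_sigma_additive.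
Qed.

HB.instance Definition _ := isMeasure.Build _ _ _ dilation
  dilation0 dilation_ge0 dilation_sigma_additive.

End dilation.

Section radon_measures.
Context {R : realType}.
Local Notation T := (measurableTypeR R).
Local Notation Re := (@complex.Re R).
Local Notation Im := (@complex.Im R).
Local Notation posmeasure := {measure set T -> \bar R}.
Implicit Types (m : posmeasure) (E : set R) (g : R -> R) (f : R -> R[i]).

(* A positive Borel measure on (0, oo) is encoded as a Borel measure on the
   line that does not charge the complement of (0, oo). *)
Definition positive_radon m : Prop :=
  m (~` halfline) = 0%E /\
  forall E, compact E -> E `<=` halfline -> (m E < +oo)%E.

Definition mutually_singular m1 m2 : Prop :=
  exists2 E : set T, measurable E & m1 E = 0%E /\ m2 (~` E) = 0%E.

(* rpos - rneg *)
Record rmeasure := RMeasure { rpos : posmeasure; rneg : posmeasure }.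

(* cre + i cim *)
Record cmeasure := CMeasure { cre : rmeasure; cim : rmeasure }.

Definition real_radon (mu : rmeasure) : Prop :=
  [/\ positive_radon (rpos mu), positive_radon (rneg mu)
    & mutually_singular (rpos mu) (rneg mu)].

Definition complex_radon (mu : cmeasure) : Prop :=
  real_radon (cre mu) /\ real_radon (cim mu).

Definition relatively_compact E : Prop :=
  exists2 C : set R, compact C /\ C `<=` halfline & E `<=` C.

(* The value mu(E), meaningful for E relatively compact in (0, oo). *)
Definition rvalue (mu : rmeasure) E : R :=
  fine (rpos mu E) - fine (rneg mu E).

Definition cvalue (mu : cmeasure) E : R[i] :=
  rvalue (cre mu) E +i* rvalue (cim mu) E.

Definition total_variation (mu : cmeasure) (E : set T) : \bar R :=
  ereal_sup [set x | exists n (F : 'I_n -> set T),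
    [/\ forall k, [/\ measurable (F k), relatively_compact (F k) & F k `<=` E],
        trivIset setT F
      & x = (\sum_(k < n) ComplexField.Normc.normc (cvalue mu (F k)))%:E]].

Definition cintegrable m (E : set T) f : Prop :=
  m.-integrable E (EFin \o (Re \o f)) /\
  m.-integrable E (EFin \o (Im \o f)).

Definition cintegral m (E : set T) f : R[i] :=
  (\int[m]_(x in E) Re (f x)) +i* (\int[m]_(x in E) Im (f x)).

Definition radon_integrable (mu : cmeasure) (E : set T) f : Prop :=
  [/\ cintegrable (rpos (cre mu)) E f, cintegrable (rneg (cre mu)) E f,
      cintegrable (rpos (cim mu)) E f & cintegrable (rneg (cim mu)) E f].

Definition radon_integral (mu : cmeasure) (E : set T) f : R[i] :=
  (cintegral (rpos (cre mu)) E f - cintegral (rneg (cre mu)) E f) +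
  'i * (cintegral (rpos (cim mu)) E f - cintegral (rneg (cim mu)) E f).

Definition ccvg (z : nat -> R[i]) (l : R[i]) : Prop :=
  ComplexField.Normc.normc (z n - l) @[n --> \oo] --> (0 : R).

(* Real test functions suffice, by linearity of the integral. *)
Definition wide_cvg (mu_ : nat -> cmeasure) (nu : cmeasure) : Prop :=
  forall phi : R -> R, continuous phi ->
    (exists2 C : set R, compact C /\ C `<=` halfline &
       forall x, ~ C x -> phi x = 0) ->
    ccvg (fun n => radon_integral (mu_ n) halfline (fun x => (phi x)%:C))
         (radon_integral nu halfline (fun x => (phi x)%:C)).

Definition borel_fun (E : set T) f : Prop :=
  measurable_fun E (Re \o f : T -> R) /\
  measurable_fun E (Im \o f : T -> R).

(* d mu(u) = f(u) du on (0, oo) *)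
Definition has_density (mu : cmeasure) f : Prop :=
  forall E : set T, measurable E -> relatively_compact E ->
    cintegrable lebesgue_measure E f /\
    cvalue mu E = cintegral lebesgue_measure E f.

Definition abs_continuous (mu : cmeasure) : Prop :=
  forall E : set T, measurable E -> E `<=` halfline ->
    lebesgue_measure E = 0%E -> total_variation mu E = 0%E.

End radon_measures.
Arguments rmeasure : clear implicits.
Arguments cmeasure : clear implicits.

Section azarin.
Context {R : realType}.
Implicit Types (rho : R -> R) (mu nu : cmeasure R).
Local Notation T := (measurableTypeR R).

Definition radon_class rho : set (cmeasure R) :=
  [set mu | complex_radon mu /\
    (ereal_sup [set total_variation mu `[r, (expR 1 * r)%R]%classic
                    * ((V rho r)^-1)%:E | r in halfline] < +oo)%E].

Definition rscale rho (t : R) (m : {measure set T -> \bar R}) :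
    {measure set T -> \bar R} :=
  mscale (NngNum (V_inv_ge0 rho t)) (dilation m t).

(* mu_t(E) = mu(t E) / V(t) *)
Definition azarin_scale rho mu (t : R) : cmeasure R :=
  CMeasure
    (RMeasure (rscale rho t (rpos (cre mu))) (rscale rho t (rneg (cre mu))))
    (RMeasure (rscale rho t (rpos (cim mu))) (rscale rho t (rneg (cim mu)))).

Definition limit_set rho mu : set (cmeasure R) :=
  [set nu | complex_radon nu /\
    exists2 t : nat -> R, t n @[n --> \oo] --> +oo &
      wide_cvg (fun n => azarin_scale rho mu (t n)) nu].

Definition transform_integrable (K : R -> R[i]) mu (r : R) : Prop :=
  radon_integrable mu halfline (fun t => K (t / r)).

Definition transform (K : R -> R[i]) mu (r : R) : R[i] :=
  radon_integral mu halfline (fun t => K (t / r)).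

End azarin.

(* Main.v *)
Require Import Defs.
From HB Require Import structures.
From mathcomp Require Import all_boot all_order all_algebra.
From mathcomp Require Import all_classical all_reals all_analysis.
From mathcomp Require Import measurable_realfun complex.
From mathcomp Require Import ring lra.
Import Order.TTheory GRing.Theory Num.Theory.
Import numFieldNormedType.Exports.
Local Open Scope classical_set_scope.
Local Open Scope ring_scope.
Set Implicit Arguments.
Unset Strict Implicit.
Unset Printing Implicit Defensive.

(** The weight w(t) = t^rho gamma(t) satisfies V(r t) <= w(t) V(r) and is
    submultiplicative, so a bound |mu|([r, e r]) <= C V(r) becomes
    mu_t([x, e x]) <= C w(x) for all rescaled measures mu_t, with one constant
    C. Measures with such a bound form the classes [growth] on which everything
    below is uniform. For a positive measure m of this kind Fubini and the
    substitution v = x / u give, on every segment [a, b] of (0, oo),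

      int_[a,b] int |K(x / u)| dm(x) du <= C D int |K(v)| w(v) / v dv

    with D depending on the segment only ([kernel_bound_segment],
    [kernel_bound]), and the last integral is finite by hypothesis. Hence the
    transform of m exists almost everywhere, is locally integrable, and the
    measure with this density satisfies the bounds of order rho + 1.

    Testing the transform Psi_m of m with phi moves the kernel to the test
    function: int phi Psi_m du = int H dm with
    H(x) = int phi(x / v) K(v) x / v^2 dv ([pairing_dual]). If K is bounded and
    supported in a segment, then H is continuous with compact support, so the
    left side depends continuously on m for wide convergence. A general K is
    truncated, and by the estimate above the error is uniform over the growth
    class ([pairing_truncation]); so the pairing is continuous there
    ([pairing_cvg]). The same formula shows that rescaling s by t corresponds to
    rescaling mu by t ([action_transform_scale]). Therefore mu_(t_n) -> nu
    implies s_(t_n) -> Psi_nu du, which puts every Psi_nu into the limit set.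

    For the converse let s_(t_n) -> sigma. By Helly selection the measures
    mu_(t_n) converge along a subsequence to some nu ([signed_selection]), so
    s_(t_n) converges along it both to sigma and to Psi_nu du, and these agree.
    In particular sigma is absolutely continuous.

    Real measures are pairs of mutually singular positive measures, and wide
    convergence controls only the difference of the two. The parts of a limit
    are not the limits of the parts, but they lie below them ([singular_le]);
    this keeps the limit in the growth class ([signed_limit_growth]). *)

(** * The weight of a proximate order *)
(** This is the least function W with V(r t) <= W(t) V(r) for all r > 0; divided
    by t it is the factor of K in the integrability hypothesis. *)
Definition weight {R : realType} (rho : R -> R) (t : R) : R :=
  t `^ order_at_infinity rho * gamma rho t.

Section log_scale.
Context {R : realType}.
Variable rhat : R -> R.
Hypothesis zrhat : zero_proximate_order rhat.

(** The logarithm of r^rhat(r) as a function of y = ln r. *)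
Definition log_excess (y : R) : R := rhat (expR y) * y.
Local Notation h := log_excess.

Lemma expR_eq1 (y : R) : (expR y == 1) = (y == 0).
Proof. by rewrite -expR0 (inj_eq (@expR_inj R)). Qed.

Lemma log_excess0 : h 0 = 0. Proof. by rewrite /log_excess mulr0. Qed.

Lemma log_excessN y : h (- y) = h y.
Proof.
have [->|y0] := eqVneq y 0; first by rewrite oppr0.
have [_ inv _ _ _] := zrhat.
by rewrite /log_excess expRN inv ?expR_gt0 ?expR_eq1// mulrNN.
Qed.

Lemma is_derive_log_excess y : y != 0 ->
  is_derive y (1:R) h (expR y * y * derive1 rhat (expR y) + rhat (expR y)).
Proof.
move=> y0; have [_ _ /(_ (expR y)) + _ _] := zrhat.
rewrite expR_gt0 expR_eq1 => /(_ isT y0)[dr _].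
have d1 : is_derive (expR y) (1:R) rhat (derive1 rhat (expR y)).
  by rewrite derive1E; exact/derivableP.
have d2 : is_derive y (1:R) (rhat \o expR) (derive1 rhat (expR y) * expR y).
  exact: is_derive1_comp.
have d3 := is_deriveM d2 (is_derive_id y (1:R)).
apply: is_derive_eq d3 _.
by rewrite /= /GRing.scale/=; ring.
Qed.

(** At y = 0 this is the condition on r^rhat(r) at r = 1. *)
Lemma continuous_log_excess : continuous h.
Proof.
move=> y; have [->|y0] := eqVneq y 0; last first.
  have := is_derive_log_excess y0 => -[/derivable1_diffP/differentiable_continuous].
  by move=> ?.
apply/continuous_withinNx; rewrite log_excess0.
have [_ _ _ _ V1] := zrhat.
have lnV : ln (x `^ rhat x) @[x --> (1:R)^'] --> (0:R).
  rewrite -(@ln1 R); apply: cvg_comp V1 _; exact: continuous_ln.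
have e1 : expR z @[z --> (0:R)^'] --> (1:R)^'.
  move=> A HA.
  have HB : \forall z \near (0:R), expR z != 1 -> A (expR z).
    have : expR z @[z --> (0:R)] --> (1:R) by rewrite -expR0; exact: continuous_expR.
    by move=> cE; exact: (cE _ HA).
  have [d /= d0 Hd] := HB.
  exists d => //= z zd z0; apply: Hd => //; by rewrite expR_eq1.
have := cvg_comp _ _ e1 lnV.
apply: cvg_trans; apply: near_eq_cvg; near=> z.
by rewrite /= /powR gt_eqF ?expR_gt0// !expRK.
Unshelve. all: by end_near. Qed.

Lemma expR_cvgy : expR y @[y --> +oo] --> (+oo : set_system R).
Proof.
apply/cvgryPge => A; near=> y; apply: le_trans (expR_ge1Dx y).
by rewrite ler_wpDl//; near: y; exact: nbhs_pinfty_ge.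
Unshelve. all: by end_near. Qed.

(** At r = e^y the derivative is r ln r rhat'(r) + rhat(r), which tends to 0. *)
Lemma log_excess_lipschitz_near_infty : exists2 M : R, 0 < M &
  forall x y, M <= x -> x <= y -> `|h y - h x| <= y - x.
Proof.
have [r0 _ _ d0 _] := zrhat.
have D0 : (r * ln r * derive1 rhat r + rhat r) @[r --> +oo] --> (0:R).
  by rewrite -[X in _ --> X]addr0; exact: cvgD.
have : \forall y \near +oo, `|expR y * y * derive1 rhat (expR y) + rhat (expR y)| <= 1.
  have /cvgrPdist_le/(_ 1 ltr01) := cvg_comp _ _ expR_cvgy D0.
  by apply: filterS => y; rewrite sub0r normrN /= expRK.
move=> [M [_ HM]]; exists (Num.max M 0 + 1) => [|x y Mx xy].
  by rewrite ltr_wpDl// le_max lexx orbT.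
have x0 : 0 < x by apply: lt_le_trans Mx; rewrite ltr_wpDl// le_max lexx orbT.
have [||c cxy ->] := @MVT_segment R h
  (fun y => expR y * y * derive1 rhat (expR y) + rhat (expR y)) x y xy.
- move=> z /[!in_itv]/= /andP[xz _]; apply: is_derive_log_excess.
  by rewrite gt_eqF// (lt_trans x0).
- exact/continuous_subspaceT/continuous_log_excess.
rewrite normrM (ger0_norm (_ : 0 <= y - x)) ?subr_ge0//.
rewrite ler_piMl ?subr_ge0//; apply: HM.
move: cxy; rewrite in_itv/= => /andP[xc _].
rewrite (lt_le_trans _ xc)// (lt_le_trans _ Mx)//.
by rewrite ltr_pwDr// le_max lexx.
Qed.

(** Near infinity increments are bounded by |x - y|, by evenness also near
    -infinity; the compact interval in between only costs an additive
    constant. *)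
Lemma log_excess_increment : exists A : R,
  forall x y, `|h x - h y| <= A + `|x - y|.
Proof.
have [M M0 HM] := log_excess_lipschitz_near_infty.
have chn : {within `[0, M], continuous (fun x => `|h x|)}.
  apply: continuous_subspaceT => x; apply: (@continuous_comp _ _ _ h Num.norm).
    exact: continuous_log_excess.
  exact: norm_continuous.
have [c _ Hc] := EVT_max (ltW M0) chn.
pose B := `|h c|.
have HB x : 0 <= x -> x <= M -> `|h x| <= B.
  by move=> x0 xM; apply: Hc; rewrite in_itv/= x0.
have B0 : 0 <= B by exact: normr_ge0.
have key x y : 0 <= x -> x <= y -> `|h y - h x| <= (B + B) + (y - x).
  move=> x0 xy; have [xM|Mx] := leP x M; last first.
    by apply: le_trans (HM _ _ (ltW Mx) xy) _; rewrite lerDr addr_ge0.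
  have [yM|My] := leP y M.
    apply: le_trans (ler_normB _ _) _; rewrite -[leLHS]addr0.
    by rewrite !lerD ?HB ?subr_ge0// (le_trans x0).
  rewrite (_ : h y - h x = (h y - h M) + (h M - h x)); last by rewrite addrA subrK.
  apply: le_trans (ler_normD _ _) _; rewrite addrC lerD//.
    by apply: le_trans (ler_normB _ _) _; rewrite lerD ?HB// ltW.
  by apply: le_trans (HM _ _ (lexx _) (ltW My)) _; rewrite lerD2l lerN2.
have key2 x y : 0 <= x -> 0 <= y -> `|h x - h y| <= (B + B) + `|x - y|.
  wlog xy : x y / x <= y.
    move=> W x0 y0; have /orP[xy|yx] := le_total x y; first exact: W.
    by rewrite distrC (distrC x); exact: W.
  move=> x0 y0; rewrite distrC (distrC x) (ger0_norm (_ : 0 <= y - x)) ?subr_ge0//.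
  exact: key.
have hn x : h x = h `|x|.
  have [x0|x0] := leP 0 x; first by rewrite ger0_norm.
  by rewrite ltr0_norm// log_excessN.
exists (B + B) => x y; rewrite (hn x) (hn y).
apply: le_trans (key2 _ _ (normr_ge0 _) (normr_ge0 _)) _.
by rewrite lerD2l ler_dist_dist.
Qed.

End log_scale.

Section weight.
Context {R : realType}.
Variable rho : R -> R.
Hypothesis hrho : proximate_order rho.
Local Notation w := (weight rho).

Lemma V_gt0 (r : R) : 0 < r -> 0 < V rho r.
Proof. exact: powR_gt0. Qed.

(** The logarithm of the quotient is an increment of [log_excess] over a step of
    length |ln t|, so it is bounded independently of r. *)
Lemma weight_has_sup (t : R) : 0 < t ->
  has_sup [set V rho (r * t) / (t `^ order_at_infinity rho * V rho r)
      | r in halfline].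
Proof.
move=> t0; split.
  by eexists; exists 1 => //=; rewrite /halfline/= in_itv/= ltr01.
have [rho0 [rhat [zr rE]]] := hrho.
have orho : order_at_infinity rho = rho0.
  apply: cvg_lim => //; have [r0 _ _ _ _] := zr.
  have : rho0 + rhat r @[r --> +oo] --> rho0.
    by rewrite -[X in _ --> X]addr0; apply: cvgD => //; exact: cvg_cst.
  apply: cvg_trans; apply: near_eq_cvg; near=> r.
  by rewrite rE// gt_eqF//; near: r; exact: nbhs_pinfty_gt.
rewrite orho; have [A HA] := log_excess_increment zr.
have VE r : 0 < r -> V rho r = expR (rho0 * ln r + log_excess rhat (ln r)).
  move=> r0; rewrite /V /powR gt_eqF//; have [->|r1] := eqVneq r 1.
    by rewrite ln1 /log_excess !mulr0 addr0.
  by rewrite rE// mulrDl /log_excess lnK// posrE.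
exists (expR (A + `|ln t|)) => _ [r /= + <-].
rewrite /halfline/= in_itv/= andbT => r0.
rewrite !VE ?mulr_gt0// lnM ?posrE// {1}/powR gt_eqF// -expRD -expRN -expRD ler_expR.
have := HA (ln r + ln t) (ln r).
rewrite (addrC (ln r)) addrK => /ler_normlW; lra.
Unshelve. all: by end_near. Qed.

Lemma V_le_weight (r t : R) : 0 < r -> 0 < t -> V rho (r * t) <= w t * V rho r.
Proof.
move=> r0 t0; rewrite /weight /gamma mulrAC -ler_pdivrMl; last first.
  by rewrite mulr_gt0 ?V_gt0 ?powR_gt0.
rewrite mulrC; apply: sup_upper_bound; first exact: weight_has_sup.
by exists r => //=; rewrite /halfline/= in_itv/= r0.
Qed.

Lemma weight_ge0 (t : R) : 0 < t -> 0 <= w t.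
Proof.
move=> t0; have := V_le_weight ltr01 t0; rewrite mul1r => H.
rewrite -(pmulr_lge0 _ (V_gt0 ltr01)); apply: le_trans H; exact: powR_ge0.
Qed.

(** V(r s t) / V(r) is the product of V(r s t) / V(r s) and V(r s) / V(r). *)
Lemma weight_submul (s t : R) : 0 < s -> 0 < t -> w (s * t) <= w s * w t.
Proof.
move=> s0 t0; have st0 : 0 < s * t by rewrite mulr_gt0.
rewrite {1}/weight /gamma mulrC -ler_pdivlMr ?powR_gt0//.
apply: ge_sup; first exact: (weight_has_sup st0).1.
move=> _ [r /= + <-]; rewrite /halfline/= in_itv/= andbT => r0.
rewrite ler_pdivrMr ?mulr_gt0 ?powR_gt0//.
rewrite [leRHS]mulrA divfK ?gt_eqF ?powR_gt0//.
apply: (@le_trans _ _ (w t * V rho (r * s))).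
  by rewrite mulrA; apply: V_le_weight; rewrite ?mulr_gt0.
rewrite mulrC (mulrC (w s)) -mulrA.
by rewrite mulrC ler_wpM2l ?weight_ge0// V_le_weight.
Qed.

End weight.

(** * Measures with a density *)
Section density.
Context {R : realType}.
Local Notation T := (measurableTypeR R).
Local Notation posmeasure := {measure set T -> \bar R}.
Implicit Types (m d : posmeasure) (g : T -> R).

Definition is_density m g d := forall A : set T, measurable A ->
  d A = (\int[m]_(x in A) (g x)%:E)%E.

Lemma density_exists m g : measurable_fun setT g -> (forall x, 0 <= g x) ->
  exists d, is_density m g d.
Proof.
move=> mg g0; pose nu (A : set T) := (\int[m]_(x in A) (g x)%:E)%E.
have nu0 : nu set0 = 0%E by rewrite /nu integral_set0.
have nu_ge0 A : (0 <= nu A)%E by apply: integral_ge0 => x _; rewrite lee_fin.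
have nu_sa : semi_sigma_additive nu.
  apply: semi_sigma_additive_nng_induced; first exact/measurable_EFinP.
  by move=> x; rewrite lee_fin.
pose mix := isMeasure.Build _ _ _ nu nu0 nu_ge0 nu_sa.
pose d : posmeasure := HB.pack nu mix.
by exists d.
Qed.

Section integral_density.
Variables (m d : posmeasure) (g : T -> R).
Hypotheses (mg : measurable_fun setT g) (g0 : forall x, 0 <= g x).
Hypothesis dE : is_density m g d.
Variables (D : set T) (mD : measurable D).
Local Open Scope ereal_scope.

Import HBNNSimple.

Let integral_density_nnsfun (h : {nnsfun T >-> R}) :
  \int[d]_(x in D) (h x)%:E = \int[m]_(x in D) ((h x)%:E * (g x)%:E).
Proof.
under [LHS]eq_integral do rewrite fimfunE -fsumEFin//.
rewrite [LHS]ge0_integral_fsum//; last 2 first.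
  - by move=> r; exact/measurable_EFinP/measurableT_comp.
  - by move=> n x _; rewrite EFinM nnfun_muleindic_ge0.
under [RHS]eq_integral.
  move=> x xD; rewrite fimfunE -fsumEFin// muleC ge0_mule_fsumr; last first.
    by move=> r; rewrite EFinM nnfun_muleindic_ge0.
  over.
have mgE : measurable_fun D (EFin \o g).
  by apply/measurable_EFinP; exact: measurable_funTS.
rewrite [RHS]ge0_integral_fsum//; last 2 first.
  - move=> r; apply: emeasurable_funM => //.
    by apply/measurable_EFinP/measurableT_comp.
  - by move=> r x _; rewrite mule_ge0 ?lee_fin//; have := nnfun_muleindic_ge0 h r x; rewrite -EFinM lee_fin.
apply: eq_fsbigr => r _.
rewrite integralZl_indic_nnsfun//= integral_indic//.
under [RHS]eq_integral do rewrite EFinM muleCA.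
have [r0|r0] := ltP r 0%R.
  rewrite preimage_nnfun0// set0I measure0 mule0 integral0_eq// => x _.
  by rewrite indic0 !mule0.
rewrite ge0_integralZl//; last 2 first.
  - apply: emeasurable_funM => //.
    by apply/measurable_EFinP; exact: measurable_indic.
  - by move=> x _; rewrite mule_ge0 ?lee_fin.
rewrite dE; last exact: measurableI.
rewrite setIC integral_mkcondr; congr (_ * _); apply: eq_integral => x _.
by rewrite /patch indicE; case: ifPn; rewrite ?mule1 ?mule0.
Qed.

Lemma ge0_integral_density (f : T -> \bar R) :
  measurable_fun D f -> (forall x, D x -> 0 <= f x) ->
  \int[d]_(x in D) f x = \int[m]_(x in D) (f x * (g x)%:E).
Proof.
move=> mf f0; pose f_ := nnsfun_approx mD mf.
transitivity (limn (fun n => \int[d]_(x in D) (f_ n x)%:E)).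
  rewrite -monotone_convergence//=.
  - apply: eq_integral => x /[!inE] xD; apply/esym/cvg_lim => //=.
    exact: cvg_nnsfun_approx.
  - by move=> n; apply/measurable_EFinP; exact: measurable_funTS.
  - by move=> n x _; rewrite lee_fin.
  - by move=> x _ a b ab; rewrite lee_fin//; exact/lefP/nd_nnsfun_approx.
transitivity (limn (fun n => \int[m]_(x in D) ((f_ n x)%:E * (g x)%:E))).
  by congr (limn _); apply/funext => n; exact: integral_density_nnsfun.
rewrite -monotone_convergence//=.
- apply: eq_integral => x /[!inE] xD; apply: cvg_lim => //=.
  apply: cvgeZr => //; exact: cvg_nnsfun_approx.
- move=> n; apply: emeasurable_funM.
    by apply/measurable_EFinP; exact: measurable_funTS.
  by apply/measurable_EFinP; exact: measurable_funTS.
- by move=> n x _; rewrite mule_ge0 ?lee_fin.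
- move=> x _ a b ab; rewrite lee_wpmul2r ?lee_fin//.
  exact/lefP/nd_nnsfun_approx.
Qed.

Lemma integral_density (f : T -> R) : measurable_fun D f ->
  \int[d]_(x in D) (f x)%:E = \int[m]_(x in D) (f x * g x)%:E.
Proof.
move=> mf; rewrite [LHS]integralE [RHS]integralE.
have mfE : measurable_fun D (EFin \o f) by exact/measurable_EFinP.
rewrite ge0_integral_density//; last exact: measurable_funepos.
rewrite ge0_integral_density//; last exact: measurable_funeneg.
congr (_ - _); apply: eq_integral => x _.
  by rewrite !funeposE /= -!EFin_max -EFinM maxr_pMl// mul0r.
  rewrite !funenegE /= -!EFin_max -EFinM maxr_pMl// mul0r.
  by rewrite mulNr.
Qed.

End integral_density.

End density.

(** * Borel measures on the half-line *)
Section halfline.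
Context {R : realType}.
Local Notation T := (measurableTypeR R).
Local Notation posmeasure := {measure set T -> \bar R}.
Implicit Types (m : posmeasure) (A : set T).

Lemma integrable_indic_finite m A : measurable A -> (m A < +oo)%E ->
  m.-integrable setT (EFin \o (\1_A : T -> R)).
Proof.
move=> mA fA; apply/integrableP; split.
  by apply/measurable_EFinP; exact: measurable_indic.
under eq_integral do rewrite /= ger0_norm ?indicE ?ler0n// -indicE.
by rewrite integral_indic// setIT.
Qed.

Lemma le_natS (x : R) n : (Num.truncn x <= n)%N -> x <= n.+1%:R.
Proof. by move=> xn; apply/ltW/(lt_le_trans (truncnS_gt _)); rewrite ler_nat ltnS. Qed.

Lemma invr_natS_le (x : R) n : 0 < x -> (Num.truncn x^-1 <= n)%N -> n.+1%:R^-1 <= x.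
Proof. by move=> x0 xn; rewrite invf_ple ?posrE ?ltr0n// le_natS. Qed.

Lemma halfline_segment_near (x : R) : 0 < x -> exists N, forall n, (N <= n)%N ->
  `[n.+1%:R^-1, n.+1%:R]%classic x.
Proof.
move=> x0; exists (maxn (Num.truncn x^-1) (Num.truncn x)) => n.
rewrite geq_max => /andP[n1 n2].
by rewrite /= in_itv/= invr_natS_le//= le_natS.
Qed.

Lemma halflineE (x : R) : halfline x = (0 < x) :> Prop.
Proof. by rewrite /halfline/= in_itv/= andbT. Qed.

Lemma measurable_halfline : measurable (halfline : set T).
Proof. exact: measurable_itv. Qed.

Lemma compact_in_segment (C : set R) : compact C -> C `<=` halfline ->
  exists a b, [/\ 0 < a, a < b & C `<=` `[a, b]].
Proof.
move=> cC Ch; have [->|/set0P C0] := eqVneq C set0.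
  by exists 1, 2; split => //; rewrite ltr1n.
have cid : {within C, continuous (@id R)}.
  by apply: continuous_subspaceT => x; exact: cvg_id.
have [a aC amin] := compact_EVT_min C0 cC cid.
have [b bC bmax] := compact_EVT_max C0 cC cid.
have a0 : 0 < a by move: aC; rewrite inE => /Ch; rewrite halflineE.
have ab : a <= b by exact: amin.
exists a, (b + 1); split => //; first by rewrite ltr_pwDr.
move=> x Cx; rewrite /= in_itv/= amin ?inE//=.
by apply: le_trans (bmax x _) _; rewrite ?inE// lerDl.
Qed.

(** For measures carried by (0, oo), finiteness on compact sets amounts to
    finiteness on segments. *)
Definition locally_finite m : Prop :=
  m (~` halfline) = 0%E /\ forall a b : R, 0 < a -> (m `[a, b]%classic < +oo)%E.

Lemma segment_halfline (a b : R) : 0 < a -> `[a, b]%classic `<=` halfline.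
Proof.
by move=> a0 x /=; rewrite in_itv/= halflineE => /andP[ax _]; exact: lt_le_trans ax.
Qed.

Lemma positive_radonP m : positive_radon m <-> locally_finite m.
Proof.
split=> -[m0 mfin]; split=> //.
  by move=> a b a0; apply: mfin; [exact: segment_compact|exact: segment_halfline].
move=> E cE Eh; have [a [b [a0 ab Eab]]] := compact_in_segment cE Eh.
apply: le_lt_trans (mfin a b a0); apply: le_measure => //; rewrite inE//.
exact: compact_measurable.
Qed.

Lemma measure_setI_halfline m A : m (~` halfline) = 0%E -> measurable A ->
  m (A `&` halfline) = m A.
Proof.
move=> m0 mA; rewrite [RHS](measureDI m mA measurable_halfline) setDE.
rewrite (@subset_measure0 _ _ _ m (A `&` ~` halfline) (~` halfline)) ?add0e//.
- by apply: measurableI => //; apply: measurableC; exact: measurable_halfline.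
- by apply: measurableC; exact: measurable_halfline.
Qed.

Definition image_measure m (f : T -> T) (mf : measurable_fun setT f) : posmeasure :=
  measure_function_pushforward__canonical__measure_function_Measure m mf.

Definition log_measure m : posmeasure := image_measure m (@measurable_ln R).

Lemma log_measure_exp m A : m (~` halfline) = 0%E -> measurable A ->
  log_measure m (expR @^-1` A) = m A.
Proof.
move=> m0 mA.
have mE : measurable (expR @^-1` A : set T).
  by rewrite -[X in measurable X]setTI; exact: measurable_expR.
rewrite -(measure_setI_halfline m0 mA).
have mL : measurable (@ln R @^-1` (expR @^-1` A) : set T).
  by rewrite -[X in measurable X]setTI; exact: measurable_ln.
rewrite -[LHS](measure_setI_halfline m0 mL); congr (m _).
apply/seteqP; split=> x /=; rewrite halflineE => -[+ x0]; rewrite lnK ?posrE//.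
Qed.

Lemma log_measure_oc m (x y : R) : m (~` halfline) = 0%E ->
  log_measure m `]x, y]%classic = m `]expR x, expR y]%classic.
Proof.
move=> m0; rewrite -(log_measure_exp m0)//; apply: (f_equal (fun A => log_measure m A)).
by apply/seteqP; split=> z /=; rewrite !in_itv/= ltr_expR ler_expR.
Qed.

(** Passing to ln turns the half-open intervals of (0, oo) into those of the
    line, which generate the Borel sets and cover the line by sets of finite
    mass. *)
Lemma halfline_measure_unique m1 m2 :
  m1 (~` halfline) = 0%E -> m2 (~` halfline) = 0%E ->
  (forall a b, 0 < a -> a < b -> m1 `]a, b]%classic = m2 `]a, b]%classic) ->
  (forall a b, 0 < a -> a < b -> (m1 `]a, b]%classic < +oo)%E) ->
  forall A, measurable A -> m1 A = m2 A.
Proof.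
move=> m10 m20 m12 m1fin A mA.
have mE : measurable (expR @^-1` A : set T).
  by rewrite -[X in measurable X]setTI; exact: measurable_expR.
rewrite -(log_measure_exp m10 mA) -(log_measure_exp m20 mA).
apply: (@measure_unique _ R T (@ocitv R) (fun k => `](- k%:R : R), k%:R]%classic)
  _ _ _ _ (log_measure m1) (log_measure m2) _ _ _ mE).
- by [].
- exact: ocitvI.
- by move=> k; exact: is_ocitv.
- exact: bigcup_itvT.
- move=> _ [[x y] _ <-] /=; rewrite !log_measure_oc//.
  have [xy|yx] := ltP x y; first by rewrite m12 ?expR_gt0 ?ltr_expR.
  by rewrite !set_itv_ge ?measure0// bnd_simp -leNgt ler_expR.
- move=> k; rewrite log_measure_oc//.
  have [xy|yx] := ltP (- k%:R : R) k%:R; first by rewrite m1fin ?expR_gt0 ?ltr_expR.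
  by rewrite set_itv_ge ?measure0// bnd_simp -leNgt ler_expR.
Qed.

Lemma locally_finite_sigma_finite m : locally_finite m -> sigma_finite setT m.
Proof.
move=> [m0 mfin].
exists (fun k => `[k.+1%:R^-1, k.+1%:R]%classic `|` ~` halfline).
  apply/seteqP; split=> // x _; have [x0|x0] := ltP 0 x; last first.
    by exists 0%N => //; right => xh; move: xh; rewrite halflineE ltNge x0.
  by have [N HN] := halfline_segment_near x0; exists N => //; left; exact: HN.
move=> k; have mh := measurableC measurable_halfline.
split; first exact: measurableU.
rewrite measureU0//; apply: mfin; by rewrite invr_gt0 ltr0n.
Qed.

Lemma measurable_invr : measurable_fun setT (GRing.inv : T -> T).
Proof.
have -> : [set: T] = [set x : R | x != 0] `|` [set 0].
  apply/seteqP; split=> // x _ /=; have [->|] := eqVneq x 0; [by right|by left].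
have o : open [set x : R | x != 0].
  exact: open_neq.
apply/measurable_funU => //; first exact: open_measurable.
split; last exact: measurable_fun_set1.
apply: open_continuous_measurable_fun => // x; rewrite inE/= => x0.
exact: inv_continuous.
Qed.

Lemma measurable_divr (t : R) : measurable_fun setT (fun v : T => t / v : T).
Proof. by apply: measurable_funM => //; exact: measurable_invr. Qed.

Lemma measurable_div_sqr (t : R) : measurable_fun setT (fun v : T => t / v ^+ 2 : T).
Proof.
apply: measurable_funM => //; apply: measurableT_comp; first exact: measurable_invr.
exact: exprn_measurable.
Qed.

Lemma measurable_ratio (k : T -> R) : measurable_fun setT k ->
  measurable_fun setT (fun z : T * T => (k (z.2 / z.1))%:E : \bar R).
Proof.
move=> mk; have mV1 : measurable_fun setT (fun z : T * T => z.1^-1 : T).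
  exact: (measurableT_comp measurable_invr measurable_fst).
have m21 : measurable_fun setT (fun z : T * T => z.2 / z.1 : T).
  exact: (measurable_funM measurable_snd mV1).
by apply/measurable_EFinP; exact: (measurableT_comp mk m21).
Qed.

Lemma integral_div_sqr (t c : R) : 0 < t -> 0 < c ->
  (\int[@lebesgue_measure R]_(v in `[c, +oo[) (t / v ^+ 2)%:E = (t / c)%:E)%E.
Proof.
move=> t0 c0; pose F (y : R) : R := - t *: y^-1.
have dF (x : R) : 0 < x -> is_derive x (1:R) F (t / x ^+ 2).
  move=> x0; have x0' : id x != 0 by rewrite gt_eqF.
  have dV := is_deriveV x0' (is_derive_id x (1:R)).
  apply: is_derive_eq (is_deriveZ (- t) dV) _.
  by rewrite /GRing.scale/= mulr1 mulrNN.
rewrite (@ge0_continuous_FTC2y R _ F c 0).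
- by rewrite /F sub0e -EFinN /GRing.scale/= mulNr opprK.
- by move=> x cx; rewrite divr_ge0 ?exprn_even_ge0// ltW.
- apply/continuous_within_itvcyP; split.
    move=> x; rewrite in_itv/= andbT => cx.
    apply: cvgM; first exact: cvg_cst.
    apply: cvgV; first by rewrite expf_neq0// gt_eqF// (lt_trans c0).
    exact: exprn_continuous.
  apply: cvg_at_right_filter.
  apply: cvgM; first exact: cvg_cst.
  apply: cvgV; first by rewrite expf_neq0// gt_eqF.
  exact: exprn_continuous.
- rewrite /F -[X in _ --> X](scaler0 _ (- t)); apply: cvgZr.
  apply/(@gtr0_cvgV0 _ _ _ _ (@id R)); first exact: nbhs_pinfty_gt.
  exact: cvg_id.
- by move=> x cx; have := dF x (lt_trans c0 cx) => -[].
- apply: cvg_at_right_filter; apply: differentiable_continuous.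
  by apply/derivable1_diffP; have := dF c c0 => -[].
- move=> x; rewrite in_itv/= andbT => cx.
  by rewrite derive1E; have := dF x (lt_trans c0 cx) => d; rewrite derive_val.
Qed.

(** The substitution u = t / v is checked on half-open intervals only, where it
    is the fundamental theorem of calculus for 1 / v. *)
Lemma ge0_integral_inversion (t : R) (F : T -> \bar R) : 0 < t ->
  measurable_fun setT F -> (forall x, (0 <= F x)%E) ->
  (\int[@lebesgue_measure R]_(u in halfline) F u =
   \int[@lebesgue_measure R]_(v in halfline) (F (t / v)%R * (t / v ^+ 2)%:E))%E.
Proof.
move=> t0 mF F0; pose g (v : T) : R := (t / v ^+ 2) * \1_(halfline : set T) v.
have mg : measurable_fun setT g.
  apply: measurable_funM; last by apply: measurable_indic; exact: measurable_halfline.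
  exact: measurable_div_sqr.
have g0 v : 0 <= g v.
  by apply: mulr_ge0; [rewrite divr_ge0 ?exprn_even_ge0// ltW|rewrite indicE ler0n].
have [d dE] := density_exists (@lebesgue_measure R) mg g0.
(* The image under v -> t / v of the measure t / v^2 dv, to be identified with
   Lebesgue measure on (0, oo). *)
pose nu := image_measure d (@measurable_divr t).
have hinv : (fun v : T => t / v : T) @^-1` halfline = halfline.
  by apply/seteqP; split=> v /=; rewrite !halflineE pmulr_rgt0// invr_gt0.
have ray c : 0 < c -> d `[c, +oo[%classic = (t / c)%:E.
  move=> c0; rewrite dE// -integral_div_sqr//.
  apply: eq_integral => v; rewrite inE/= in_itv/= andbT => cv.
  by rewrite /g indicE mem_set ?mulr1// halflineE (lt_le_trans c0).
have dh : d (~` halfline) = 0%E.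
  rewrite dE; last exact: measurableC measurable_halfline.
  apply: integral0_eq => v nv; rewrite /g indicE memNset ?mulr0//.
have lebE A : measurable A -> mrestr (@lebesgue_measure R) measurable_halfline A = nu A.
  have oc a b : 0 < a -> a < b ->
      mrestr (@lebesgue_measure R) measurable_halfline `]a, b]%classic = (b - a)%:E.
    move=> a0 ab; rewrite /mrestr setIidl; last first.
      by move=> x/=; rewrite in_itv/= halflineE => /andP[ax _]; exact: lt_trans ax.
    by rewrite lebesgue_measure_itv/= lte_fin ab EFinB.
  apply: halfline_measure_unique.
  - by rewrite /= /mrestr setICl measure0.
  - by have := dh; rewrite -{1}hinv preimage_setC.
  - move=> a b a0 ab; rewrite /= oc//.
    have b0 : 0 < b by exact: lt_trans ab.
    have tb0 : 0 < t / b by rewrite divr_gt0.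
    have mP : measurable ((fun v : T => t / v : T) @^-1` `]a, b]%classic).
      by rewrite -[X in measurable X]setTI; exact: measurable_divr.
    rewrite /nu /= /pushforward -(measure_setI_halfline dh mP).
    have fin : (d `[(t / b)%R, +oo[%classic < +oo)%E by rewrite ray// ltry.
    rewrite (_ : _ `&` _ = `[t / b, +oo[ `\` `[t / a, +oo[).
      rewrite measureD//.
      rewrite setIidr; last first.
        apply: subset_itvr; rewrite bnd_simp ler_pM2l// lef_pV2 ?posrE//; exact: ltW.
      transitivity ((t / (t / b))%:E - (t / (t / a))%:E)%E; last first.
        by congr (_ - _)%E; apply/esym/ray; rewrite ?divr_gt0.
      by rewrite -EFinB; congr (_%:E); field; rewrite !gt_eqF.
    apply/seteqP; split=> v /=; rewrite !in_itv/= halflineE !andbT.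
      move=> [/andP[av vb] v0]; split.
        by rewrite ler_pdivrMr// mulrC -ler_pdivrMr.
      by apply/negP; rewrite -ltNge ltr_pdivlMr// mulrC -ltr_pdivlMr.
    move=> [tbv /negP]; rewrite -ltNge => vta.
    have v0 : 0 < v by exact: lt_le_trans tbv.
    split=> //; rewrite ltr_pdivlMr// mulrC -ltr_pdivlMr// vta/=.
    by rewrite ler_pdivrMr// mulrC -ler_pdivrMr.
  - by move=> a b a0 ab; rewrite /= oc// ltry.
rewrite (eq_measure_integral nu); last first.
  by move=> A mA Ah; rewrite -lebE// /mrestr setIidl.
rewrite (ge0_integral_pushforward (@measurable_divr t) _ measurable_halfline)//; last first.
  exact: measurable_funTS.
rewrite hinv (ge0_integral_density mg g0 dE measurable_halfline)//; last 2 first.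
- by apply: measurable_funTS; apply: measurableT_comp => //; exact: measurable_divr.
- by move=> v _; exact: F0.
by apply: eq_integral => v; rewrite inE => vh; rewrite /g indicE mem_set// mulr1.
Qed.

End halfline.

Section sigma_finite_copy.
Context {R : realType}.
Local Notation T := (measurableTypeR R).
Variables (m : {measure set T -> \bar R}) (lfm : locally_finite m).

(** An alias of m that carries sigma-finiteness, which Fubini's theorem asks
    for. *)
Definition sigma_finite_copy of locally_finite m : set T -> \bar R := m.

HB.instance Definition _ := Measure.copy (sigma_finite_copy lfm) m.

HB.instance Definition _ := @Measure_isSigmaFinite.Build _ _ _ (sigma_finite_copy lfm)
  (locally_finite_sigma_finite lfm).

End sigma_finite_copy.

(** * Growth classes and the basic estimate *)
Section slices.
Context {R : realType}.
Variables (k : R -> R) (a b : R).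
Hypotheses (a0 : 0 < a) (k0 : forall x, x <= 0 -> k x = 0).
Implicit Types x u v : R.

Lemma indic_segment x : \1_(`[a, b]%classic : set R) x = ((a <= x <= b)%R : nat)%:R :> R.
Proof. by rewrite indicE mem_setE. Qed.

(** [slice_u] is the integrand of the double integral in the variables (x, u),
    [slice_v] the same integrand in (x, v) after the substitution u = x / v. *)
Definition slice_u x u : R := \1_(`[a, b]%classic : set R) u * `|k (x / u)|.
Definition slice_v x v : R :=
  \1_(`[a, b]%classic : set R) (x / v) * (`|k v| * (x / v ^+ 2)).

Lemma slice_u_ge0 x u : 0 <= slice_u x u.
Proof. by rewrite mulr_ge0// indic_segment ler0n. Qed.

Lemma slice_v_ge0 x v : 0 <= slice_v x v.
Proof.
rewrite /slice_v; have [v0|v0] := leP v 0.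
  by rewrite k0// normr0 mul0r mulr0.
rewrite indic_segment; case: (boolP (a <= _ <= b)) => [/andP[axv _]|]; last by rewrite mul0r.
have x0 : 0 < x by have := lt_le_trans a0 axv; rewrite pmulr_lgt0 ?invr_gt0.
by rewrite mul1r mulr_ge0// divr_ge0 ?exprn_even_ge0// ltW.
Qed.

Lemma slice_u_le0 x u : u <= 0 -> slice_u x u = 0.
Proof.
by move=> u0; rewrite /slice_u indic_segment leNgt (le_lt_trans u0 a0) mul0r.
Qed.

Lemma slice_v_le0 x v : v <= 0 -> slice_v x v = 0.
Proof. by move=> v0; rewrite /slice_v k0// normr0 mul0r mulr0. Qed.

Lemma slice_u_le0l x u : x <= 0 -> slice_u x u = 0.
Proof.
move=> x0; have [u0|u0] := leP u 0; first exact: slice_u_le0.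
by rewrite /slice_u k0 ?normr0 ?mulr0// mulr_le0_ge0// invr_ge0 ltW.
Qed.

Lemma slice_v_le0l x v : x <= 0 -> slice_v x v = 0.
Proof.
move=> x0; have [v0|v0] := leP v 0; first exact: slice_v_le0.
have xv : x / v <= 0 by rewrite mulr_le0_ge0// invr_ge0 ltW.
by rewrite /slice_v indic_segment leNgt (le_lt_trans xv a0) mul0r.
Qed.

Lemma slice_inversion x v : 0 < x -> 0 < v ->
  slice_u x (x / v) * (x / v ^+ 2) = slice_v x v.
Proof.
move=> x0 v0; rewrite /slice_u /slice_v -mulrA; congr (_ * (`|k _| * _)).
by field; rewrite !gt_eqF.
Qed.

Lemma slice_v_segment x v : 0 < v ->
  slice_v x v <= \1_(`[a * v, b * v]%classic : set R) x * (`|k v| / v * `|b|).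
Proof.
move=> v0; rewrite /slice_v !indicE !mem_setE !in_itv/= ler_pdivlMr// ler_pdivrMr//.
case: (boolP (_ <= _ <= _)) => [/andP[ax xb]|]; last by rewrite !mul0r.
have v0' : 0 <= v^-1 by rewrite invr_ge0 ltW.
rewrite !mul1r -!mulrA ler_wpM2l// expr2 invfM mulrCA ler_wpM2l//.
by rewrite ler_pdivrMr//; apply: le_trans xb _; rewrite ler_pM2r// ler_norm.
Qed.

End slices.

Section growth.
Context {R : realType}.
Local Notation T := (measurableTypeR R).
Local Notation posmeasure := {measure set T -> \bar R}.
Local Notation leb := (@lebesgue_measure R).
Variable w : R -> R.
Hypothesis w_ge0 : forall x, 0 < x -> 0 <= w x.
Hypothesis w_submul : forall x y, 0 < x -> 0 < y -> w (x * y) <= w x * w y.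
Implicit Types (m : posmeasure) (k : T -> R) (C : R).

(** All rescalings of a measure in the class of rho lie in one such class, with
    the same C; estimates that only use C are therefore uniform in the scale. *)
Definition growth C m : Prop := m (~` halfline) = 0%E /\
  forall x, 0 < x -> (m `[x, (expR 1 * x)%R]%classic <= (C * w x)%:E)%E.

(** Finitely many segments [x, e x] cover [a v, b v], and submultiplicativity
    compares w at their left end points with w(v). *)
Lemma growth_segment (a b : R) : 0 < a -> exists2 D : R, 0 <= D &
  forall m C v, 0 <= C -> growth C m -> 0 < v ->
    (m `[(a * v)%R, (b * v)%R]%classic <= (C * D * w v)%:E)%E.
Proof.
move=> a0; pose D n : R := \sum_(i < n) w (expR i%:R * a).
have D0 n : 0 <= D n.
  by apply: sumr_ge0 => i _; apply: w_ge0; rewrite mulr_gt0 ?expR_gt0.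
have step n m C v : 0 <= C -> growth C m -> 0 < v ->
    (m `[(a * v)%R, (expR n%:R * a * v)%R[%classic <= (C * D n * w v)%:E)%E.
  move=> C0 [_ gm] v0.
  have tail j : (m `[(expR j%:R * a * v)%R, (expR j.+1%:R * a * v)%R]%classic <=
      (C * w (expR j%:R * a) * w v)%:E)%E.
    have p0 : 0 < expR j%:R * a * v by rewrite !mulr_gt0 ?expR_gt0.
    have := gm _ p0; rewrite !mulrA -expRD (addrC 1) natr1.
    move=> /le_trans; apply; rewrite lee_fin -[leRHS]mulrA ler_wpM2l//.
    by apply: w_submul => //; rewrite mulr_gt0 ?expR_gt0.
  elim: n => [|n IHn].
    rewrite expR0 mul1r set_itvco0 measure0 lee_fin.
    by rewrite mulr_ge0 ?w_ge0// mulr_ge0.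
  apply: (@le_trans _ _ (m (`[(a * v)%R, (expR n%:R * a * v)%R[%classic `|`
      `[(expR n%:R * a * v)%R, (expR n.+1%:R * a * v)%R]%classic))).
    apply: le_measure; rewrite ?inE//; first exact: measurableU.
    move=> x /=; rewrite !in_itv/= => /andP[ax xb].
    by have [xn|xn] := ltP x (expR n%:R * a * v); [left|right]; rewrite ?ax ?xb ?ltW.
  apply: le_trans (measureU2 _ _ _) _ => //.
  apply: (@le_trans _ _ ((C * D n * w v)%:E + (C * w (expR n%:R * a) * w v)%:E)%E).
    apply: leeD; [exact: IHn|exact: tail].
  by rewrite -EFinD lee_fin -mulrDl -mulrDr /D big_ord_recr.
(* e^n > n, so e^n a exceeds b as soon as n > b / a. *)
exists (D (Num.truncn (b / a)).+1) => // m C v C0 gm v0.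
apply: le_trans (step _ m C v C0 gm v0).
apply: le_measure; rewrite ?inE//; apply: subset_itvl; rewrite bnd_simp.
rewrite ltr_pM2r// -ltr_pdivrMr//; apply: lt_le_trans (truncnS_gt _) _.
by apply: le_trans (expR_ge1Dx _); rewrite lerDr.
Qed.

Lemma growth_locally_finite C m : 0 <= C -> growth C m -> locally_finite m.
Proof.
move=> C0 gm; split; first exact: gm.1.
move=> a b a0; have [D _ HD] := growth_segment b a0.
have := HD m C 1 C0 gm ltr01; rewrite !mulr1 => /le_lt_trans; apply.
exact: ltry.
Qed.

Lemma integral_halfline_setT m (f : T -> \bar R) :
  (forall x, ~ halfline x -> f x = 0%E) ->
  (\int[m]_(x in halfline) f x = \int[m]_x f x)%E.
Proof.
move=> f0; rewrite integral_mkcond; apply: eq_integral => x _.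
by rewrite /patch; case: ifPn => //; rewrite notin_setE => /f0.
Qed.

(** For the weight of rho the integrability condition is the one imposed on K.
    Kernels vanish off (0, oo), so that integrals may be taken over the line. *)
Definition admissible k : Prop := [/\ measurable_fun setT k,
  (forall x, x <= 0 -> k x = 0) &
  leb.-integrable halfline (fun v => (k v * (w v / v))%:E)].

Definition kernel_norm k : \bar R :=
  (\int[leb]_(v in halfline) (`|k v| * (w v / v))%:E)%E.

Lemma admissible_norm k : admissible k -> measurable_fun halfline
  (fun v => (`|k v| * (w v / v))%:E) /\ (kernel_norm k < +oo)%E.
Proof.
move=> [mk k0 /integrableP[mi fi]].
have E v : halfline v -> (`|k v| * (w v / v))%:E = (abse \o (fun v => (k v * (w v / v))%:E)) v.
  rewrite halflineE => v0 /=; rewrite normrM (ger0_norm (_ : 0 <= w v / v))//.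
  by rewrite divr_ge0 ?w_ge0// ltW.
split.
  apply: (eq_measurable_fun (abse \o (fun v => (k v * (w v / v))%:E))).
    by move=> v; rewrite inE => /E.
  exact: measurableT_comp.
rewrite /kernel_norm (eq_integral (abse \o (fun v => (k v * (w v / v))%:E)))//.
by move=> v; rewrite inE => /E.
Qed.

Lemma kernel_norm_ge0 k : (0 <= kernel_norm k)%E.
Proof.
apply: integral_ge0 => v; rewrite halflineE => v0.
by rewrite lee_fin mulr_ge0// divr_ge0 ?w_ge0// ltW.
Qed.

Lemma kernel_normZ k (c : R) : 0 <= c -> admissible k ->
  measurable_fun halfline (fun v => (c%:E * (`|k v| * (w v / v))%:E)%E) /\
  (c%:E * kernel_norm k = \int[leb]_(v in halfline) (c%:E * (`|k v| * (w v / v))%:E))%E.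
Proof.
move=> c0 ak; have [mn _] := admissible_norm ak; split; first exact: measurable_funeM.
rewrite (@ge0_integralZl _ T R leb _ measurable_halfline _ mn c%:E)//.
by move=> v; rewrite halflineE => v0; rewrite lee_fin mulr_ge0// divr_ge0 ?w_ge0// ltW.
Qed.

Lemma slice_v_integral m k (a b B v : R) : 0 < a -> 0 < v ->
  measurable_fun setT (fun x : T => (slice_v k a b x v)%:E) ->
  (forall x, x <= 0 -> k x = 0) ->
  (m `[(a * v)%R, (b * v)%R]%classic <= B%:E)%E ->
  (\int[m]_x (slice_v k a b x v)%:E <= (`|k v| / v * `|b| * B)%:E)%E.
Proof.
move=> a0 v0 ms k0 mB; pose c : R := `|k v| / v * `|b|.
have c0 : 0 <= c by rewrite mulr_ge0// divr_ge0// ltW.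
have mI : measurable (`[a * v, b * v]%classic : set T) by exact: measurable_itv.
have mi : measurable_fun setT (fun x => (\1_(`[a * v, b * v]%classic : set T) x)%:E : \bar R).
  by apply/measurable_EFinP; exact: measurable_indic.
apply: (@le_trans _ _ (\int[m]_x (c%:E * (\1_(`[a * v, b * v]%classic : set T) x)%:E))%E).
  apply: ge0_le_integral; [exact: measurableT| |exact: ms| |].
  - by move=> x _; rewrite lee_fin slice_v_ge0.
  - exact: measurable_funeM.
  - by move=> x _; rewrite -EFinM lee_fin mulrC; exact: slice_v_segment.
rewrite (ge0_integralZl _ measurableT mi); last 2 first.
- by move=> x _; rewrite lee_fin indicE ler0n.
- by rewrite lee_fin.
rewrite integral_indic// setIT -[`|k v| / v * `|b|]/c (EFinM c).
apply: lee_wpmul2l; last exact: mB.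
by rewrite lee_fin.
Qed.

(** Fubini turns the double integral into an integral over v = x / u, and for
    fixed v the variable x only ranges over the segment from a v to b v. *)
Lemma kernel_bound_segment (a b B : R) m k : 0 < a -> 0 <= B -> locally_finite m ->
  (forall v, 0 < v -> (m `[(a * v)%R, (b * v)%R]%classic <= (B * w v)%:E)%E) ->
  admissible k ->
  (\int[leb]_(u in `[a, b]) \int[m]_x `|k (x / u)|%:E <= (`|b| * B)%:E * kernel_norm k)%E.
Proof.
move=> a0 B0 lfm HB ak; have [mk k0 _] := ak; have [mn _] := admissible_norm ak.
pose m' : {sigma_finite_measure set T -> \bar R} := sigma_finite_copy lfm.
pose f (z : T * T) : \bar R := (slice_u k a b z.2 z.1)%:E.
have mI : measurable_fun setT (\1_(`[a, b]%classic : set T) : T -> R).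
  by apply: measurable_indic; exact: measurable_itv.
have mV : measurable_fun setT (fun z : T * T => z.2^-1 : T).
  exact: (measurableT_comp (@measurable_invr R) measurable_snd).
have m12 : measurable_fun setT (fun z : T * T => z.1 / z.2 : T).
  exact: (measurable_funM measurable_fst mV).
have mnk : measurable_fun setT (fun v => `|k v|).
  exact: measurableT_comp.
have mf : measurable_fun setT f.
  apply/measurable_EFinP; apply: measurable_funM.
    exact: (measurableT_comp mI measurable_fst).
  by apply/measurable_EFinP; exact: measurable_ratio mnk.
have f0 z : (0 <= f z)%E by rewrite lee_fin slice_u_ge0.
have E1 : (\int[leb]_(u in `[a, b]) \int[m]_x `|k (x / u)|%:E =
    \int[leb]_u \int[m']_x f (u, x))%E.
  rewrite integral_mkcond; apply: eq_integral => u _; rewrite /f /patch /=.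
  case: ifPn => uab.
    by apply: eq_integral => x _; rewrite /slice_u indicE uab mul1r.
  by rewrite integral0_eq// => x _; rewrite /slice_u indicE (negbTE uab) mul0r.
rewrite E1 (@fubini_tonelli _ _ _ _ _ leb m' f mf f0).
pose h (z : T * T) : \bar R := (slice_v k a b z.1 z.2)%:E.
have mh : measurable_fun setT h.
  apply/measurable_EFinP; apply: measurable_funM.
    exact: (measurableT_comp mI m12).
  apply: measurable_funM; first exact: (measurableT_comp mnk measurable_snd).
  apply: measurable_funM; first exact: measurable_fst.
  have m2 : measurable_fun setT (fun z : T * T => z.2 ^+ 2 : T).
    exact: (measurableT_comp (@exprn_measurable R setT 2) measurable_snd).
  exact: (measurableT_comp (@measurable_invr R) m2).
have h0 z : (0 <= h z)%E by rewrite lee_fin slice_v_ge0.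
have E2 x : (\int[leb]_u f (u, x) = \int[leb]_v h (x, v))%E.
  have [x0|x0] := leP x 0.
    rewrite integral0_eq; last by move=> u _; rewrite /f /= slice_u_le0l.
    by rewrite integral0_eq => [//|v _]; rewrite /h /= slice_v_le0l.
  rewrite -integral_halfline_setT; last first.
    by move=> u; rewrite halflineE => /negP; rewrite -leNgt => u0; rewrite /f /= slice_u_le0.
  have mfx : measurable_fun setT (fun u => f (u, x)) by exact: (measurableT_comp mf (pair2_measurable x)).
  rewrite (ge0_integral_inversion x0 mfx)//.
  rewrite -[RHS]integral_halfline_setT; last first.
    by move=> v; rewrite halflineE => /negP; rewrite -leNgt => v0; rewrite /h /= slice_v_le0.
  apply: eq_integral => v; rewrite inE halflineE => v0; rewrite /f /h -EFinM.
  by rewrite slice_inversion.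
under eq_integral do rewrite E2.
have mhs : measurable_fun setT (fun z : T * T => h (z.2, z.1)).
  exact: (measurableT_comp mh (@measurable_swap _ _ _ _)).
have hs0 z : (0 <= h (z.2, z.1))%E by exact: h0.
rewrite -(@fubini_tonelli _ _ _ _ _ leb m' (fun z => h (z.2, z.1)) mhs hs0).
rewrite -integral_halfline_setT; last first.
  move=> v; rewrite halflineE => /negP; rewrite -leNgt => v0.
  by apply: integral0_eq => x _; rewrite /h /= slice_v_le0.
have mh2 : measurable_fun setT (fun v => \int[m']_x h (x, v))%E.
  exact: (@measurable_fun_fubini_tonelli_F _ _ _ _ _ m' (fun z => h (z.2, z.1)) mhs hs0).
have bB0 : 0 <= `|b| * B by rewrite mulr_ge0.
have [mCn ->] := kernel_normZ bB0 ak.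
apply: ge0_le_integral; [exact: measurable_halfline| | |exact: mCn|].
- by move=> v _; apply: integral_ge0 => x _; exact: h0.
- exact: measurable_funTS.
move=> v; rewrite halflineE => v0.
have ms : measurable_fun setT (fun x : T => (slice_v k a b x v)%:E).
  exact: (measurableT_comp mh (pair2_measurable v)).
apply: le_trans (slice_v_integral a0 v0 ms k0 (HB v v0)) _.
rewrite -EFinM lee_fin le_eqVlt; apply/orP; left; apply/eqP; ring.
Qed.

Lemma kernel_bound (a b : R) : 0 < a -> exists2 D : R, 0 <= D &
  forall m C k, 0 <= C -> growth C m -> admissible k ->
  (\int[leb]_(u in `[a, b]) \int[m]_x `|k (x / u)|%:E
    <= (C * D)%:E * kernel_norm k)%E.
Proof.
move=> a0; have [D D0 HD] := growth_segment b a0.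
exists (`|b| * D) => [|m C k C0 gm ak]; first by rewrite mulr_ge0.
rewrite (mulrCA C); apply: kernel_bound_segment => //; first by rewrite mulr_ge0.
  exact: growth_locally_finite C0 gm.
by move=> v v0; exact: HD.
Qed.

End growth.

(** * Transforms of positive measures *)
Section test_functions.
Context {R : realType}.
Implicit Types phi : R -> R.

Definition test_fun phi (a b : R) : Prop :=
  [/\ continuous phi, 0 < a & forall x, ~ `[a, b]%classic x -> phi x = 0].

Lemma test_fun_bounded phi a b : test_fun phi a b ->
  exists2 M, 0 <= M & forall x, `|phi x| <= M.
Proof.
move=> [cphi a0 phi0]; have [ab|ba] := leP a b; last first.
  by exists 0 => // x; rewrite phi0 ?normr0// set_itv_ge// bnd_simp -ltNge.
have cn : {within `[a, b], continuous (fun x => `|phi x|)}.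
  apply: continuous_subspaceT => x; apply: (@continuous_comp _ _ _ phi Num.norm).
    exact: cphi.
  exact: norm_continuous.
have [c _ Hc] := EVT_max ab cn; exists `|phi c| => // x.
have [xab|xab] := pselect (`[a, b]%classic x); first exact: Hc.
by rewrite phi0// normr0.
Qed.

Lemma test_fun_le0 phi a b x : test_fun phi a b -> x <= 0 -> phi x = 0.
Proof.
move=> [_ a0 phi0] x0; apply: phi0 => /=; rewrite in_itv/= => /andP[ax _].
by move: (lt_le_trans a0 ax); rewrite ltNge x0.
Qed.

Lemma test_fun_indic_bound phi a b M x : test_fun phi a b -> (forall x, `|phi x| <= M) ->
  `|phi x| <= M * \1_(`[a, b]%classic : set R) x.
Proof.
move=> [_ _ phi0] HM; rewrite indicE; case: (boolP (x \in _)) => xab.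
  by rewrite mulr1.
by rewrite phi0 ?normr0 ?mulr0//; move: xab; rewrite notin_setE.
Qed.

Lemma measurable_test_fun phi a b : test_fun phi a b ->
  measurable_fun [set: measurableTypeR R] (phi : measurableTypeR R -> R).
Proof. by move=> [cphi _ _]; exact: continuous_measurable_fun. Qed.

Lemma test_fun_mul_integrable phi a b (h : measurableTypeR R -> R) : test_fun phi a b ->
  measurable_fun setT h -> (@lebesgue_measure R).-integrable `[a, b] (EFin \o h) ->
  (@lebesgue_measure R).-integrable setT (fun u : measurableTypeR R => (phi u * h u)%:E).
Proof.
move=> tphi mh ih; have [M M0 HM] := test_fun_bounded tphi; have [_ a0 phi0] := tphi.
have mab : measurable (`[a, b]%classic : set (measurableTypeR R)) by exact: measurable_itv.
have := integrableZl mab M (integrable_abse ih).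
rewrite (integrable_mkcond _ mab) => I2.
apply: le_integrable I2 => //.
  by apply/measurable_EFinP; apply: measurable_funM; first exact: measurable_test_fun tphi.
move=> u _; rewrite /patch; case: ifPn => uab.
  rewrite /= lee_fin !normrM normr_id.
  by rewrite ler_wpM2r // (le_trans (HM u)) // ler_norm.
by rewrite phi0 ?mul0r//; move: uab; rewrite notin_setE.
Qed.

End test_functions.

Section transform.
Context {R : realType}.
Local Notation T := (measurableTypeR R).
Local Notation posmeasure := {measure set T -> \bar R}.
Local Notation leb := (@lebesgue_measure R).
Implicit Types (m : posmeasure) (k : T -> R) (phi : R -> R).

Definition kernel_transform k m (u : R) : R := \int[m]_x k (x / u).

Definition pairing phi k m : R := \int[leb]_u (phi u * kernel_transform k m u).

Lemma measurable_slice k (u : R) : measurable_fun setT k ->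
  measurable_fun setT (fun x : T => (k (x / u))%:E : \bar R).
Proof.
by move=> mk; exact: (measurableT_comp (measurable_ratio mk) (pair1_measurable (u : T))).
Qed.

Lemma measurable_kernel_transform k m : measurable_fun setT k -> locally_finite m ->
  measurable_fun setT (kernel_transform k m : T -> R).
Proof.
move=> mk lfm.
pose m' : {sigma_finite_measure set T -> \bar R} := sigma_finite_copy lfm.
pose f (z : T * T) : \bar R := (k (z.2 / z.1))%:E.
have mf : measurable_fun setT f by exact: measurable_ratio.
have E : kernel_transform k m = fine \o
    (fun u => \int[m']_x f^\+ (u, x) - \int[m']_x f^\- (u, x))%E.
  apply/funext => u; rewrite /kernel_transform /Rintegral /= integralE.
  by congr (fine (_ - _)%E); apply: eq_integral => x _; rewrite !(funeposE, funenegE).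
rewrite E; apply: measurableT_comp; first exact: fine_measurable.
apply: emeasurable_funB.
  exact: (@measurable_fun_fubini_tonelli_F _ _ _ _ _ m' _ (measurable_funepos mf) (funepos_ge0 f)).
exact: (@measurable_fun_fubini_tonelli_F _ _ _ _ _ m' _ (measurable_funeneg mf) (funeneg_ge0 f)).
Qed.

Lemma measurable_abs_transform k m : measurable_fun setT k -> locally_finite m ->
  measurable_fun setT (fun u : T => \int[m]_x `|k (x / u)|%:E)%E.
Proof.
move=> mk lfm.
pose m' : {sigma_finite_measure set T -> \bar R} := sigma_finite_copy lfm.
have mnk : measurable_fun setT (fun v => `|k v|) by exact: measurableT_comp.
have f0 (z : T * T) : (0 <= `|k (z.2 / z.1)|%:E)%E by rewrite lee_fin.
exact: (@measurable_fun_fubini_tonelli_F _ _ _ _ _ m' _ (measurable_ratio mnk) f0).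
Qed.

Lemma kernel_transform_le k m (u : R) : measurable_fun setT k ->
  (`|kernel_transform k m u|%:E <= \int[m]_x `|k (x / u)|%:E)%E.
Proof.
move=> mk; apply: le_trans (le_abse_integral m measurableT (measurable_slice u mk)).
rewrite /kernel_transform /Rintegral; case: (\int[m]_x _)%E => [r||] //=.
- by rewrite normr0 leey.
- by rewrite normr0 leey.
Qed.

End transform.

Section transform_growth.
Context {R : realType}.
Local Notation T := (measurableTypeR R).
Local Notation posmeasure := {measure set T -> \bar R}.
Local Notation leb := (@lebesgue_measure R).
Variable w : R -> R.
Hypothesis w_ge0 : forall x, 0 < x -> 0 <= w x.
Hypothesis w_submul : forall x y, 0 < x -> 0 < y -> w (x * y) <= w x * w y.
Implicit Types (m : posmeasure) (k : T -> R) (phi : R -> R) (C : R).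
Local Notation growth := (growth w).
Local Notation admissible := (admissible w).
Local Notation kernel_norm := (kernel_norm w).

Lemma abs_transform_lty m C k (a b : R) : 0 < a -> 0 <= C -> growth C m ->
  admissible k -> (\int[leb]_(u in `[a, b]) \int[m]_x `|k (x / u)|%:E < +oo)%E.
Proof.
move=> a0 C0 gm ak; have [D D0 HD] := kernel_bound w_ge0 w_submul b a0.
apply: le_lt_trans (HD m C k C0 gm ak) _.
by rewrite lte_mul_pinfty ?lee_fin ?mulr_ge0//; have [] := admissible_norm w_ge0 ak.
Qed.

Lemma ae_halfline (P : R -> Prop) :
  (forall a b, 0 < a -> {ae leb, forall u : R, `[a, b]%classic u -> P u}) ->
  {ae leb, forall u : R, halfline u -> P u}.
Proof.
move=> H; have := ae_foralln (fun n => H n.+1%:R^-1 n.+1%:R (ltac:(by rewrite invr_gt0))).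
apply: filterS => u Hu uh.
have [|N HN] := @halfline_segment_near _ u; first by rewrite -halflineE.
exact: Hu (HN N (leqnn N)).
Qed.

(** The double integral over each segment is finite, hence the inner integral is
    finite almost everywhere. *)
Lemma kernel_transform_ae m C k : 0 <= C -> growth C m -> admissible k ->
  {ae leb, forall u : R, 0 < u -> m.-integrable setT (fun x : T => (k (x / u))%:E)}.
Proof.
move=> C0 gm ak; have [mk k0 _] := ak.
have lfm := growth_locally_finite w_ge0 w_submul C0 gm.
have H : {ae leb, forall u : R, halfline u ->
    (\int[m]_x `|k (x / u)|%:E)%E \is a fin_num}.
  apply: ae_halfline => a b a0; apply: integrable_ae => //; apply/integrableP; split.
    by apply: measurable_funTS; exact: measurable_abs_transform.
  under eq_integral do rewrite gee0_abs ?integral_ge0//.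
  exact: abs_transform_lty gm ak.
apply: (@filterS _ (almost_everywhere leb) _ _ _ _ H) => u Hu u0.
have fin : (\int[m]_x `|k (x / u)|%:E)%E \is a fin_num by apply: Hu; rewrite halflineE.
apply/integrableP; split; first exact: measurable_slice.
by rewrite ltey_eq fin.
Qed.

Lemma integrable_kernel_transform m C k (a b : R) : 0 < a -> 0 <= C -> growth C m ->
  admissible k -> leb.-integrable `[a, b] (EFin \o kernel_transform k m).
Proof.
move=> a0 C0 gm ak; have [mk _ _] := ak.
have lfm := growth_locally_finite w_ge0 w_submul C0 gm.
apply/integrableP; split.
  by apply/measurable_EFinP; apply: measurable_funTS; exact: measurable_kernel_transform.
apply: le_lt_trans (abs_transform_lty b a0 C0 gm ak).
apply: ge0_le_integral => //.
- apply: measurableT_comp => //; apply/measurable_EFinP.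
  by apply: measurable_funTS; exact: measurable_kernel_transform.
- by apply: measurable_funTS; exact: measurable_abs_transform.
- by move=> u _; exact: kernel_transform_le.
Qed.

Lemma integrable_pairing phi a b m C k : test_fun phi a b -> 0 <= C -> growth C m ->
  admissible k -> leb.-integrable setT (fun u : T => (phi u * kernel_transform k m u)%:E).
Proof.
move=> tphi C0 gm ak; have [mk _ _] := ak; have [_ a0 _] := tphi.
apply: (test_fun_mul_integrable tphi); last exact: integrable_kernel_transform C0 gm ak.
exact: measurable_kernel_transform (growth_locally_finite w_ge0 w_submul C0 gm).
Qed.

(** The error made in replacing a kernel is uniform over all measures with the
    same growth constant. *)
Lemma pairing_bound phi a b : test_fun phi a b -> exists2 D, 0 <= D &
  forall m C k, 0 <= C -> growth C m -> admissible k ->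
    `|pairing phi k m| <= C * D * fine (kernel_norm k).
Proof.
move=> tphi; have [M M0 HM] := test_fun_bounded tphi; have [_ a0 phi0] := tphi.
have [D D0 HD] := kernel_bound w_ge0 w_submul b a0.
exists (M * D) => [|m C k C0 gm ak]; first by rewrite mulr_ge0.
have [mk _ _] := ak; have lfm := growth_locally_finite w_ge0 w_submul C0 gm.
have [_ fk] := admissible_norm w_ge0 ak.
have mab : measurable (`[a, b]%classic : set T) by exact: measurable_itv.
have Ip := integrable_pairing tphi C0 gm ak.
rewrite -lee_fin EFin_normr_Rintegral//.
apply: le_trans (le_abse_integral leb measurableT (measurable_int _ Ip)) _.
have mA := measurable_abs_transform mk lfm.
apply: (@le_trans _ _ (\int[leb]_(u in `[a, b]) (M%:E * \int[m]_x `|k (x / u)|%:E))%E).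
  rewrite [leRHS]integral_mkcond; apply: ge0_le_integral => //.
  - exact: (measurableT_comp _ (measurable_int _ Ip)).
  - apply/(measurable_restrictT _ mab).
    by apply: measurable_funeM; exact: measurable_funTS.
  move=> u _; rewrite /patch; case: ifPn => uab; last first.
    by rewrite phi0 ?mul0r ?abse0//; move: uab; rewrite notin_setE.
  rewrite abse_EFin normrM EFinM; apply: lee_pmul => //.
  - by rewrite lee_fin.
  - exact: kernel_transform_le.
rewrite ge0_integralZl//; last 2 first.
- exact: measurable_funTS.
- by move=> u _; exact: integral_ge0.
apply: le_trans (lee_wpmul2l _ (HD m C k C0 gm ak)) _; first by rewrite lee_fin.
rewrite -[kernel_norm k]fineK ?ge0_fin_numE ?kernel_norm_ge0//= -!EFinM lee_fin.
by rewrite le_eqVlt; apply/orP; left; apply/eqP; ring.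
Qed.

End transform_growth.

(** * Bounded kernels and dual test functions *)
Section bounded_kernel.
Context {R : realType}.
Local Notation T := (measurableTypeR R).
Local Notation posmeasure := {measure set T -> \bar R}.
Local Notation leb := (@lebesgue_measure R).
Implicit Types (m : posmeasure) (k : T -> R) (phi F : R -> R).

Lemma integral_inversion (t : R) F : 0 < t ->
  measurable_fun setT (F : T -> R) ->
  (\int[leb]_(u in halfline) (F u)%:E =
   \int[leb]_(v in halfline) (F (t / v) * (t / v ^+ 2))%:E)%E.
Proof.
move=> t0 mF; have mFE : measurable_fun (setT : set T) (EFin \o F) by exact/measurable_EFinP.
rewrite [LHS]integralE [RHS]integralE.
rewrite (ge0_integral_inversion t0 (measurable_funepos mFE) (funepos_ge0 _)).
rewrite (ge0_integral_inversion t0 (measurable_funeneg mFE) (funeneg_ge0 _)).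
have g0 v : 0 <= t / v ^+ 2 by rewrite divr_ge0 ?exprn_even_ge0// ltW.
congr (_ - _)%E; apply: eq_integral => v _.
  by rewrite !funeposE /= -!EFin_max -EFinM maxr_pMl ?mul0r//; exact: g0.
by rewrite !funenegE /= -!EFin_max -EFinM maxr_pMl ?mul0r ?mulNr//; exact: g0.
Qed.

Definition bounded_kernel k (B c d : R) : Prop :=
  [/\ measurable_fun setT k, 0 < c, (forall v, `|k v| <= B) &
    forall v, ~ `[c, d]%classic v -> k v = 0].

(** The pairing of phi with the transform of m is the integral against m of this
    function, and for a bounded kernel supported in a segment it is again a test
    function; this is what makes wide convergence applicable. *)
Definition dual_test phi k (x : R) : R :=
  \int[leb]_v (phi (x / v) * k v * (x / v ^+ 2)).

Section dual_test.
Variables (phi : R -> R) (k : T -> R) (a b B c d : R).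
Hypotheses (tphi : test_fun phi a b) (bk : bounded_kernel k B c d).

Lemma bounded_kernel_le0 v : v <= 0 -> k v = 0.
Proof.
have [_ c0 _ k0] := bk; move=> v0; apply: k0 => /=; rewrite in_itv/= => /andP[cv _].
by move: (lt_le_trans c0 cv); rewrite ltNge v0.
Qed.

Lemma dual_integrand_le (M e x v : R) : 0 <= e -> (forall x, `|phi x| <= M) -> `|x| <= e ->
  `|phi (x / v) * k v * (x / v ^+ 2)| <=
    (M * B * (e / c ^+ 2)) * \1_(`[c, d]%classic : set R) v.
Proof.
move=> e0 HM xe; have [_ c0 kB k0] := bk; rewrite indicE; case: (boolP (v \in _)) => vcd.
  have M0 : 0 <= M := le_trans (normr_ge0 _) (HM 0).
  have B0 : 0 <= B := le_trans (normr_ge0 _) (kB 0).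
  move: vcd; rewrite inE/= in_itv/= => /andP[cv _].
  have v0 : 0 < v := lt_le_trans c0 cv.
  rewrite mulr1 !normrM; apply: ler_pM; rewrite ?mulr_ge0//.
    by apply: ler_pM.
  apply: ler_pM => //; rewrite normfV ger0_norm ?exprn_even_ge0//.
  by rewrite lef_pV2 ?posrE ?exprn_gt0// ler_pXn2r ?nnegrE// ltW.
by rewrite k0 ?(mulr0, mul0r, normr0)//; move: vcd; rewrite notin_setE.
Qed.

Lemma measurable_dual_integrand (x : R) :
  measurable_fun setT (fun v : T => phi (x / v) * k v * (x / v ^+ 2)).
Proof.
have [mk _ _ _] := bk.
apply: measurable_funM; last exact: measurable_div_sqr.
apply: measurable_funM => //.
exact: (measurableT_comp (measurable_test_fun tphi) (@measurable_divr R x)).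
Qed.

Lemma dual_integrand_dominated (e : R) : 0 <= e -> exists2 g : T -> R,
  leb.-integrable setT (EFin \o g) &
  forall x v, `|x| <= e -> `|phi (x / v) * k v * (x / v ^+ 2)| <= g v.
Proof.
move=> e0; have [M M0 HM] := test_fun_bounded tphi.
exists (fun v => (M * B * (e / c ^+ 2)) * \1_(`[c, d]%classic : set R) v).
  have := integrableZl measurableT (M * B * (e / c ^+ 2)) (integrable_indic_itv c d true false).
  by apply: eq_integrable => // v _ /=; rewrite EFinM.
by move=> x v xe; exact: dual_integrand_le.
Qed.

Lemma integrable_dual_integrand (x : R) :
  leb.-integrable setT (EFin \o (fun v : T => phi (x / v) * k v * (x / v ^+ 2))).
Proof.
have [g ig Hg] := dual_integrand_dominated (normr_ge0 x).
apply: le_integrable ig => //.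
  by apply/measurable_EFinP; exact: measurable_dual_integrand.
move=> v _ /=; rewrite lee_fin; apply: le_trans (Hg x v (lexx _)) _; exact: ler_norm.
Qed.

(** Continuity holds by domination. If phi(x / v) k(v) <> 0 then x = (x / v) v
    lies between a c and b d. *)
Lemma test_fun_dual_test : test_fun (dual_test phi k) (a * c) (b * d).
Proof.
have [cphi a0 phi0] := tphi; have [mk c0 kB k0] := bk; split.
- move=> x; have e0 : 0 <= `|x| + 1 by rewrite addr_ge0.
  have [g ig Hg] := dual_integrand_dominated e0.
  have xI : x \in `](x - 1), (x + 1)[%classic.
    by rewrite inE/= in_itv/=; apply/andP; split; lra.
  have HI y : `](x - 1), (x + 1)[%classic y -> `|y| <= `|x| + 1.
    rewrite /= in_itv/= => /andP[xy yx].
    rewrite -[y](subrK x) (le_trans (ler_normD _ _))// addrC lerD2l ler_norml.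
    by rewrite lerBrDl (ltW xy)/= lerBlDl ltW.
  have := @continuity_under_integral R _ T leb
    (fun y v => phi (y / v) * k v * (y / v ^+ 2)) setT measurableT (x - 1) (x + 1) _ _ g ig _ x xI.
  apply.
  + by move=> y _; exact: integrable_dual_integrand.
  + apply: aeW => v _ y _; apply: cvgM; [apply: cvgM|].
    * have cd : (fun z : R => z / v) @ y --> y / v.
        by apply: cvgM; [exact: cvg_id|exact: cvg_cst].
      exact: (cvg_comp _ _ cd (cphi (y / v))).
    * exact: cvg_cst.
    * by apply: cvgM; [exact: cvg_id|exact: cvg_cst].
  + by move=> y yI; apply: aeW => v _; apply: Hg; exact: HI.
- by rewrite mulr_gt0.
move=> x xab; rewrite /dual_test /Rintegral integral0_eq// => v _; congr (_%:E).
have [vcd|vcd] := pselect (`[c, d]%classic v); last by rewrite k0// mulr0 mul0r.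
move: vcd => /=; rewrite in_itv/= => /andP[cv vd].
have v0 : 0 < v := lt_le_trans c0 cv.
rewrite phi0 ?mul0r// => /=; rewrite in_itv/= ler_pdivlMr// ler_pdivrMr// => /andP[ax xb].
apply: xab; rewrite /= in_itv/=; apply/andP; split.
  by apply: le_trans ax; rewrite ler_pM2l.
apply: (le_trans xb); rewrite ler_wpM2l//.
have x0 : 0 < x by apply: lt_le_trans ax; rewrite mulr_gt0.
have := lt_le_trans x0 xb; by rewrite pmulr_lgt0// => /ltW.
Qed.

Lemma integral_dual_test (x : R) :
  (\int[leb]_u (phi u * k (x / u))%:E = (dual_test phi k x)%:E)%E.
Proof.
have [mk _ _ _] := bk.
have -> : ((dual_test phi k x)%:E =
    \int[leb]_v (phi (x / v) * k v * (x / v ^+ 2))%:E)%E.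
  rewrite /dual_test /Rintegral fineK//.
  by apply: integrable_fin_num => //; exact: integrable_dual_integrand.
have [x0|x0] := leP x 0.
  rewrite !integral0_eq// => v _; congr (_%:E); have [v0|v0] := leP v 0.
  - by rewrite bounded_kernel_le0// mulr0 mul0r.
  - rewrite (test_fun_le0 tphi) ?mul0r// mulr_le0_ge0// invr_ge0; exact: ltW.
  - by rewrite (test_fun_le0 tphi)// mul0r.
  - by rewrite bounded_kernel_le0 ?mulr0// mulr_le0_ge0// invr_ge0 ltW.
rewrite -integral_halfline_setT; last first.
  move=> u; rewrite halflineE => /negP; rewrite -leNgt => u0.
  by rewrite (test_fun_le0 tphi)// mul0r.
have mF : measurable_fun setT (fun u : T => phi u * k (x / u)).
  apply: measurable_funM; first exact: (measurable_test_fun tphi).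
  exact: (measurableT_comp mk (@measurable_divr R x)).
rewrite (integral_inversion x0 mF) -[RHS]integral_halfline_setT; last first.
  move=> v; rewrite halflineE => /negP; rewrite -leNgt => v0.
  by rewrite bounded_kernel_le0// mulr0 mul0r.
apply: eq_integral => v; rewrite inE halflineE => v0.
by congr (_ * k _ * _)%:E; field; rewrite !gt_eqF.
Qed.

End dual_test.

End bounded_kernel.

(** * Truncation of the kernel *)
Section truncation.
Context {R : realType}.
Local Notation T := (measurableTypeR R).
Local Notation posmeasure := {measure set T -> \bar R}.
Local Notation leb := (@lebesgue_measure R).
Variable w : R -> R.
Hypothesis w_ge0 : forall x, 0 < x -> 0 <= w x.
Hypothesis w_submul : forall x y, 0 < x -> 0 < y -> w (x * y) <= w x * w y.
Implicit Types (m : posmeasure) (k : T -> R) (phi : R -> R) (C : R).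
Local Notation growth := (growth w).
Local Notation admissible := (admissible w).
Local Notation kernel_norm := (kernel_norm w).

Lemma admissible_indic k (A : set T) : measurable A -> admissible k ->
  admissible (fun v => k v * \1_A v).
Proof.
move=> mA [mk k0 ik].
have mi D : measurable_fun D (\1_A : T -> R) by exact: measurable_indic.
split.
- exact: measurable_funM.
- by move=> v v0; rewrite k0// mul0r.
have /measurable_EFinP mi' := measurable_int _ ik.
apply: le_integrable ik; first exact: measurable_halfline.
  apply/measurable_EFinP.
  rewrite (_ : (fun v => _) = (fun v => (k v * (w v / v)) * \1_A v)); last first.
    by apply/funext => v; rewrite mulrAC.
  exact: measurable_funM.
move=> v _ /=; rewrite lee_fin !normrM ler_wpM2r ?mulr_ge0// ler_piMr//.
by rewrite indicE; case: (_ \in _); rewrite ?normr1 ?normr0.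
Qed.

(** The transform is additive in the kernel only where both transforms converge,
    that is almost everywhere. *)
Lemma pairing_split phi a b m C k k1 k2 : test_fun phi a b -> 0 <= C -> growth C m ->
  admissible k -> admissible k1 -> admissible k2 -> (forall v, k v = k1 v + k2 v) ->
  pairing phi k m = pairing phi k1 m + pairing phi k2 m.
Proof.
move=> tphi C0 gm ak ak1 ak2 kE.
have I := integrable_pairing w_ge0 w_submul tphi C0 gm.
rewrite /pairing -RintegralD//; [|exact: I..].
congr fine; apply: ae_eq_integral => //.
- exact: measurable_int _ (I _ ak).
- exact: (measurable_int _ (integrableD measurableT (I _ ak1) (I _ ak2))).
have h1 := kernel_transform_ae w_ge0 w_submul C0 gm ak1.
have h2 := kernel_transform_ae w_ge0 w_submul C0 gm ak2.
apply: (@filterS2 _ (almost_everywhere leb) _ _ _ _ _ h1 h2) => u i1 i2 _; congr (_%:E); rewrite -mulrDr.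
have [u0|u0] := leP u 0; first by rewrite (test_fun_le0 tphi)// !mul0r.
congr (_ * _); rewrite /kernel_transform -RintegralD//; [|exact: i1|exact: i2].
by apply: eq_Rintegral => x _; exact: kE.
Qed.

(** For a bounded kernel supported in a segment all integrals converge
    absolutely, so Fubini applies without exceptional sets. *)
Lemma pairing_dual phi a b m C k B c d : test_fun phi a b -> 0 <= C -> growth C m ->
  admissible k -> bounded_kernel k B c d ->
  pairing phi k m = \int[m]_x dual_test phi k x.
Proof.
move=> tphi C0 gm ak bk; have [mk c0 kB k0] := bk.
have lfm := growth_locally_finite w_ge0 w_submul C0 gm.
have [M M0 HM] := test_fun_bounded tphi; have [_ a0 phi0] := tphi.
pose m' : {sigma_finite_measure set T -> \bar R} := sigma_finite_copy lfm.
pose f (z : T * T) : \bar R := (phi z.1 * k (z.2 / z.1))%:E.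
have mphi := measurable_test_fun tphi.
have mf : measurable_fun setT f.
  apply/measurable_EFinP; apply: measurable_funM.
    exact: (measurableT_comp mphi measurable_fst).
  by apply/measurable_EFinP; exact: measurable_ratio.
have inner u : (\int[m']_x f (u, x) = (phi u * kernel_transform k m u)%:E)%E.
  rewrite /f /=; have [u0|u0] := leP u 0.
    rewrite (test_fun_le0 tphi)// mul0r integral0_eq// => x _.
    by rewrite mul0r.
  have iku : m.-integrable setT (fun x : T => (k (x / u))%:E).
    have mI : measurable (`[c * u, d * u]%classic : set T) by exact: measurable_itv.
    have iI : m.-integrable setT (EFin \o (\1_(`[c * u, d * u]%classic : set T) : T -> R)).
      by apply: integrable_indic_finite => //; apply: lfm.2; exact: mulr_gt0.
    apply: le_integrable (integrableZl measurableT B iI) => //; first exact: measurable_slice.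
    move=> x _ /=; rewrite lee_fin indicE; case: (boolP (x \in _)) => xcd.
      by rewrite mulr1 (le_trans (kB _))// ler_norm.
    rewrite k0 ?normr0// => /=; rewrite in_itv/= ler_pdivlMr// ler_pdivrMr//.
    by move: xcd; rewrite notin_setE/= in_itv.
  under eq_integral do rewrite EFinM.
  rewrite integralZl// EFinM; congr (_ * _)%E; rewrite /kernel_transform /Rintegral fineK//.
  exact: integrable_fin_num.
have If : (leb \x m')%E.-integrable setT f.
  apply/integrable12ltyP => //.
  have mnk : measurable_fun setT (fun v => `|k v|) by exact: measurableT_comp.
  have maf : measurable_fun setT (abse \o f) by exact: measurableT_comp.
  have haf z : (0 <= (abse \o f) z)%E by exact: abse_ge0.
  have mab : measurable (`[a, b]%classic : set T) by exact: measurable_itv.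
  have mA := measurable_abs_transform mk lfm.
  have mAM : measurable_fun (`[a, b]%classic : set T)
      (fun u : T => M%:E * \int[m]_x `|k (x / u)|%:E)%E.
    by apply: measurable_funeM; exact: measurable_funTS.
  apply: (@le_lt_trans _ _ (\int[leb]_(u in `[a, b]) (M%:E * \int[m]_x `|k (x / u)|%:E))%E).
    rewrite [leRHS]integral_mkcond; apply: ge0_le_integral => //.
    - by move=> u _; exact: integral_ge0.
    - exact: (@measurable_fun_fubini_tonelli_F _ _ _ _ _ m' (abse \o f) maf haf).
    - by apply/(measurable_restrictT _ mab).
    move=> u _; rewrite /patch; case: ifPn => uab; last first.
      rewrite integral0_eq// => x _; rewrite /f/= phi0 ?mul0r ?normr0//.
      by move: uab; rewrite notin_setE.
    have mks := measurable_slice u mnk.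
    rewrite -(ge0_integralZl m measurableT mks)//.
    apply: ge0_le_integral => //.
    - exact: (measurableT_comp maf (pair1_measurable (u : T))).
    - exact: measurable_funeM.
    by move=> x _; rewrite /f/= lee_fin normrM ler_wpM2r.
  rewrite ge0_integralZl//; last 2 first.
  - exact: measurable_funTS.
  - by move=> u _; exact: integral_ge0.
  rewrite lte_mul_pinfty ?lee_fin//.
  exact: (abs_transform_lty w_ge0 w_submul b a0 C0 gm ak).
rewrite /pairing /Rintegral; congr fine.
transitivity (\int[leb]_u \int[m']_x f (u, x))%E.
  by apply: eq_integral => u _; rewrite inner.
by rewrite (Fubini If); apply: eq_integral => x _; exact: integral_dual_test tphi bk _.
Qed.

(** Both the values of the kernel and its support are bounded on this set, so that
    the truncated kernel falls under [pairing_dual]. *)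
Definition cutoff k (N : nat) : set T :=
  `[N.+1%:R^-1, N.+1%:R]%classic `&` [set v | `|k v| <= N%:R].

Definition truncation k (N : nat) (v : T) : R := k v * \1_(cutoff k N) v.

Definition remainder k (N : nat) (v : T) : R := k v * \1_(~` cutoff k N) v.

Lemma truncation_remainder k N v : k v = truncation k N v + remainder k N v.
Proof.
rewrite /truncation /remainder -mulrDr !indicE in_setC.
by case: (_ \in _); rewrite ?addr0 ?add0r mulr1.
Qed.

Lemma measurable_cutoff k N : measurable_fun setT k -> measurable (cutoff k N).
Proof.
move=> mk; apply: measurableI; first exact: measurable_itv.
rewrite (_ : [set v | _] = (fun v => `|k v|) @^-1` `]-oo, N%:R]).
  rewrite -[X in measurable X]setTI; apply: (measurableT_comp (@normr_measurable R setT) mk) => //.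
by apply/seteqP; split=> v /=; rewrite in_itv.
Qed.

Lemma bounded_truncation k N : measurable_fun setT k ->
  bounded_kernel (truncation k N) N%:R N.+1%:R^-1 N.+1%:R.
Proof.
move=> mk; split.
- by apply: measurable_funM => //; apply: measurable_indic; exact: measurable_cutoff.
- by rewrite invr_gt0.
- move=> v; rewrite /truncation indicE; case: (boolP (v \in _)); last by rewrite mulr0 normr0.
  by rewrite mulr1 inE => -[].
move=> v nv; rewrite /truncation indicE memNset ?mulr0// => -[+ _]; exact: nv.
Qed.

Lemma admissible_truncation k N : admissible k -> admissible (truncation k N).
Proof.
by move=> ak; apply: admissible_indic => //; apply: measurable_cutoff; have [] := ak.
Qed.

Lemma admissible_remainder k N : admissible k -> admissible (remainder k N).
Proof.
move=> ak; apply: admissible_indic => //; apply: measurableC.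
by apply: measurable_cutoff; have [] := ak.
Qed.

(** Each v > 0 is eventually in the cut-off set, and the norm of k dominates. *)
Lemma kernel_norm_remainder k : admissible k ->
  fine (kernel_norm (remainder k N)) @[N --> \oo] --> (0 : R).
Proof.
move=> ak; have [mk k0 ik] := ak; have [mn fk] := admissible_norm w_ge0 ak.
pose f_ N v : \bar R := (`|remainder k N v| * (w v / v))%:E.
have mf_ N : measurable_fun halfline (f_ N).
  by have [] := admissible_norm w_ge0 (admissible_remainder N ak).
have wv0 v : halfline v -> 0 <= w v / v.
  by rewrite halflineE => v0; rewrite divr_ge0 ?w_ge0// ltW.
have ig : leb.-integrable halfline (fun v => (`|k v| * (w v / v))%:E).
  apply/integrableP; split => //; apply: le_lt_trans fk; rewrite /kernel_norm.
  rewrite le_eqVlt; apply/orP; left; apply/eqP; apply: eq_integral => v; rewrite inE => vh.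
  by rewrite gee0_abs// lee_fin mulr_ge0// wv0.
have [] := @dominated_convergence _ T R leb halfline measurable_halfline f_ (cst 0%E) _
  mf_ _ _ ig _.
- exact: measurable_cst.
- apply: aeW => v vh; apply: cvg_near_cst.
  have [|N0 HN] := @halfline_segment_near _ v; first by rewrite -halflineE.
  exists (maxn N0 (Num.truncn `|k v|).+1) => // N /=; rewrite geq_max => /andP[N1 N2].
  rewrite /f_ /remainder indicE memNset ?mulr0 ?normr0 ?mul0r//; apply; split; first exact: HN.
  by apply/ltW/(lt_le_trans (truncnS_gt _)); rewrite ler_nat.
- apply: aeW => v N vh; rewrite /f_ abse_EFin lee_fin normrM (ger0_norm (wv0 _ vh)).
  rewrite ler_wpM2r ?wv0// normr_id /remainder normrM ler_piMr//.
  by rewrite indicE; case: (_ \in _); rewrite ?normr1 ?normr0.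
move=> _ _; rewrite integral0 => /fine_cvg; exact.
Qed.

Lemma pairing_truncation phi a b k : test_fun phi a b -> admissible k ->
  exists2 D, 0 <= D & forall m C N, 0 <= C -> growth C m ->
    `|pairing phi k m - pairing phi (truncation k N) m| <=
      C * D * fine (kernel_norm (remainder k N)).
Proof.
move=> tphi ak; have [D D0 HD] := pairing_bound w_ge0 w_submul tphi.
exists D => // m C N C0 gm.
have at_ := admissible_truncation N ak; have ar := admissible_remainder N ak.
rewrite (pairing_split tphi C0 gm ak at_ ar (truncation_remainder k N)).
by rewrite addrAC subrr add0r; exact: HD.
Qed.

Lemma pairing_truncation_cvg phi a b m C k : test_fun phi a b -> admissible k ->
  0 <= C -> growth C m ->
  pairing phi (truncation k N) m @[N --> \oo] --> pairing phi k m.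
Proof.
move=> tphi ak C0 gm; have [D D0 HD] := pairing_truncation tphi ak.
apply/cvgrPdist_le => e e0.
have H0 : C * D * fine (kernel_norm (remainder k N)) @[N --> \oo] --> (0 : R).
  rewrite -(mulr0 (C * D)); apply: cvgM; first exact: cvg_cst.
  exact: kernel_norm_remainder.
have /cvgrPdist_le/(_ e e0) := H0; apply: filterS => N; rewrite sub0r normrN => HN.
apply: le_trans (HD m C N C0 gm) _; apply: le_trans HN; exact: ler_norm.
Qed.

End truncation.

(** * Continuity and homogeneity of the pairing *)
Section test_integral.
Context {R : realType}.
Local Notation T := (measurableTypeR R).
Local Notation posmeasure := {measure set T -> \bar R}.
Implicit Types (m : posmeasure) (phi : R -> R).

Lemma test_fun_integrable phi a b m : test_fun phi a b -> locally_finite m ->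
  m.-integrable setT (EFin \o (phi : T -> R)).
Proof.
move=> tphi lfm; have [M M0 HM] := test_fun_bounded tphi; have [_ a0 phi0] := tphi.
have mI : measurable (`[a, b]%classic : set T) by exact: measurable_itv.
have iI : m.-integrable setT (EFin \o (\1_(`[a, b]%classic : set T) : T -> R)).
  by apply: integrable_indic_finite => //; exact: lfm.2.
apply: le_integrable (integrableZl measurableT M iI) => //.
  by apply/measurable_EFinP; exact: measurable_test_fun tphi.
move=> x _ /=; rewrite lee_fin; apply: le_trans (test_fun_indic_bound x tphi HM) _.
exact: ler_norm.
Qed.

Lemma test_fun_dilate phi a b t : 0 < t -> test_fun phi a b ->
  test_fun (fun x => phi (x / t)) (a * t) (b * t).
Proof.
move=> t0 [cphi a0 phi0]; split; last 2 first.
- exact: mulr_gt0.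
- move=> x nx; apply: phi0 => h; apply: nx; move: h => /=.
  by rewrite !in_itv/= ler_pdivlMr// ler_pdivrMr.
move=> x; have cd : (fun z : R => z / t) @ x --> x / t.
  by apply: cvgM; [exact: cvg_id|exact: cvg_cst].
exact: (cvg_comp _ _ cd (cphi (x / t))).
Qed.

Lemma Rintegral_mscale (c : {nonneg R}) m (f : T -> R) : m.-integrable setT (EFin \o f) ->
  \int[mscale c m]_x f x = c%:num * \int[m]_x f x.
Proof.
move=> fi; have mf := measurable_int _ fi; rewrite /Rintegral integralE.
rewrite ge0_integral_mscale//; last exact: measurable_funepos.
rewrite ge0_integral_mscale//; last exact: measurable_funeneg.
rewrite [in RHS]integralE.
have := integrable_pos_fin_num measurableT fi.
have := integrable_neg_fin_num measurableT fi.
rewrite /= => /fineK <- /fineK <-.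
by rewrite -!EFinM -!EFinB/= mulrBr.
Qed.

Lemma Rintegral_rscale rho (t : R) m phi a b : 0 < t -> test_fun phi a b ->
  locally_finite m ->
  \int[rscale rho t m]_x phi x = (V rho t)^-1 * \int[m]_x phi (x / t).
Proof.
move=> t0 tphi lfm.
have mphi := measurable_test_fun tphi.
have mdiv : measurable_fun setT (fun x : T => x / t : T) by exact: mulrr_measurable.
have i1 : m.-integrable setT ((EFin \o (phi : T -> R)) \o (fun x : T => x / t : T)).
  exact: test_fun_integrable (test_fun_dilate t0 tphi) lfm.
have mE : measurable_fun setT (EFin \o (phi : T -> R)) by exact/measurable_EFinP.
have i2 : (dilation m t : posmeasure).-integrable setT (EFin \o (phi : T -> R)).
  exact: (integrable_pushforward mdiv mE i1 measurableT).
rewrite /rscale Rintegral_mscale//=; congr (_ * fine _).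
exact: (integral_pushforward mdiv mE i1 measurableT).
Qed.

Lemma rscale_segment rho (t x y : R) m : 0 < t ->
  rscale rho t m `[x, y]%classic =
    ((V rho t)^-1%:E * m `[(x * t)%R, (y * t)%R]%classic)%E.
Proof.
move=> t0; rewrite /rscale /= /mscale /= /dilation /pushforward; congr (_ * m _)%E.
by apply/seteqP; split=> z /=; rewrite !in_itv/= ler_pdivlMr// ler_pdivrMr.
Qed.

Lemma rscale_null rho (t : R) m : 0 < t -> m (~` halfline) = 0%E ->
  rscale rho t m (~` halfline) = 0%E.
Proof.
move=> t0 m0; rewrite /rscale /= /mscale /= /dilation /pushforward.
rewrite (_ : _ @^-1` _ = ~` halfline) ?m0 ?mule0//.
by apply/seteqP; split=> z /=; rewrite !halflineE pmulr_lgt0 ?invr_gt0.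
Qed.

End test_integral.

Section pairing_convergence.
Context {R : realType}.
Local Notation T := (measurableTypeR R).
Local Notation posmeasure := {measure set T -> \bar R}.
Variable w : R -> R.
Hypothesis w_ge0 : forall x, 0 < x -> 0 <= w x.
Hypothesis w_submul : forall x y, 0 < x -> 0 < y -> w (x * y) <= w x * w y.
Implicit Types (m : posmeasure) (k : T -> R) (phi : R -> R) (C : R).

Lemma four_approximations (d p p' n n' q q' r r' : R) :
  `|p - p'| <= d -> `|n - n'| <= d -> `|q - q'| <= d -> `|r - r'| <= d ->
  `|p' - n' - (q' - r')| <= d -> `|p - n - (q - r)| <= d + d + d + d + d.
Proof.
rewrite (distrC n) (distrC q) => hp hn hq hr h.
rewrite (_ : p - n - (q - r) =
  (p - p') + (n' - n) + (q' - q) + (r - r') + (p' - n' - (q' - r'))); last by ring.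
by do 4![apply: (le_trans (ler_normD _ _)); apply: lerD => //].
Qed.

(** Truncating the kernel costs an error which is uniform in n, and for a
    truncated kernel the pairing is the integral of a fixed test function. *)
Lemma pairing_cvg (p_ n_ : nat -> posmeasure) (p n : posmeasure) C :
  0 <= C ->
  (\forall i \near \oo, growth w C (p_ i) /\ growth w C (n_ i)) ->
  growth w C p -> growth w C n ->
  (forall psi a b, test_fun psi a b ->
     \int[p_ i]_x psi x - \int[n_ i]_x psi x @[i --> \oo] -->
     \int[p]_x psi x - \int[n]_x psi x) ->
  forall phi a b k, test_fun phi a b -> admissible w k ->
  pairing phi k (p_ i) - pairing phi k (n_ i) @[i --> \oo] -->
  pairing phi k p - pairing phi k n.
Proof.
move=> C0 g_ gp gn cvg phi a b k tphi ak.
have [D D0 HD] := pairing_truncation w_ge0 w_submul tphi ak.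
apply/cvgrPdist_le => e e0.
(* Four truncation errors and the distance of the truncated pairings. *)
have e5 : 0 < e / 5 by rewrite divr_gt0.
have H0 : C * D * fine (kernel_norm w (remainder k N)) @[N --> \oo] --> (0 : R).
  rewrite -(mulr0 (C * D)); apply: cvgM; first exact: cvg_cst.
  exact: kernel_norm_remainder.
have /cvgrPdist_le/(_ _ e5)[N _ /(_ N (leqnn N))] := H0.
rewrite /= sub0r normrN => HN.
have {}HD m : growth w C m -> `|pairing phi k m - pairing phi (truncation k N) m| <= e / 5.
  by move=> gm; apply: le_trans (HD m C N C0 gm) (le_trans (ler_norm _) HN).
have [mk _ _] := ak; have bk := bounded_truncation N mk.
have atr := admissible_truncation N ak.
have dualE m : growth w C m ->
    pairing phi (truncation k N) m = \int[m]_x dual_test phi (truncation k N) x.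
  by move=> gm; exact: (pairing_dual w_ge0 w_submul tphi C0 gm atr bk).
have /cvgrPdist_le/(_ _ e5) := cvg _ _ _ (test_fun_dual_test tphi bk).
move: g_; apply: filterS2 => i [gpi gni].
rewrite -!dualE// => Hi.
rewrite (_ : e = e / 5 + e / 5 + e / 5 + e / 5 + e / 5); last by field.
exact: four_approximations (HD _ gp) (HD _ gn) (HD _ gpi) (HD _ gni) Hi.
Qed.

(** Dual test functions satisfy H_(phi(. / t))(x) = t H_phi(x / t), which gives
    the identity for truncated kernels; the general case is the limit. *)
Lemma pairing_scale rho (t : R) phi a b m C C' k : 0 < t -> test_fun phi a b ->
  0 <= C -> 0 <= C' -> growth w C m -> growth w C' (rscale rho t m) -> admissible w k ->
  V rho t != 0 ->
  pairing (fun x => phi (x / t)) k m = t * V rho t * pairing phi k (rscale rho t m).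
Proof.
move=> t0 tphi C0 C'0 gm gm' ak Vt0.
have tphi' := test_fun_dilate t0 tphi.
have lfm := growth_locally_finite w_ge0 w_submul C0 gm.
have h1 := pairing_truncation_cvg w_ge0 w_submul tphi' ak C0 gm.
have h2 := pairing_truncation_cvg w_ge0 w_submul tphi ak C'0 gm'.
have {}h2 : t * V rho t * pairing phi (truncation k N) (rscale rho t m) @[N --> \oo] -->
    t * V rho t * pairing phi k (rscale rho t m).
  by apply: cvgM => //; exact: cvg_cst.
suff h3 : pairing (fun x => phi (x / t)) (truncation k N) m @[N --> \oo] -->
    t * V rho t * pairing phi k (rscale rho t m) by exact: (norm_cvg_unique h1 h3).
apply: cvg_trans h2; apply: near_eq_cvg; apply: nearW => N.
have [mk _ _] := ak; have bk := bounded_truncation N mk.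
have atr := admissible_truncation N ak.
rewrite (pairing_dual w_ge0 w_submul tphi' C0 gm atr bk).
rewrite (pairing_dual w_ge0 w_submul tphi C'0 gm' atr bk).
have tH := test_fun_dual_test tphi bk.
rewrite (Rintegral_rscale rho t0 tH lfm) mulrA mulfK//.
rewrite -RintegralZl//; last exact: test_fun_integrable (test_fun_dilate t0 tH) lfm.
apply: eq_Rintegral => x _; rewrite /dual_test.
rewrite -RintegralZl//; last exact: integrable_dual_integrand tphi bk _.
apply: eq_Rintegral => v _.
rewrite (_ : x / t / v = x / v / t); last by rewrite mulrAC.
by move: (phi _) (v ^- 2) => p i; field; rewrite gt_eqF.
Qed.

End pairing_convergence.

Section rscale_growth.
Context {R : realType}.
Local Notation T := (measurableTypeR R).
Local Notation posmeasure := {measure set T -> \bar R}.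
Variable rho : R -> R.
Hypothesis hrho : proximate_order rho.
Variables (m : posmeasure) (C : R).
Hypotheses (C0 : 0 <= C) (m0 : m (~` halfline) = 0%E).
Hypothesis mV : forall x, 0 < x -> (m `[x, (expR 1 * x)%R]%classic <= (C * V rho x)%:E)%E.

Lemma growth_V : growth (weight rho) C m.
Proof.
split=> // x x0; apply: le_trans (mV x0) _; rewrite lee_fin ler_wpM2l//.
by have := V_le_weight hrho ltr01 x0; rewrite mul1r /V powR1 mulr1.
Qed.

(** m([t x, e t x]) <= C V(t x) <= C w(x) V(t). *)
Lemma growth_rscale t : 0 < t -> growth (weight rho) C (rscale rho t m).
Proof.
move=> t0; split; first exact: rscale_null.
move=> x x0; rewrite rscale_segment// -mulrA.
have xt0 : 0 < x * t by exact: mulr_gt0.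
apply: (@le_trans _ _ ((V rho t)^-1%:E * (C * V rho (x * t))%:E)%E).
  by apply: lee_wpmul2l; [rewrite lee_fin invr_ge0 ltW// V_gt0|exact: mV].
rewrite -EFinM lee_fin ler_pdivrMl ?V_gt0// mulrCA ler_wpM2l//.
by rewrite mulrC (mulrC (V rho t)); exact: V_le_weight.
Qed.

End rscale_growth.

(** * Helly selection on the line *)
Section extraction.
Context {R : realType}.

(** A pointwise bounded sequence of functions on a countable set: by Tychonoff
    the sequence has a cluster point z in the product topology, and the j-th
    index is chosen close to z at the first j points. *)
Lemma pointwise_extraction (I : countType) (x : nat -> I -> R) (B : I -> R) :
  (forall n i, `|x n i| <= B i) ->
  exists eta : nat -> nat, (forall j, (j <= eta j)%N) /\
    exists z : I -> R, forall i, x (eta j) i @[j --> \oo] --> z i.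
Proof.
move=> xB.
pose A (i : I) : set R := `[- B i, B i]%classic.
have cA : compact [set f : prod_topology (fun _ : I => R) | forall i, A i (f i)].
  by apply: (@tychonoff I (fun _ => R) A) => i; exact: segment_compact.
pose X n : prod_topology (fun _ : I => R) := x n.
have [|z [_ clz]] := cA (X @ \oo) _.
  by exists 0%N => // n _ i /=; rewrite /A/= in_itv/= -ler_norml.
have near_z (j : nat) : exists n, (j <= n)%N /\
    forall i, (pickle i <= j)%N -> `|z i - x n i| < j.+1%:R^-1.
  pose P (l : 'I_j.+1) (f : prod_topology (fun _ : I => R)) : Prop :=
    match @unpickle I l with Some i => `|z i - f i| < j.+1%:R^-1 | None => True end.
  have nU : \forall f \near nbhs z, forall l, P l f.
    apply: filter_forall => l; rewrite /P; case: (unpickle _) => [i|]; last exact: nearW.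
    have pc : (fun f : prod_topology (fun _ : I => R) => f i : R) @ nbhs z --> (z i : R).
      exact: (@proj_continuous I (fun _ => R) i z).
    have e0 : (0 : R) < j.+1%:R^-1 by rewrite invr_gt0.
    have := @cvgr_dist_lt _ _ _ _ _ _ _ pc _ e0.
    exact.
  have [|y [[n jn <-] Uy]] := clz (X @` [set n | (j <= n)%N]) _ _ nU.
    by exists j => // n jn; exists n.
  exists n; split=> // i ij; have := Uy (Ordinal (ij : (pickle i < j.+1)%N)).
  by rewrite /P /= pickleK.
have [eta Heta] := choice near_z.
exists eta; split=> [j|]; first by have [] := Heta j.
exists z => i; apply/cvgrPdist_lt => e e0.
exists (maxn (pickle i) (Num.truncn e^-1)) => // j /=; rewrite geq_max => /andP[ij ej].
have [_ /(_ i ij)] := Heta j; move=> /lt_le_trans; apply.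
exact: invr_natS_le.
Qed.

End extraction.

Section step_sums.
Context {R : realType}.
Local Notation T := (measurableTypeR R).
Local Notation posmeasure := {measure set T -> \bar R}.
Implicit Types (q : posmeasure) (f Phi : R -> R).

(** Phi is determined up to an additive constant; normalising it at -oo is
    impossible when q has infinite mass near -oo. *)
Definition distribution_of q Phi : Prop :=
  forall x y, x <= y -> q `]x, y]%classic = (Phi y - Phi x)%:E.

(** On each cell the integrals of f and of the constant c i differ by at most om
    times the mass of the cell. *)
Lemma step_sum_integral q Phi f (c y : nat -> R) (om : R) N :
  distribution_of q Phi -> q.-integrable setT (EFin \o (f : T -> R)) ->
  {homo y : i j / (i <= j)%N >-> i <= j} ->
  (forall i t, (i < N)%N -> y i < t -> t <= y i.+1 -> `|f t - c i| <= om) ->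
  `|\int[q]_(t in `]y 0%N, y N]) f t - \sum_(i < N) c i * (Phi (y i.+1) - Phi (y i))|
    <= om * (Phi (y N) - Phi (y 0%N)).
Proof.
move=> qPhi fi homy; elim: N => [|N IHN] Hom.
  by rewrite set_itvoc0 Rintegral_set0 big_ord0 !subrr normr0 mulr0.
have HN := IHN (fun i t iN => Hom i t (ltnW iN)).
have yN : y N <= y N.+1 by exact: homy.
have y0 : y 0%N <= y N by exact: homy.
have mI : measurable (`]y N, y N.+1]%classic : set T) by exact: measurable_itv.
have mJ : measurable (`]y 0%N, y N]%classic : set T) by exact: measurable_itv.
have fin : (q `]y N, y N.+1]%classic < +oo)%E by rewrite qPhi// ltry.
have iD (D : set T) : measurable D -> q.-integrable D (EFin \o (f : T -> R)).
  by move=> mD; exact: integrableS fi.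
have ic (r : R) : q.-integrable `]y N, y N.+1] (EFin \o (cst r : T -> R)).
  apply: measurable_bounded_integrable => //.
  exact: bounded_cst.
have Hc t : (`]y N, y N.+1]%classic : set T) t -> `|f t - c N| <= om.
  by rewrite /= in_itv/= => /andP[]; exact: Hom.
have E : `]y 0%N, y N.+1]%classic = `]y 0%N, y N] `|` `]y N, y N.+1] :> set T.
  by rewrite -itv_bndbnd_setU// bnd_simp.
rewrite E Rintegral_setU//; last 2 first.
- by apply: iD; exact: measurableU.
- apply/disj_setPRL => t /=; rewrite !in_itv/= => /andP[yt _] /andP[_].
  by rewrite leNgt yt.
rewrite big_ord_recr/=.
have H2 : `|\int[q]_(t in `]y N, y N.+1]) f t - c N * (Phi (y N.+1) - Phi (y N))|
    <= om * (Phi (y N.+1) - Phi (y N)).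
  have qE : fine (q `]y N, y N.+1]%classic) = Phi (y N.+1) - Phi (y N) by rewrite qPhi.
  have iB := integrableB mI (iD _ mI) (ic (c N)).
  rewrite -qE -!Rintegral_cst// -RintegralB//; [|exact: iD|exact: ic].
  apply: le_trans (le_normr_Rintegral mI iB) _.
  by apply: le_Rintegral => //; [exact: integrable_norm iB|exact: ic].
rewrite opprD addrACA (le_trans (ler_normD _ _))//.
rewrite (_ : Phi (y N.+1) - Phi (y 0%N) =
  (Phi (y N) - Phi (y 0%N)) + (Phi (y N.+1) - Phi (y N))); last by ring.
by rewrite [leRHS]mulrDr; apply: lerD.
Qed.

End step_sums.

Section cdf.
Context {R : realType}.
Local Notation T := (measurableTypeR R).
Local Notation posmeasure := {measure set T -> \bar R}.
Implicit Types (q : posmeasure) (f Phi : R -> R).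

Definition bounded_finite q : Prop := forall x y, (q `]x, y]%classic < +oo)%E.

Definition distribution q (x : R) : R :=
  if 0 <= x then fine (q `]0, x]%classic) else - fine (q `]x, 0]%classic).

Lemma bounded_finite_cat q x y z : bounded_finite q -> x <= y -> y <= z ->
  fine (q `]x, z]%classic) = fine (q `]x, y]%classic) + fine (q `]y, z]%classic).
Proof.
move=> qfin xy yz.
have fn a b : q `]a, b]%classic \is a fin_num by rewrite ge0_fin_numE// qfin.
rewrite -fineD//; congr fine; rewrite -measureU//.
  by rewrite -itv_bndbnd_setU// bnd_simp.
apply/seteqP; split=> t //= []; rewrite !in_itv/= => /andP[_ ty] /andP[yt _].
by move: (lt_le_trans yt ty); rewrite ltxx.
Qed.

Lemma distributionP q : bounded_finite q -> distribution_of q (distribution q).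
Proof.
move=> qfin x y xy.
have fn a b : q `]a, b]%classic \is a fin_num by rewrite ge0_fin_numE// qfin.
rewrite -[LHS]fineK//; congr (_%:E); rewrite /distribution.
have [x0|x0] := leP 0 x; have [y0|y0] := leP 0 y.
- by rewrite (bounded_finite_cat qfin x0 xy) addrAC subrr add0r.
- by move: (lt_le_trans y0 (le_trans x0 xy)); rewrite ltxx.
- by rewrite opprK addrC (bounded_finite_cat qfin (ltW x0) y0).
- by rewrite opprK addrC (bounded_finite_cat qfin xy (ltW y0)) addrK.
Qed.

Lemma distribution_of_nondecreasing q Phi x y : distribution_of q Phi -> x <= y ->
  Phi x <= Phi y.
Proof.
by move=> qPhi xy; rewrite -subr_ge0 -lee_fin -qPhi.
Qed.

End cdf.

Section uniform_continuity.
Context {R : realType}.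

Lemma compact_uniform_continuity (f : R -> R) (A : set R) (om : R) :
  continuous f -> compact A -> 0 < om ->
  exists2 d, 0 < d & forall s t, A s -> `|s - t| < d -> `|f s - f t| <= om.
Proof.
move=> cf cA om0; have om2 : 0 < om / 2 by rewrite divr_gt0.
have nc := (compact_near_coveringP A).1 cA R (0^'+)%R
  (fun d s => forall t, `|s - t| < d -> `|f s - f t| <= om) _.
have [|d /= d0 Hd] := nc.
  move=> x Ax; have /cvgrPdist_le/(_ _ om2)[e /= e0 He] := cf x.
  have e2 : 0 < e / 2 by rewrite divr_gt0.
  exists (ball x (e / 2), [set d | d < e / 2]).
    by split; [exact: nbhsx_ballx|exact: nbhs_right_lt].
  move=> [s d] /= [xs de] t st.
  have xs' : `|x - s| < e by apply: lt_trans xs _; rewrite ltr_pdivrMr// ltr_pMr// ltr1n.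
  have xt : `|x - t| < e.
    rewrite -[x - t](subrK (x - s)) (_ : x - t - (x - s) = s - t); last by ring.
    apply: le_lt_trans (ler_normD _ _) _; rewrite [e]splitr ltrD//.
    exact: lt_trans st de.
  rewrite -[f s - f t](subrK (f s - f x)) (_ : f s - f t - (f s - f x) = f x - f t); last by ring.
  by rewrite (le_trans (ler_normD _ _))// [om]splitr lerD ?He// distrC He.
exists (d / 2); first by rewrite divr_gt0.
move=> s t As; apply: Hd As t => //=; last by rewrite divr_gt0.
by rewrite sub0r normrN gtr0_norm ?divr_gt0// ltr_pdivrMr// ltr_pMr// ltr1n.
Qed.

End uniform_continuity.

Section right_limit.
Context {R : realType}.
Variable z : rat -> R.
Hypothesis z_mono : forall p q, p <= q -> z p <= z q.

(** The right-continuous version of a nondecreasing function on the rationals, as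
    needed to define a Stieltjes measure. *)
Definition right_limit (x : R) : R := inf [set z q | q in [set q : rat | x < ratr q]].

Lemma exists_rat_gt (x : R) : exists q : rat, x < ratr q.
Proof.
have := @rat_in_itvoo R x (x + 1); rewrite ltrDl => /(_ ltr01)[q].
by rewrite in_itv/= => /andP[xq _]; exists q.
Qed.

Lemma exists_rat_lt (x : R) : exists q : rat, ratr q < x.
Proof.
have := @rat_in_itvoo R (x - 1) x; rewrite ltrBlDr ltrDl => /(_ ltr01)[q].
by rewrite in_itv/= => /andP[_ xq]; exists q.
Qed.

Lemma right_limit_has_inf (x : R) : has_inf [set z q | q in [set q : rat | x < ratr q]].
Proof.
split; first by have [q xq] := exists_rat_gt x; exists (z q), q.
have [p px] := exists_rat_lt x; exists (z p) => _ [q /= xq <-].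
by apply: z_mono; rewrite -(ler_rat R); apply: ltW; exact: lt_trans xq.
Qed.

Lemma right_limit_le (x : R) q : x < ratr q -> right_limit x <= z q.
Proof. by move=> xq; apply: ge_inf; [exact: (right_limit_has_inf x).2|exists q]. Qed.

Lemma right_limit_ge (x : R) q : ratr q <= x -> z q <= right_limit x.
Proof.
move=> qx; apply: lb_le_inf; first exact: (right_limit_has_inf x).1.
move=> _ [p /= xp <-]; apply: z_mono.
by rewrite -(ler_rat R); apply: ltW; exact: le_lt_trans xp.
Qed.

Lemma right_limit_adherent (x e : R) : 0 < e ->
  exists2 q, x < ratr q & z q < right_limit x + e.
Proof.
by move=> e0; have [_ [q xq <-] H] := inf_adherent e0 (right_limit_has_inf x); exists q.
Qed.

Lemma right_limit_nondecreasing : nondecreasing right_limit.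
Proof.
move=> x y xy; apply: lb_le_inf; first exact: (right_limit_has_inf y).1.
by move=> _ [q /= yq <-]; apply: right_limit_le; exact: le_lt_trans yq.
Qed.

Lemma right_limit_right_continuous : right_continuous right_limit.
Proof.
move=> x; apply/cvgrPdist_le => e e0.
have [q xq zq] := right_limit_adherent x e0.
near=> y.
have xy : x < y by near: y; exact: nbhs_right_gt.
rewrite ler0_norm ?subr_le0 ?right_limit_nondecreasing ?(ltW xy)//.
rewrite opprB lerBlDl; apply: le_trans (ltW zq); apply: right_limit_le.
by near: y; exact: nbhs_right_lt.
Unshelve. all: by end_near. Qed.

HB.instance Definition _ := isCumulative.Build R _ R right_limit
  right_limit_nondecreasing right_limit_right_continuous.

Definition right_limit_measure : {measure set (measurableTypeR R) -> \bar R} :=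
  lebesgue_stieltjes_measure (right_limit : cumulative R R).

Lemma right_limit_measureE : distribution_of right_limit_measure right_limit.
Proof.
move=> x y xy; rewrite /right_limit_measure /= /lebesgue_stieltjes_measure.
rewrite /measure_extension measurable_mu_extE/=; last exact: is_ocitv.
by rewrite wlength_itv_bnd.
Qed.

(** z itself need not be right-continuous at q, so its right limit is only
    recovered from points slightly to the right of q. *)
Lemma right_limit_shift (q : rat) :
  z (q + l.+1%:R^-1) @[l --> \oo] --> right_limit (ratr q).
Proof.
apply/cvgrPdist_le => e e0.
have [p qp zp] := right_limit_adherent (ratr q) e0.
have pq0 : 0 < p - q by rewrite subr_gt0 -(ltr_rat R).
exists (Num.truncn (p - q)^-1) => // l /= hl.
have hq : q + l.+1%:R^-1 <= p.
  rewrite -lerBrDl invf_ple ?posrE ?ltr0n//.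
  by apply/ltW/(lt_le_trans (truncnS_gt _)); rewrite ler_nat ltnS.
rewrite ler0_norm; last first.
  rewrite subr_le0; apply: right_limit_le.
  by rewrite ltr_rat ltrDl invr_gt0.
rewrite opprB lerBlDl; apply: le_trans (ltW zp); exact: z_mono.
Qed.

End right_limit.

Section line_selection.
Context {R : realType}.
Local Notation T := (measurableTypeR R).
Local Notation posmeasure := {measure set T -> \bar R}.
Variables (p : nat -> posmeasure) (B : nat -> R).
Hypothesis pB : forall n L, (p n `[(- L%:R)%R, L%:R]%classic <= (B L)%:E)%E.

Lemma selection_bounded_finite n : bounded_finite (p n).
Proof.
move=> x y; have L : exists L : nat, `|x| <= L%:R /\ `|y| <= L%:R.
  exists (maxn (Num.truncn `|x|).+1 (Num.truncn `|y|).+1); split.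
    by apply/ltW/(lt_le_trans (truncnS_gt _)); rewrite ler_nat leq_maxl.
  by apply/ltW/(lt_le_trans (truncnS_gt _)); rewrite ler_nat leq_maxr.
have [L' [/ler_normlP[xL _] /ler_normlP[_ yL]]] := L.
apply: le_lt_trans (ltry (B L')); apply: le_trans (pB n L').
apply: le_measure; rewrite ?inE//; apply: subset_itv; rewrite bnd_simp//.
by rewrite lerNl.
Qed.

Lemma selection_increment n (L : nat) x y : - L%:R <= x -> x <= y -> y <= L%:R ->
  distribution (p n) y - distribution (p n) x <= B L.
Proof.
move=> Lx xy yL; rewrite -lee_fin.
rewrite -(distributionP (selection_bounded_finite n) xy); apply: le_trans (pB n L).
by apply: le_measure; rewrite ?inE//; apply: subset_itv; rewrite bnd_simp.
Qed.

(** Distribution functions vanishing at 0 are bounded at each point uniformly in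
    n, so they can be made to converge at all rational points at once. *)
Lemma selection_exists : exists eta : nat -> nat, (forall j, (j <= eta j)%N) /\
  exists2 z : rat -> R, (forall a b, a <= b -> z a <= z b) &
    forall q, distribution (p (eta j)) (ratr q) @[j --> \oo] --> z q.
Proof.
pose x n (q : rat) : R := distribution (p n) (ratr q).
have xB n q : `|x n q| <= B (Num.truncn `|ratr q : R|).+1.
  have [L1 L2] := ler_normlP _ _ (ltW (truncnS_gt (`|ratr q : R|))).
  set L := (_.+1) in L1 L2 *.
  have d0 : distribution (p n) 0 = 0 by rewrite /distribution lexx set_itvoc0 measure0.
  have L0 : (0 : R) <= L%:R by [].
  have [q0|q0] := leP 0 (ratr q : R).
    have := @selection_increment n L 0 (ratr q).
    rewrite d0 subr0 oppr_le0 => /(_ L0 q0 L2) h; rewrite ger0_norm//.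
    by have := distribution_of_nondecreasing (distributionP (selection_bounded_finite n)) q0; rewrite d0.
  have := @selection_increment n L (ratr q) 0.
  rewrite d0 sub0r lerNl => /(_ L1 (ltW q0) L0) h; rewrite ler0_norm//.
  by have := distribution_of_nondecreasing (distributionP (selection_bounded_finite n)) (ltW q0); rewrite d0.
have [eta [Heta [z Hz]]] := pointwise_extraction xB.
exists eta; split => //; exists z => // a b ab.
apply: ler_cvg_to (Hz a) (Hz b) _; apply: nearW => j.
apply: distribution_of_nondecreasing; first exact/distributionP/selection_bounded_finite.
by rewrite ler_rat.
Qed.

Section selected.
Variables (eta : nat -> nat) (z : rat -> R).
Hypothesis z_mono : forall a b, a <= b -> z a <= z b.
Hypothesis z_lim : forall q, distribution (p (eta j)) (ratr q) @[j --> \oo] --> z q.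
Local Notation F := (right_limit z).
Local Notation lam := (right_limit_measure z_mono).

Lemma right_limit_increment (L : nat) (a b c : rat) : - L%:R <= ratr a :> R ->
  a <= b -> b < c -> ratr c <= L%:R :> R -> F (ratr b) - F (ratr a) <= B L.
Proof.
move=> La ab bc cL.
apply: (@le_trans _ _ (z c - z a)).
  by rewrite lerB// ?right_limit_le ?ltr_rat// right_limit_ge.
have h : distribution (p (eta j)) (ratr c) - distribution (p (eta j)) (ratr a) @[j --> \oo]
    --> z c - z a by apply: cvgB; exact: z_lim.
apply: cvgr_to_le h _; apply: nearW => j.
by apply: selection_increment => //; rewrite ler_rat (le_trans ab)// ltW.
Qed.

(** The nodes are rational, since limits are known at rational points only. The
    shift h leads from z to its right limit, see [right_limit_shift]. *)
Definition grid (L K : nat) (h : rat) (i : nat) : rat := - L%:R + i%:R / K.+1%:R + h.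

Lemma grid_le L K h i j : (i <= j)%N -> grid L K h i <= grid L K h j.
Proof.
by move=> ij; rewrite /grid lerD2r lerD2l ler_pM2r ?invr_gt0// ler_nat.
Qed.

Lemma grid_last L K h : grid L K h ((L + L) * K.+1)%N = L%:R + h.
Proof.
rewrite /grid natrM mulfK ?pnatr_eq0// natrD; ring.
Qed.

Lemma grid0 L K h : grid L K h 0 = - L%:R + h.
Proof. by rewrite /grid mul0r addr0. Qed.

Lemma gridS L K h i : grid L K h i.+1 = grid L K h i + K.+1%:R^-1.
Proof. rewrite /grid -natr1 mulrDl mul1r; ring. Qed.

Definition step_sum (f : R -> R) (Psi : rat -> R) L K (h : rat) : R :=
  \sum_(i < (L + L) * K.+1) f (ratr (grid L K 0 i)) *
    (Psi (grid L K h i.+1) - Psi (grid L K h i)).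

Lemma cvg_step_sum (f : R -> R) (Psi_ : nat -> rat -> R) (h_ : nat -> rat) (Psi : rat -> R)
    L K (h : rat) :
  (forall i, Psi_ l (grid L K (h_ l) i) @[l --> \oo] --> Psi (grid L K h i)) ->
  step_sum f (Psi_ l) L K (h_ l) @[l --> \oo] --> step_sum f Psi L K h.
Proof.
move=> cPsi; rewrite /step_sum; elim: (_ * _)%N => [|N IHN].
  rewrite big_ord0; apply: cvg_near_cst; apply: nearW => l; by rewrite big_ord0.
rewrite big_ord_recr/=; under eq_fun do rewrite big_ord_recr/=.
apply: cvgD => //; apply: cvgM; first exact: cvg_cst.
by apply: cvgB; exact: cPsi.
Qed.

(** Evaluating f at the unshifted nodes is harmless, as h is below the mesh and f
    is uniformly continuous. *)
Lemma step_sum_approx (q : posmeasure) (f Phi : R -> R) (L K : nat) (h : rat) (om d : R) :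
  distribution_of q Phi -> q.-integrable setT (EFin \o (f : T -> R)) ->
  (forall s t, `|s| <= L%:R -> `|s - t| < d -> `|f s - f t| <= om) ->
  (forall t, L%:R - 1 <= `|t| -> f t = 0) ->
  0 <= h -> h < K.+1%:R^-1 -> ratr (K.+1%:R^-1 + K.+1%:R^-1) < d ->
  `|\int[q]_t f t - step_sum f (Phi \o ratr) L K h| <=
    om * (Phi (ratr (L%:R + h)) - Phi (ratr (- L%:R + h))).
Proof.
move=> qPhi fi Hd f0 h0 hK Kd.
pose y i : R := ratr (grid L K h i); pose c i : R := f (ratr (grid L K 0 i)).
have homy : {homo y : i j / (i <= j)%N >-> i <= j}.
  by move=> i j ij; rewrite ler_rat grid_le.
have h1 : h <= 1 by apply: (le_trans (ltW hK)); rewrite invf_le1 ?ler1n ?ltr0n.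
have gridh i : grid L K h i = grid L K 0 i + h by rewrite /grid addr0.
have Hom i t : (i < (L + L) * K.+1)%N -> y i < t -> t <= y i.+1 -> `|f t - c i| <= om.
  move=> iN yt ty; rewrite distrC; apply: Hd.
    have := grid_le L K 0 (leq0n i); rewrite grid0 addr0 => lo.
    have := grid_le L K 0 (ltnW iN); rewrite grid_last addr0 => hi.
    by rewrite -(ratr_nat R L) -ratr_norm ler_rat ler_norml lo hi.
  have xt : ratr (grid L K 0 i) <= t.
    by apply: ltW; apply: le_lt_trans yt; rewrite /y ler_rat gridh lerDl.
  rewrite ler0_norm ?subr_le0// opprB; apply: le_lt_trans Kd.
  rewrite lerBlDl (le_trans ty)// -rmorphD ler_rat gridS gridh.
  by rewrite -addrA lerD2l lerD2r ltW.
have y0 : y 0%N = ratr (- L%:R + h) by rewrite /y grid0.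
have yN : y ((L + L) * K.+1)%N = ratr (L%:R + h) by rewrite /y grid_last.
have := step_sum_integral qPhi fi homy Hom; rewrite y0 yN.
rewrite (_ : \int[q]_t f t = \int[q]_(t in `](ratr (- L%:R + h) : R), ratr (L%:R + h)]) f t)//.
rewrite [RHS]Rintegral_mkcond; apply: eq_Rintegral => t _; rewrite /patch.
case: ifPn => // /negP nt; apply/eqP; rewrite -[_ == _]negbK; apply/negP => /eqP ft.
apply: nt; rewrite inE/= in_itv/= !rmorphD/= rmorphN/= !ratr_nat.
have : `|t| < L%:R - 1.
  by rewrite ltNge; apply/negP => /f0 /eqP; exact/negP/eqP.
have hr0 : 0 <= ratr h :> R by rewrite ler0q.
have hr1 : ratr h <= 1 :> R by rewrite -(rmorph1 (@ratr R)) ler_rat.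
by rewrite ltr_norml => /andP[t1 t2]; apply/andP; split; lra.
Qed.

Lemma integrable_compact_support (q : posmeasure) (f : R -> R) (L : nat) :
  bounded_finite q -> continuous f -> (forall t, L%:R <= `|t| -> f t = 0) ->
  q.-integrable setT (EFin \o (f : T -> R)).
Proof.
move=> qfin cf f0.
have mI : measurable (`](- L%:R)%R, L%:R]%classic : set T) by exact: measurable_itv.
have cn : {within `[- L%:R, L%:R], continuous (fun x => `|f x|)}.
  apply: continuous_subspaceT => x; apply: (@continuous_comp _ _ _ f Num.norm).
    exact: cf.
  exact: norm_continuous.
have LL : - L%:R <= L%:R :> R by rewrite (@le_trans _ _ 0)// oppr_le0.
have [c _ Hc] := EVT_max LL cn.
have iI : q.-integrable setT (EFin \o (\1_(`](- L%:R)%R, L%:R]%classic : set T) : T -> R)).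
  by apply: integrable_indic_finite => //; exact: qfin.
apply: le_integrable (integrableZl measurableT (`|f c|) iI) => //.
  by apply/measurable_EFinP; exact: continuous_measurable_fun.
move=> x _ /=; rewrite lee_fin indicE; case: (boolP (x \in _)) => xL.
  rewrite mulr1 normr_id; apply: Hc; move: xL; rewrite inE/= !in_itv/=.
  by move=> /andP[/ltW -> ->].
rewrite f0 ?normr0//; rewrite leNgt; apply/negP; rewrite ltr_norml => /andP[x1 x2].
by move/negP: xL; apply; rewrite inE/= in_itv/= x1 ltW.
Qed.

(** The integrals for the limit and for the sequence are replaced by Stieltjes
    sums; between these, the right limit is replaced by z at slightly shifted
    nodes, and z by the distribution functions of the sequence. *)
Lemma selection_cvg (f : R -> R) (L0 : nat) :
  continuous f -> (forall t, L0%:R <= `|t| -> f t = 0) ->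
  \int[p (eta j)]_t f t @[j --> \oo] --> \int[lam]_t f t.
Proof.
move=> cf f0; pose L := L0.+1.
have pfin n := @selection_bounded_finite n.
have lfin : bounded_finite lam.
  move=> x y; have [xy|yx] := leP x y; first by rewrite right_limit_measureE// ltry.
  by rewrite set_itv_ge ?measure0// bnd_simp -leNgt ltW.
have f1 t : L%:R - 1 <= `|t| -> f t = 0.
  by rewrite -natr1 addrK; exact: f0.
have B0 : 0 <= B L.+1.
  by rewrite -lee_fin; apply: le_trans (pB 0 L.+1); exact: measure_ge0.
apply/cvgrPdist_le => e e0.
pose om := e / 4 / (B L.+1 + 1).
have om0 : 0 < om by rewrite !divr_gt0// ltr_wpDl.
have omB : om * B L.+1 <= e / 4.
  rewrite /om -mulrA ger_pMr ?divr_gt0// ler_pdivrMl ?ltr_wpDl// mulr1 lerDl//.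
have [d d0 Hd] := compact_uniform_continuity cf (@segment_compact R (- L%:R) L%:R) om0.
have {}Hd s t : `|s| <= L%:R -> `|s - t| < d -> `|f s - f t| <= om.
  by move=> sL; apply: Hd; rewrite /= in_itv/= -ler_norml.
(* On a cell, the point t and the unshifted node may be two meshes apart. *)
pose K := Num.truncn (2 / d).
have Kd : ratr (K.+1%:R^-1 + K.+1%:R^-1) < d.
  rewrite rmorphD/= fmorphV/= ratr_nat -mulr2n -[X in X < _]mulr_natl.
  by rewrite ltr_pdivrMr ?ltr0n// mulrC -ltr_pdivrMr// truncnS_gt.
have e4 : 0 < e / 4 by rewrite divr_gt0.
have s1 : step_sum f z L K (l.+1%:R^-1) @[l --> \oo] --> step_sum f (F \o ratr) L K 0.
  apply: cvg_step_sum => i; rewrite /= /grid addr0; exact: right_limit_shift.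
have /cvgrPdist_le/(_ _ e4)[N _ HN] := s1.
(* The shift has to be below the mesh, and small enough to approximate the right
   limits at all nodes. *)
pose l := maxn N K.+1; pose h : rat := l.+1%:R^-1.
have {}HN := HN l (leq_maxl _ _).
have h0 : 0 <= h by rewrite invr_ge0.
have hK : h < K.+1%:R^-1.
  by rewrite ltf_pV2 ?posrE ?ltr0n// ltr_nat ltnS leq_maxr.
have h1 : h <= 1 by rewrite invf_le1 ?ler1n ?ltr0n.
have s2 : step_sum f (distribution (p (eta j)) \o ratr) L K h @[j --> \oo] -->
    step_sum f z L K h.
  by apply: cvg_step_sum => i; exact: z_lim.
have /cvgrPdist_le/(_ _ e4) := s2; apply: filterS => j Hj.
have hr0 : 0 <= ratr h :> R by rewrite ler0q.
have hr1 : ratr h <= 1 :> R by rewrite -(rmorph1 (@ratr R)) ler_rat.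
have LS : L.+1%:R = L%:R + 1 :> R by rewrite -natr1.
have a1 : `|\int[p (eta j)]_t f t - step_sum f (distribution (p (eta j)) \o ratr) L K h| <= e / 4.
  apply: le_trans omB.
  have i1 := integrable_compact_support (pfin (eta j)) cf f0.
  apply: le_trans (step_sum_approx (distributionP (pfin _)) i1 Hd f1 h0 hK Kd) _.
  apply: ler_wpM2l; first exact: ltW.
  rewrite !rmorphD/= rmorphN/= !ratr_nat; apply: selection_increment; rewrite ?LS; try lra.
  have : 0 <= L%:R :> R by []. lra.
have a2 : `|\int[lam]_t f t - step_sum f (F \o ratr) L K 0| <= e / 4.
  apply: le_trans omB.
  have i2 := integrable_compact_support lfin cf f0.
  have K0 : (0 : rat) < K.+1%:R^-1 by rewrite invr_gt0.
  apply: le_trans (step_sum_approx (right_limit_measureE z_mono) i2 Hd f1 (lexx 0) K0 Kd) _.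
  apply: ler_wpM2l; first exact: ltW.
  rewrite !addr0; apply: (@right_limit_increment L.+1 _ _ (L%:R + 1)).
  - by rewrite rmorphN/= ratr_nat lerN2 ler_nat.
  - by rewrite (@le_trans _ _ 0)// oppr_le0.
  - by rewrite ltrDl.
  - by rewrite rmorphD/= rmorph1 ratr_nat -natr1.
rewrite (_ : e = e / 4 + e / 4 + e / 4 + e / 4); last by field.
set I := (\int[lam]_t f t) in a2 *; set J := (\int[p (eta j)]_t f t) in a1 *.
set S1 := step_sum f (_ \o _) L K h in a1 Hj; set S2 := step_sum f z L K h in Hj HN.
set S3 := step_sum f (F \o ratr) L K 0 in a2 HN.
rewrite (_ : I - J = (I - S3) + (S3 - S2) + (S2 - S1) + (S1 - J)); last by ring.
rewrite distrC in a1.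
by do 3![apply: (le_trans (ler_normD _ _)); apply: lerD => //].
Qed.

End selected.
End line_selection.

(** * Uniqueness and selection on the half-line *)
Section trapezoid.
Context {R : realType}.
Local Notation T := (measurableTypeR R).
Local Notation posmeasure := {measure set T -> \bar R}.
Variables a b c d : R.
Hypotheses (ab : a < b) (cd : c < d).

Definition trapezoid (t : R) : R :=
  Num.max 0 (Num.min 1 (Num.min ((t - a) / (b - a)) ((d - t) / (d - c)))).

Lemma trapezoid_ge0 t : 0 <= trapezoid t.
Proof. by rewrite /trapezoid le_max lexx. Qed.

Lemma trapezoid_le1 t : trapezoid t <= 1.
Proof. by rewrite /trapezoid ge_max ler01 ge_min lexx. Qed.

Lemma trapezoid_out t : t <= a \/ d <= t -> trapezoid t = 0.
Proof.
move=> out; apply/max_idPl; rewrite !ge_min; apply/orP; right.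
have ba0 : 0 <= (b - a)^-1 by rewrite invr_ge0 subr_ge0 ltW.
have dc0 : 0 <= (d - c)^-1 by rewrite invr_ge0 subr_ge0 ltW.
by case: out => h; apply/orP; [left|right]; rewrite mulr_le0_ge0// subr_le0.
Qed.

Lemma trapezoid_in t : b <= t -> t <= c -> trapezoid t = 1.
Proof.
move=> bt tc; rewrite /trapezoid (_ : Num.min 1 _ = 1) ?max_r//.
apply/min_idPl; rewrite le_min; apply/andP; split.
  by rewrite ler_pdivlMr ?subr_gt0// mul1r lerB.
by rewrite ler_pdivlMr ?subr_gt0// mul1r lerB.
Qed.

Lemma continuous_trapezoid : continuous trapezoid.
Proof.
have c1 : continuous (fun t : R => (t - a) / (b - a)).
  move=> t; apply: cvgM; last exact: cvg_cst.
  by apply: cvgB; [exact: cvg_id|exact: cvg_cst].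
have c2 : continuous (fun t : R => (d - t) / (d - c)).
  move=> t; apply: cvgM; last exact: cvg_cst.
  by apply: cvgB; [exact: cvg_cst|exact: cvg_id].
have cc (r : R) : continuous (fun _ : R => r) by move=> t; exact: cvg_cst.
exact: (max_fun_continuous (cc 0) (min_fun_continuous (cc 1) (min_fun_continuous c1 c2))).
Qed.

Lemma test_fun_trapezoid : 0 < a -> test_fun trapezoid a d.
Proof.
move=> a0; split=> //; first exact: continuous_trapezoid.
move=> t nt; apply: trapezoid_out.
have [ta|at_] := leP t a; first by left.
have [dt|td] := leP d t; first by right.
by exfalso; apply: nt; rewrite /= in_itv/= (ltW at_) ltW.
Qed.

Lemma trapezoid_integral_ge (m : posmeasure) : 0 < a -> locally_finite m ->
  (m `[b, c]%classic <= (\int[m]_x trapezoid x)%:E)%E.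
Proof.
move=> a0 lfm; have tt := test_fun_trapezoid a0.
have it := test_fun_integrable tt lfm.
rewrite /Rintegral fineK; last exact: integrable_fin_num it.
rewrite -[X in (m X <= _)%E]setIT -integral_indic//.
apply: ge0_le_integral => //.
- by apply/measurable_EFinP; exact: measurable_indic.
- exact: measurable_int it.
move=> x _; rewrite lee_fin indicE; case: (boolP (x \in _)) => [|_].
  by rewrite inE/= in_itv/= => /andP[bx xc]; rewrite trapezoid_in.
exact: trapezoid_ge0.
Qed.

Lemma trapezoid_integral_le (m : posmeasure) : 0 < a -> locally_finite m ->
  ((\int[m]_x trapezoid x)%:E <= m `[a, d]%classic)%E.
Proof.
move=> a0 lfm; have tt := test_fun_trapezoid a0.
have it := test_fun_integrable tt lfm.
rewrite /Rintegral fineK; last exact: integrable_fin_num it.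
rewrite -[X in (_ <= m X)%E]setIT -integral_indic//.
apply: ge0_le_integral => //.
- by move=> x _; rewrite lee_fin trapezoid_ge0.
- exact: measurable_int it.
- by apply/measurable_EFinP; exact: measurable_indic.
move=> x _; rewrite lee_fin indicE; case: (boolP (x \in _)) => xad.
  exact: trapezoid_le1.
have [_ _ ->] := tt; first by [].
by move: xad; rewrite notin_setE.
Qed.

End trapezoid.

Section uniqueness.
Context {R : realType}.
Local Notation T := (measurableTypeR R).
Local Notation posmeasure := {measure set T -> \bar R}.
Implicit Types m : posmeasure.

(* Trapezoids converging pointwise to the indicator of ]c, d]. *)
Let trap (c d : R) (n : nat) : R -> R :=
  trapezoid c (c + (d - c) / n.+1%:R) d (d + n.+1%:R^-1).

Let trap_cvg (c d : R) t : c < d ->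
  trap c d n t @[n --> \oo] --> (\1_(`]c, d]%classic : set R) t : R).
Proof.
move=> cd; have dc0 : 0 < d - c by rewrite subr_gt0.
have inc n : c < c + (d - c) / n.+1%:R by rewrite ltrDl divr_gt0.
have ind n : d < d + n.+1%:R^-1 by rewrite ltrDl invr_gt0.
rewrite indicE; case: (boolP (t \in _)) => [|tn].
  rewrite inE/= in_itv/= => /andP[ct td]; apply: cvg_near_cst.
  exists (Num.truncn ((d - c) / (t - c))) => // n /= hn.
  apply: trapezoid_in => //.
  have tc0 : 0 < t - c by rewrite subr_gt0.
  by rewrite -lerBrDl ler_pdivrMr ?ltr0n// mulrC -ler_pdivrMr// le_natS.
have [tc|ct] := leP t c.
  by apply: cvg_near_cst; apply: nearW => n; apply: trapezoid_out => //; left.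
have dt : d < t.
  by rewrite ltNge; apply/negP => td; move/negP: tn; apply; rewrite inE/= in_itv/= ct.
apply: cvg_near_cst; exists (Num.truncn (t - d)^-1) => // n /= hn.
apply: trapezoid_out => //; right; rewrite -lerBrDl.
by rewrite invr_natS_le// subr_gt0.
Qed.

Let trap_integral_cvg m (c d : R) : locally_finite m -> 0 < c -> c < d ->
  ((\int[m]_x trap c d n x)%:E @[n --> \oo] --> m `]c, d]%classic)%E.
Proof.
move=> lfm c0 cd; have dc0 : 0 < d - c by rewrite subr_gt0.
have inc n : c < c + (d - c) / n.+1%:R by rewrite ltrDl divr_gt0.
have ind n : d < d + n.+1%:R^-1 by rewrite ltrDl invr_gt0.
have tt n := test_fun_trapezoid (inc n) (ind n) c0.
have it n := test_fun_integrable (tt n) lfm.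
have mI : measurable (`[c, d + 1]%classic : set T) by exact: measurable_itv.
have iI : m.-integrable setT (EFin \o (\1_(`[c, d + 1]%classic : set T) : T -> R)).
  by apply: integrable_indic_finite => //; exact: lfm.2.
have [] := @dominated_convergence _ T R m setT measurableT
  (fun n x => (trap c d n x)%:E) (EFin \o (\1_(`]c, d]%classic : set T) : T -> R)) _
  (fun n => measurable_int _ (it n)) _ _ iI _.
- by apply/measurable_EFinP; exact: measurable_indic.
- by apply: aeW => x _; apply: cvg_EFin; [exact: nearW|exact: trap_cvg].
- apply: aeW => x n _; rewrite abse_EFin lee_fin ger0_norm ?trapezoid_ge0// indicE.
  case: (boolP (x \in _)) => xcd; first exact: trapezoid_le1.
  have [_ _ t0] := tt n; rewrite /trap t0//.
  move: xcd; rewrite notin_setE/= !in_itv/= => h /andP[cx xd]; apply: h; rewrite cx/=.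
  by apply: (le_trans xd); rewrite lerD2l invf_le1 ?ltr0n ?ler1n.
move=> _ _; rewrite integral_indic// setIT; apply: cvg_trans; apply: near_eq_cvg.
apply: nearW => n; rewrite /Rintegral fineK//; exact: integrable_fin_num (it n).
Qed.

Lemma test_fun_measure_unique m1 m2 : locally_finite m1 -> locally_finite m2 ->
  (forall phi a b, test_fun phi a b -> \int[m1]_x phi x = \int[m2]_x phi x) ->
  forall A, measurable A -> m1 A = m2 A.
Proof.
move=> lf1 lf2 H; apply: halfline_measure_unique; [exact: lf1.1|exact: lf2.1| |].
  move=> c d c0 cd.
  have h1 := trap_integral_cvg lf1 c0 cd; have h2 := trap_integral_cvg lf2 c0 cd.
  suff h3 : ((\int[m1]_x trap c d n x)%:E @[n --> \oo] --> m2 `]c, d]%classic)%E.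
    by rewrite -(cvg_lim _ h1)// -(cvg_lim _ h3).
  apply: cvg_trans h2; apply: near_eq_cvg; apply: nearW => n; congr (_%:E).
  apply: esym; apply: H; apply: test_fun_trapezoid => //.
  - by rewrite ltrDl divr_gt0 ?subr_gt0.
  - by rewrite ltrDl invr_gt0.
move=> c d c0 cd; apply: le_lt_trans (lf1.2 c d c0); apply: le_measure; rewrite ?inE//.
by apply: subset_itvr; rewrite bnd_simp.
Qed.

Lemma sum_measure (p q : posmeasure) : exists s : posmeasure,
  (forall A, s A = (p A + q A)%E) /\
  forall f : T -> R, p.-integrable setT (EFin \o f) -> q.-integrable setT (EFin \o f) ->
    \int[s]_x f x = \int[p]_x f x + \int[q]_x f x.
Proof.
exists (measure_add p q); split=> [A|f ip iq]; first exact: measure_addE.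
rewrite /Rintegral integral_measure_add// fineD//; exact: integrable_fin_num.
Qed.

(** Signed measures given as differences: only sums of positive measures are
    compared, so no infinite values are ever subtracted. *)
Lemma test_fun_difference_unique m1 m2 n1 n2 :
  locally_finite m1 -> locally_finite m2 -> locally_finite n1 -> locally_finite n2 ->
  (forall phi a b, test_fun phi a b ->
    \int[m1]_x phi x - \int[m2]_x phi x = \int[n1]_x phi x - \int[n2]_x phi x) ->
  forall A, measurable A -> (m1 A + n2 A = n1 A + m2 A)%E.
Proof.
move=> lm1 lm2 ln1 ln2 H A mA.
have [s [sE sI]] := sum_measure m1 n2; have [r [rE rI]] := sum_measure n1 m2.
rewrite -sE -rE; apply: test_fun_measure_unique mA => [||phi a b tphi].
- split; first by rewrite sE lm1.1 ln2.1 adde0.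
  by move=> a b a0; rewrite sE lte_add_pinfty ?lm1.2 ?ln2.2.
- split; first by rewrite rE ln1.1 lm2.1 adde0.
  by move=> a b a0; rewrite rE lte_add_pinfty ?ln1.2 ?lm2.2.
have I := test_fun_integrable tphi; rewrite sI ?rI; [|exact: I..].
have := H _ _ _ tphi; lra.
Qed.

End uniqueness.

Section halfline_selection.
Context {R : realType}.
Local Notation T := (measurableTypeR R).
Local Notation posmeasure := {measure set T -> \bar R}.
Variable w : R -> R.
Hypothesis w_ge0 : forall x, 0 < x -> 0 <= w x.
Hypothesis w_submul : forall x y, 0 < x -> 0 < y -> w (x * y) <= w x * w y.
Implicit Types (m : posmeasure) (phi : R -> R) (C : R).

(** A trapezoid equal to 1 on [x, e x] bounds the limit on this segment by the
    measures of the sequence on a slightly larger one. *)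
Lemma growth_limit : exists2 D, 0 <= D & forall C (m_ : nat -> posmeasure) m,
  0 <= C -> (\forall j \near \oo, growth w C (m_ j)) -> locally_finite m ->
  (forall phi a b, test_fun phi a b ->
     \int[m_ j]_x phi x @[j --> \oo] --> \int[m]_x phi x) ->
  growth w (C * D) m.
Proof.
have [D D0 HD] := growth_segment w_ge0 w_submul (expR 1 + 1) (ltac:(lra) : (0:R) < 1 / 2).
exists D => // C m_ m C0 gm lfm cvg; split; first exact: lfm.1.
move=> x x0; have e1 : 1 < expR 1 :> R by rewrite expR_gt1.
have h1 : 1 / 2 * x < x by rewrite gtr_pMl//; lra.
have h2 : expR 1 * x < (expR 1 + 1) * x by rewrite ltr_pM2r// ltrDl.
have h0 : 0 < 1 / 2 * x by rewrite mulr_gt0.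
apply: le_trans (trapezoid_integral_ge h1 h2 h0 lfm) _; rewrite lee_fin.
have tt := test_fun_trapezoid h1 h2 h0.
apply: cvgr_to_le (cvg _ _ _ tt) _; move: gm; apply: filterS => j gj.
have lfj := growth_locally_finite w_ge0 w_submul C0 gj.
rewrite -lee_fin; apply: le_trans (trapezoid_integral_le h1 h2 h0 lfj) _.
exact: HD.
Qed.

Lemma Rintegral_halfline m (f : T -> R) : m (~` halfline) = 0%E ->
  m.-integrable setT (EFin \o f) -> \int[m]_x f x = \int[m]_(x in halfline) f x.
Proof.
move=> m0 fi; rewrite /Rintegral; congr fine.
rewrite (negligible_integral _ _ fi m0)//; last exact: measurableC measurable_halfline.
by rewrite setTD setCK.
Qed.

Lemma log_measure_integral m phi a b : locally_finite m -> test_fun phi a b ->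
  (log_measure m).-integrable setT (EFin \o ((phi \o expR) : T -> R)) /\
  \int[log_measure m]_t phi (expR t) = \int[m]_x phi x.
Proof.
move=> lfm tphi; have I := test_fun_integrable tphi lfm.
have mh := @measurable_halfline R.
have mphi := measurable_test_fun tphi.
have mpe : measurable_fun setT (phi \o expR : T -> R).
  exact: (measurableT_comp mphi (@measurable_expR R)).
have mpel : measurable_fun setT ((phi \o expR) \o (@ln R) : T -> R).
  exact: (measurableT_comp mpe (@measurable_ln R)).
have E x : halfline x -> phi (expR (ln x)) = phi x.
  by rewrite halflineE => x0; rewrite lnK.
have i1 : m.-integrable halfline (EFin \o ((phi \o expR) \o (@ln R) : T -> R)).
  apply: (eq_integrable mh (EFin \o phi)); first by move=> x; rewrite inE => /E /= ->.
  exact: integrableS I.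
have i2 : m.-integrable setT (EFin \o ((phi \o expR) \o (@ln R) : T -> R)).
  have mN := measurableC mh.
  apply/(negligible_integrable mN measurableT _ lfm.1); first exact/measurable_EFinP.
  by rewrite setTD setCK.
have mE : measurable_fun setT (EFin \o (phi \o expR : T -> R)) by exact/measurable_EFinP.
have mln : measurable_fun [set: T] (@ln R : T -> T) := @measurable_ln R.
split; first exact: (integrable_pushforward mln mE i2 measurableT).
rewrite {1}/Rintegral (integral_pushforward mln mE i2 measurableT).
rewrite (Rintegral_halfline lfm.1 I) -[LHS]/(\int[m]_x ((phi \o expR) \o (@ln R)) x).
rewrite (Rintegral_halfline lfm.1 i2); apply: eq_Rintegral => x; rewrite inE.
exact: E.
Qed.

(** Images under ln have uniformly bounded mass on bounded intervals; the limit on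
    the line is carried back by the exponential. *)
Lemma halfline_selection C (m_ : nat -> posmeasure) : 0 <= C ->
  (forall n, growth w C (m_ n)) ->
  exists eta : nat -> nat, (forall j, (j <= eta j)%N) /\
  exists2 m, locally_finite m & forall phi a b, test_fun phi a b ->
    \int[m_ (eta j)]_x phi x @[j --> \oo] --> \int[m]_x phi x.
Proof.
move=> C0 gm; have lfm n := growth_locally_finite w_ge0 w_submul C0 (gm n).
have HB (L : nat) : exists b : R, forall n,
    (log_measure (m_ n) `[(- L%:R)%R, L%:R]%classic <= b%:E)%E.
  have [D D0 HD] := growth_segment w_ge0 w_submul (expR L%:R) (expR_gt0 (- L%:R)).
  exists (C * D * w 1) => n.
  apply: le_trans (HD (m_ n) C 1 C0 (gm n) ltr01); rewrite !mulr1.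
  rewrite -(log_measure_exp (lfm n).1)//; apply: le_measure; rewrite ?inE//.
    by rewrite -[X in measurable X]setTI; exact: measurable_expR.
  by move=> t /=; rewrite !in_itv/= !ler_expR.
have [B {}HB] := choice HB.
have pB n L := HB L n.
have [eta [Heta [z zm zl]]] := selection_exists pB.
exists eta; split=> //; pose lam := right_limit_measure zm.
have lamE := right_limit_measureE zm.
have lfin : bounded_finite lam.
  move=> x y; have [xy|yx] := leP x y; first by rewrite lamE// ltry.
  by rewrite set_itv_ge ?measure0// bnd_simp -leNgt ltW.
exists (image_measure lam (@measurable_expR R)).
  split; rewrite /image_measure /= /pushforward.
    rewrite (_ : _ @^-1` _ = set0) ?measure0//.
    by apply/seteqP; split=> // t /=; rewrite halflineE => /negP; rewrite expR_gt0.
  move=> a b a0; apply: le_lt_trans (lfin (ln a - 1) (ln b)).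
  apply: le_measure; rewrite ?inE//.
    by rewrite -[X in measurable X]setTI; exact: measurable_expR.
  move=> t /=; rewrite !in_itv/= => /andP[ta tb].
  have b0 : 0 < b := lt_le_trans (expR_gt0 t) tb.
  rewrite -ler_expR lnK// tb andbT ltrBlDr (le_lt_trans (_ : ln a <= t)) ?ltrDl//.
  by rewrite -ler_expR lnK.
move=> phi a b tphi; have [cphi a0 phi0] := tphi.
have cf : continuous (phi \o expR).
  by move=> t; apply: cvg_comp; [exact: continuous_expR|exact: cphi].
pose L0 := (Num.truncn (`|ln a| + `|ln b|)).+1.
have f0 t : L0%:R <= `|t| -> (phi \o expR) t = 0.
  move=> Lt; apply: phi0 => /=; rewrite in_itv/= => /andP[ta tb].
  have b0 : 0 < b := lt_le_trans (expR_gt0 t) tb.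
  have t1 : ln a <= t by rewrite -ler_expR lnK.
  have t2 : t <= ln b by rewrite -ler_expR lnK.
  have : `|t| < L0%:R.
    apply: le_lt_trans (truncnS_gt _); rewrite ler_norml.
    have := ler_norm (ln b); have := ler_norm (- ln a); rewrite normrN.
    have := normr_ge0 (ln a); have := normr_ge0 (ln b) => *; apply/andP; split; lra.
  by rewrite ltNge Lt.
have := selection_cvg pB (z_mono := zm) zl cf f0.
have mphi := measurable_test_fun tphi.
have ife := integrable_compact_support lfin cf f0.
have mE : measurable_fun setT (EFin \o (phi : T -> R)) by exact/measurable_EFinP.
have -> : \int[image_measure lam (@measurable_expR R)]_x phi x = \int[lam]_t (phi \o expR) t.
  have mexp : measurable_fun [set: T] (@expR R : T -> T) := @measurable_expR R.
  by rewrite {1}/Rintegral (integral_pushforward mexp mE ife measurableT).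
apply: cvg_trans; apply: near_eq_cvg; apply: nearW => j /=.
by have [_ ->] := log_measure_integral (lfm (eta j)) tphi.
Qed.

End halfline_selection.

(** * The Jordan decomposition of a difference *)
Section jordan.
Context {R : realType}.
Local Notation T := (measurableTypeR R).
Local Notation posmeasure := {measure set T -> \bar R}.
Implicit Types p q m : posmeasure.

(** These sets form a countable partition of (0, oo) into relatively compact
    pieces, where locally finite measures are finite. *)
Definition annulus (n : nat) : set T :=
  halfline `&` [set x | Num.truncn `|ln x| = n].

Lemma annulus_segment n :
  annulus n `<=` `[expR (- n.+1%:R), expR n.+1%:R]%classic.
Proof.
move=> x [] /=; rewrite halflineE => x0 xn; rewrite in_itv/=.
rewrite -[x]lnK ?posrE// !ler_expR -ler_norml -xn; exact/ltW/truncnS_gt.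
Qed.

Lemma annulusE n : annulus n =
  halfline `&` (fun x : T => `|ln x|) @^-1` `[n%:R, n.+1%:R[%classic.
Proof.
rewrite /annulus; congr (_ `&` _); apply/seteqP; split=> x /=; rewrite in_itv/=.
  by move=> <-; exact: truncn_itv.
by move=> h; apply/eqP; rewrite truncn_eq.
Qed.

Lemma measurable_annulus n : measurable (annulus n).
Proof.
rewrite annulusE; apply: measurableI; first exact: measurable_halfline.
rewrite -[X in measurable X]setTI.
by apply: (measurableT_comp (@normr_measurable R setT) (@measurable_ln R)).
Qed.

Lemma trivIset_annulus : trivIset setT annulus.
Proof.
apply/trivIsetP => i j _ _ /eqP ij; apply/seteqP; split=> // x [[_ /= xi] [_ /= xj]].
by apply: ij; rewrite -xi -xj.
Qed.

Lemma bigcup_annulus : \bigcup_n annulus n = halfline.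
Proof.
apply/seteqP; split=> [x [n _ []]//|x xh].
by exists (Num.truncn `|ln x|).
Qed.

(** The Radon-Nikodym theorem is applied on each piece, where the smaller
    measure is finite. *)
Lemma dominated_density p m : locally_finite p -> locally_finite m ->
  (forall A, measurable A -> (p A <= m A)%E) ->
  exists2 g : T -> R, measurable_fun setT g /\ (forall x, 0 <= g x) & is_density m g p.
Proof.
move=> lp lm pm.
have pfin n : (p (annulus n) < +oo)%E.
  apply: le_lt_trans (lp.2 _ _ (expR_gt0 (- n.+1%:R))); apply: le_measure; rewrite ?inE//.
  - exact: measurable_annulus.
  - exact: annulus_segment.
pose pn n : {finite_measure set T -> \bar R} := mfrestr (measurable_annulus n) (pfin n).
pose m' : {sigma_finite_measure set T -> \bar R} := sigma_finite_copy lm.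
have dom n : pn n `<< m'.
  move=> A nA B mB BA; rewrite /pn /= /mfrestr /mrestr.
  have mBn : measurable (B `&` annulus n) by apply: measurableI => //; exact: measurable_annulus.
  apply/eqP; rewrite eq_le measure_ge0 andbT; apply: le_trans (pm _ mBn) _.
  have -> // : m (B `&` annulus n) = 0%E.
  by apply: nA => // x [/BA].
have [f Hf] := choice (fun n => radon_nikodym_sigma_finite (dom n)).
pose g (x : T) : R := fine (f (Num.truncn `|ln x|) x) * \1_(halfline : set T) x.
have gE n x : annulus n x -> (g x)%:E = f n x.
  move=> [xh /= xn]; rewrite /g xn indicE mem_set// mulr1 fineK//.
  by have [_ + _ _] := Hf n; exact.
have g0 x : 0 <= g x.
  by rewrite mulr_ge0 ?indicE// fine_ge0//; have [+ _ _ _] := Hf (Num.truncn `|ln x|); exact.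
have mg : measurable_fun setT g.
  have -> : [set: T] = halfline `|` ~` halfline by rewrite setUv.
  apply/measurable_funU; [exact: measurable_halfline|exact: measurableC measurable_halfline|].
  split; last first.
    apply: (eq_measurable_fun (cst 0 : T -> R)); last exact: measurable_cst.
    move=> x; rewrite inE => nx.
    by rewrite /g indicE memNset ?mulr0.
  rewrite -bigcup_annulus; apply/measurable_fun_bigcup; first exact: measurable_annulus.
  move=> n; apply/measurable_EFinP; apply: (eq_measurable_fun (f n)).
    by move=> x; rewrite inE => xn; rewrite /= (gE n).
  apply: measurable_funTS; have [_ _ + _] := Hf n; exact: measurable_int.
exists g => // A mA.
have mAn n : measurable (A `&` annulus n) by apply: measurableI => //; exact: measurable_annulus.
have tAn : trivIset setT (fun n => A `&` annulus n).
  by apply: trivIset_setIl; exact: trivIset_annulus.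
have E : A `&` halfline = \bigcup_n (A `&` annulus n) by rewrite -bigcup_annulus setI_bigcupr.
have mAh : measurable (A `&` halfline) by apply: measurableI => //; exact: measurable_halfline.
rewrite -(measure_setI_halfline lp.1 mA).
have -> : (\int[m]_(x in A) (g x)%:E = \int[m]_(x in A `&` halfline) (g x)%:E)%E.
  rewrite [LHS]integral_mkcond [RHS]integral_mkcond; apply: eq_integral => x _.
  rewrite /patch; case: (boolP (x \in A)) => xA; case: (boolP (x \in A `&` halfline)) => // xAh.
  - rewrite /g indicE memNset ?mulr0// => xh; move/negP: xAh; apply.
    by rewrite in_setI xA mem_set.
  - by move: xAh; rewrite in_setI (negbTE xA).
rewrite E measure_semi_bigcup//; last by rewrite -E.
rewrite ge0_integral_bigcup//; last 2 first.
- by apply/measurable_EFinP; exact: measurable_funTS.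
- by move=> x _; rewrite lee_fin.
apply: eq_eseriesr => n _.
have [_ _ _ fE] := Hf n.
have -> : p (A `&` annulus n) = pn n (A `&` annulus n).
  by rewrite /pn /= /mfrestr /mrestr -setIA setIid.
rewrite fE//; apply: eq_integral => x; rewrite inE => -[_ xn].
by rewrite (gE n).
Qed.

(** With densities f and g with respect to p + q, the Jordan parts of p - q have
    densities (f - g)^+ and (g - f)^+. *)
Lemma jordan_difference p q : locally_finite p -> locally_finite q ->
  exists p' q' : posmeasure, [/\ mutually_singular p' q',
    forall A, measurable A -> (p' A <= p A)%E,
    forall A, measurable A -> (q' A <= q A)%E &
    forall A, measurable A -> (p' A + q A = p A + q' A)%E].
Proof.
move=> lp lq; have [m [mE _]] := sum_measure p q.
have lm : locally_finite m.
  split; first by rewrite mE lp.1 lq.1 adde0.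
  by move=> a b a0; rewrite mE lte_add_pinfty ?lp.2 ?lq.2.
have [|f [mf f0] fE] := dominated_density lp lm.
  by move=> A mA; rewrite mE leeDl.
have [|g [mg g0] gE] := dominated_density lq lm.
  by move=> A mA; rewrite mE leeDr.
pose u x := Num.max (f x - g x) 0; pose v x := Num.max (g x - f x) 0.
have mu_ : measurable_fun setT (u : T -> R).
  by apply: measurable_maxr => //; exact: measurable_funB.
have mv : measurable_fun setT (v : T -> R).
  by apply: measurable_maxr => //; exact: measurable_funB.
have u0 x : 0 <= u x by rewrite le_max lexx orbT.
have v0 x : 0 <= v x by rewrite le_max lexx orbT.
have [p' p'E] := density_exists m mu_ u0.
have [q' q'E] := density_exists m mv v0.
have EF (h : T -> R) A : measurable_fun setT h -> measurable_fun A (fun x => (h x)%:E).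
  by move=> mh; apply/measurable_EFinP; exact: measurable_funTS.
exists p', q'; split.
- exists [set x | f x <= g x].
    rewrite -[X in measurable X]setTI -[X in _ `&` X]/((fun x => f x <= g x) @^-1` [set true]).
    by apply: (measurable_fun_ler mf mg) => //.
  have mfg : measurable [set x | f x <= g x].
    rewrite -[X in measurable X]setTI -[X in _ `&` X]/((fun x => f x <= g x) @^-1` [set true]).
    by apply: (measurable_fun_ler mf mg) => //.
  split; [rewrite p'E//|rewrite q'E; last exact: measurableC].
    by apply: integral0_eq => x /= fg; rewrite /u max_r// subr_le0.
  apply: integral0_eq => x /= /negP; rewrite -ltNge => gf.
  by rewrite /v max_r// subr_le0 ltW.
- move=> A mA; rewrite p'E// fE//; apply: ge0_le_integral => //.
  + by move=> x _; rewrite lee_fin.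
  + exact: EF.
  + exact: EF.
  + by move=> x _; rewrite lee_fin /u ge_max f0 andbT gerBl.
- move=> A mA; rewrite q'E// gE//; apply: ge0_le_integral => //.
  + by move=> x _; rewrite lee_fin.
  + exact: EF.
  + exact: EF.
  + by move=> x _; rewrite lee_fin /v ge_max g0 andbT gerBl.
move=> A mA; rewrite p'E// q'E// fE// gE//.
rewrite -!ge0_integralD//; try exact: EF; try by move=> x _; rewrite lee_fin.
apply: eq_integral => x _; rewrite -!EFinD; congr (_%:E); rewrite /u /v.
have [fg|fg] := leP (f x) (g x).
  by rewrite max_r ?subr_le0// max_l ?subr_ge0// add0r addrC subrK.
by rewrite max_l ?subr_ge0 1?ltW// max_r ?subr_le0 1?ltW// addr0 subrK.
Qed.

Lemma measure_setI_null m (A E : set T) : measurable A -> measurable E ->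
  m E = 0%E -> m (A `&` E) = 0%E.
Proof.
move=> mA mE m0; apply/eqP; rewrite eq_le measure_ge0 andbT -m0.
by apply: le_measure; rewrite ?inE//; exact: measurableI.
Qed.

Lemma measure_setIC_null m (A E : set T) : measurable A -> measurable E ->
  m E = 0%E -> m (A `&` ~` E) = m A.
Proof.
move=> mA mE m0.
have -> : (m A = m (A `\` E) + m (A `&` E))%E by rewrite -measureDI.
by rewrite (measure_setI_null mA mE m0) adde0 setDE.
Qed.

(** On a set that carries p the measure q vanishes, and there the equality reads
    p + q' = p'. *)
Lemma singular_le p q p' q' : mutually_singular p q ->
  (forall A, measurable A -> (p A + q' A = p' A + q A)%E) ->
  (forall A, measurable A -> (p A <= p' A)%E) /\
  (forall A, measurable A -> (q A <= q' A)%E).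
Proof.
move=> [E mE [pE qE]] H; have mEc := measurableC mE; split=> A mA.
  have mAE := measurableI _ _ mA mEc.
  rewrite -(measure_setIC_null mA mE pE).
  apply: (@le_trans _ _ (p (A `&` ~` E) + q' (A `&` ~` E))%E).
    by rewrite leeDl.
  rewrite H// (measure_setI_null mA mEc qE) adde0.
  by apply: le_measure; rewrite ?inE//.
have mAE := measurableI _ _ mA mE.
rewrite -(measure_setIC_null mA mEc qE) setCK.
apply: (@le_trans _ _ (p' (A `&` E) + q (A `&` E))%E).
  by rewrite leeDr.
rewrite -H// (measure_setI_null mA mE pE) add0e.
by apply: le_measure; rewrite ?inE//.
Qed.

End jordan.

(** * Limits of signed measures *)
Lemma ge_id_cvg (eta : nat -> nat) : (forall j, (j <= eta j)%N) -> eta j @[j --> \oo] --> \oo.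
Proof.
move=> he A [N _ HN]; exists N => // j /= Nj; apply: HN => /=.
exact: leq_trans Nj (he j).
Qed.

Section signed_limits.
Context {R : realType}.
Local Notation T := (measurableTypeR R).
Local Notation posmeasure := {measure set T -> \bar R}.
Variable w : R -> R.
Hypothesis w_ge0 : forall x, 0 < x -> 0 <= w x.
Hypothesis w_submul : forall x y, 0 < x -> 0 < y -> w (x * y) <= w x * w y.
Implicit Types (r nu : rmeasure R) (k : T -> R) (phi : R -> R) (C : R).

Definition action r phi : R := \int[rpos r]_x phi x - \int[rneg r]_x phi x.

Definition rgrowth C r := growth w C (rpos r) /\ growth w C (rneg r).

Lemma growth_le C (m1 m2 : posmeasure) : locally_finite m2 ->
  (forall A, measurable A -> (m2 A <= m1 A)%E) -> growth w C m1 -> growth w C m2.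
Proof.
by move=> lf le [_ gm]; split=> [|x x0]; [exact: lf.1|exact: le_trans (le _ _) (gm x x0)].
Qed.

Lemma locally_finite_le (m1 m2 : posmeasure) : (forall A, measurable A -> (m2 A <= m1 A)%E) ->
  locally_finite m1 -> locally_finite m2.
Proof.
move=> le [m0 mf]; split=> [|a b a0]; last exact: le_lt_trans (le _ _) (mf a b a0).
apply/eqP; rewrite eq_le measure_ge0 andbT -m0; apply: le.
exact: measurableC measurable_halfline.
Qed.

Lemma jordan_action (p q p' q' : posmeasure) phi a b :
  locally_finite p -> locally_finite q -> locally_finite p' -> locally_finite q' ->
  (forall A, measurable A -> (p' A + q A = p A + q' A)%E) -> test_fun phi a b ->
  \int[p']_x phi x - \int[q']_x phi x = \int[p]_x phi x - \int[q]_x phi x.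
Proof.
move=> lp lq lp' lq' H tphi.
have [s [sE sI]] := sum_measure p' q; have [t [tE tI]] := sum_measure p q'.
have I m : locally_finite m -> m.-integrable setT (EFin \o (phi : T -> R)).
  exact: test_fun_integrable tphi.
have : \int[s]_x phi x = \int[t]_x phi x.
  rewrite /Rintegral; congr fine; apply: eq_measure_integral => A mA _.
  by rewrite sE tE H.
rewrite sI ?tI; [|exact: I..]; lra.
Qed.

Lemma signed_selection_parts C (r_ : nat -> rmeasure R) : 0 <= C ->
  (forall n, rgrowth C (r_ n)) ->
  exists eta : nat -> nat, (forall j, (j <= eta j)%N) /\
  exists p q : posmeasure, [/\ locally_finite p, locally_finite q &
    forall phi a b, test_fun phi a b ->
      (\int[rpos (r_ (eta j))]_x phi x @[j --> \oo] --> \int[p]_x phi x) /\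
      (\int[rneg (r_ (eta j))]_x phi x @[j --> \oo] --> \int[q]_x phi x)].
Proof.
move=> C0 gr.
have [e1 [he1 [p lp Hp]]] := halfline_selection w_ge0 w_submul C0 (fun n => (gr n).1).
have [e2 [he2 [q lq Hq]]] := halfline_selection w_ge0 w_submul C0 (fun n => (gr (e1 n)).2).
exists (e1 \o e2); split=> [j|]; first exact: leq_trans (he2 j) (he1 _).
exists p, q; split=> // phi a b tphi; split; last exact: Hq tphi.
exact: (cvg_comp _ _ (ge_id_cvg he2) (Hp phi a b tphi)).
Qed.

(** The two parts converge separately along a subsequence. Their limits need not
    be mutually singular, so the Jordan decomposition of the difference is
    taken. *)
Lemma signed_selection C (r_ : nat -> rmeasure R) : 0 <= C ->
  (forall n, rgrowth C (r_ n)) ->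
  exists eta : nat -> nat, (forall j, (j <= eta j)%N) /\
  exists2 nu, real_radon nu & forall phi a b, test_fun phi a b ->
      action (r_ (eta j)) phi @[j --> \oo] --> action nu phi.
Proof.
move=> C0 gr; have [eta [he [p [q [lp lq H]]]]] := signed_selection_parts C0 gr.
have [p' [q' [sing pp qq E]]] := jordan_difference lp lq.
have lp' := locally_finite_le pp lp; have lq' := locally_finite_le qq lq.
exists eta; split=> //; exists (RMeasure p' q'); first by split=> //=; exact/positive_radonP.
move=> phi a b tphi; have [h1 h2] := H _ _ _ tphi.
by rewrite /action/= (jordan_action lp lq lp' lq' E tphi); exact: cvgB.
Qed.

(** The limits of the two parts may have a common part; the parts of nu, being
    mutually singular, lie below them. *)
Lemma signed_limit_growth : exists2 D, 0 <= D & forall C (r_ : nat -> rmeasure R) nu,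
  0 <= C -> (forall n, rgrowth C (r_ n)) -> real_radon nu ->
  (forall phi a b, test_fun phi a b -> action (r_ n) phi @[n --> \oo] --> action nu phi) ->
  rgrowth (C * D) nu.
Proof.
have [D D0 HD] := growth_limit w_ge0 w_submul.
exists D => // C r_ nu C0 gr [/positive_radonP l1 /positive_radonP l2 sing] H.
have [eta [he [p [q [lp lq Hpq]]]]] := signed_selection_parts C0 gr.
have gp : growth w (C * D) p.
  apply: (HD C (fun j => rpos (r_ (eta j)))) => //; last by move=> phi a b /Hpq[].
  by apply: nearW => n; exact: (gr _).1.
have gq : growth w (C * D) q.
  apply: (HD C (fun j => rneg (r_ (eta j)))) => //; last by move=> phi a b /Hpq[].
  by apply: nearW => n; exact: (gr _).2.
have E phi a b : test_fun phi a b -> \int[rpos nu]_x phi x - \int[rneg nu]_x phi x =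
    \int[p]_x phi x - \int[q]_x phi x.
  move=> tphi; have [h1 h2] := Hpq _ _ _ tphi.
  have h3 := cvg_comp _ _ (ge_id_cvg he) (H _ _ _ tphi).
  exact: (norm_cvg_unique h3 (cvgB h1 h2)).
have [le1 le2] := singular_le sing (test_fun_difference_unique l1 l2 lp lq E).
by split; [exact: growth_le gp|exact: growth_le gq].
Qed.

Definition rpairing phi k r : R := pairing phi k (rpos r) - pairing phi k (rneg r).

Lemma rpairing_cvg C (r_ : nat -> rmeasure R) nu : 0 <= C ->
  (forall n, rgrowth C (r_ n)) -> real_radon nu ->
  (forall phi a b, test_fun phi a b -> action (r_ n) phi @[n --> \oo] --> action nu phi) ->
  forall phi a b k, test_fun phi a b -> admissible w k ->
  rpairing phi k (r_ n) @[n --> \oo] --> rpairing phi k nu.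
Proof.
move=> C0 gr rnu H phi a b k tphi ak.
have [D D0 HD] := signed_limit_growth.
have [g1 g2] := HD C r_ nu C0 gr rnu H.
have CD0 : 0 <= C + C * D by rewrite addr_ge0 ?mulr_ge0.
have mono A B m : A <= B -> growth w A m -> growth w B m.
  move=> AB [m0 gm]; split=> // x x0; apply: le_trans (gm x x0) _.
  by rewrite lee_fin ler_wpM2r// w_ge0.
apply: (@pairing_cvg _ _ w_ge0 w_submul (fun n => rpos (r_ n)) (fun n => rneg (r_ n))
  (rpos nu) (rneg nu) (C + C * D) CD0 _ _ _ H phi a b k tphi ak).
- apply: nearW => n; split; apply: mono (gr n).1 || apply: mono (gr n).2.
  + by rewrite lerDl mulr_ge0.
  + by rewrite lerDl mulr_ge0.
- by apply: mono g1; rewrite lerDr.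
- by apply: mono g2; rewrite lerDr.
Qed.

End signed_limits.

(** * Signed measures with a locally integrable density *)
Section signed_density.
Context {R : realType}.
Local Notation T := (measurableTypeR R).
Local Notation posmeasure := {measure set T -> \bar R}.
Local Notation leb := (@lebesgue_measure R).
Implicit Types (r s : rmeasure R) (h : T -> R) (phi : R -> R).

(** The densities of the two parts of h(u) du; the indicator carries them to
    (0, oo). *)
Definition pos_density h (x : T) : R := Num.max (h x) 0 * \1_(halfline : set T) x.
Definition neg_density h (x : T) : R := Num.max (- h x) 0 * \1_(halfline : set T) x.

Definition signed_density h s :=
  is_density leb (pos_density h) (rpos s) /\ is_density leb (neg_density h) (rneg s).

Definition halfline_integrable h := measurable_fun setT h /\
  forall a b : R, 0 < a -> leb.-integrable `[a, b] (EFin \o h).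

Lemma halfline_integrableN h : halfline_integrable h -> halfline_integrable (fun x => - h x).
Proof.
move=> [mh ih]; split=> [|a b a0]; first exact: measurableT_comp.
have mab : measurable (`[a, b]%classic : set T) by exact: measurable_itv.
exact: (integrableN (ih a b a0)).
Qed.

Lemma halfline_integrableB h1 h2 : halfline_integrable h1 -> halfline_integrable h2 ->
  halfline_integrable (fun x => h1 x - h2 x).
Proof.
move=> [mh1 i1] [mh2 i2]; split=> [|a b a0]; first exact: measurable_funB.
have mab : measurable (`[a, b]%classic : set T) by exact: measurable_itv.
exact: (integrableB mab (i1 a b a0) (i2 a b a0)).
Qed.

Lemma pos_density_ge0 h x : 0 <= pos_density h x.
Proof. by rewrite mulr_ge0 ?indicE// le_max lexx orbT. Qed.

Lemma pos_density_le h x : pos_density h x <= `|h x|.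
Proof.
rewrite -[leRHS]mulr1; apply: ler_pM; rewrite ?le_max ?lexx ?orbT//.
by rewrite ge_max normr_ge0 ler_norm.
Qed.

Lemma measurable_pos_density h : measurable_fun setT h -> measurable_fun setT (pos_density h).
Proof.
move=> mh; apply: measurable_funM; first exact: measurable_maxr.
exact: measurable_indic measurable_halfline.
Qed.

Lemma pos_neg_density h x : halfline x -> pos_density h x - neg_density h x = h x.
Proof.
move=> xh; rewrite /pos_density /neg_density indicE mem_set// !mulr1.
case/orP: (le_total 0 (h x)) => h0.
  by rewrite max_l// max_r ?subr0// oppr_le0.
by rewrite max_r// max_l ?opprK ?add0r// oppr_ge0.
Qed.

Lemma pos_density_integrable h (E : set T) : measurable E -> measurable_fun setT h ->
  leb.-integrable E (EFin \o h) -> leb.-integrable E (EFin \o pos_density h).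
Proof.
move=> mE mh; apply: le_integrable => //.
  by apply/measurable_EFinP; apply: measurable_funTS; exact: measurable_pos_density.
by move=> x _; rewrite /= lee_fin (ger0_norm (pos_density_ge0 h x)) pos_density_le.
Qed.

Lemma density_locally_finite h (m : posmeasure) : halfline_integrable h ->
  is_density leb (pos_density h) m -> locally_finite m.
Proof.
move=> [mh ih] mE; split.
  rewrite mE; last exact: measurableC measurable_halfline.
  by apply: integral0_eq => x xh; rewrite /pos_density indicE memNset// mulr0.
move=> a b a0; rewrite mE; last exact: measurable_itv.
have mab : measurable (`[a, b]%classic : set T) by exact: measurable_itv.
have /integrableP[_] := pos_density_integrable mab mh (ih a b a0).
by under eq_integral do rewrite /= ger0_norm ?pos_density_ge0//.
Qed.

Lemma signed_density_radon h s : halfline_integrable h -> signed_density h s -> real_radon s.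
Proof.
move=> lh [sp sn]; split; [exact/positive_radonP/(density_locally_finite lh)| |].
  exact/positive_radonP/(density_locally_finite (halfline_integrableN lh)).
have mN : measurable [set x : T | h x <= 0].
  rewrite -[X in measurable X]setTI -[X in _ `&` X]/((fun x => h x <= 0) @^-1` [set true]).
  by apply: (measurable_fun_ler lh.1 (@measurable_cst _ _ _ _ setT (0 : T))) => //.
exists [set x | h x <= 0] => //; split.
  rewrite sp//; apply: integral0_eq => x /= h0.
  by rewrite /pos_density max_r// mul0r.
rewrite sn; last exact: measurableC.
apply: integral0_eq => x /= /negP; rewrite -ltNge => h0.
by rewrite /neg_density max_r ?mul0r// oppr_le0 ltW.
Qed.

Lemma signed_density_exists h : measurable_fun setT h -> exists s, signed_density h s.
Proof.
move=> mh; have mh' : measurable_fun setT (fun x => - h x) by exact: measurableT_comp.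
have [p pE] := density_exists leb (measurable_pos_density mh) (pos_density_ge0 h).
have [n nE] := density_exists leb (measurable_pos_density mh') (pos_density_ge0 _).
by exists (RMeasure p n).
Qed.

Lemma signed_density_rvalue h s (E : set T) : signed_density h s ->
  measurable_fun setT h -> measurable E -> E `<=` halfline ->
  leb.-integrable E (EFin \o h) -> rvalue s E = \int[leb]_(x in E) h x.
Proof.
move=> [sp sn] mh mE Eh ih; rewrite /rvalue sp// sn//.
have ip := pos_density_integrable mE mh ih.
have ih' : leb.-integrable E (EFin \o (fun x => - h x)).
  exact: (integrableN ih).
have in_ : leb.-integrable E (EFin \o neg_density h).
  by apply: pos_density_integrable ih' => //; exact: measurableT_comp.
rewrite -[LHS]/(\int[leb]_(x in E) pos_density h x - \int[leb]_(x in E) neg_density h x).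
rewrite -RintegralB//; apply: eq_Rintegral => x; rewrite inE => /Eh xh.
exact: pos_neg_density.
Qed.

Lemma signed_density_action h s phi a b : signed_density h s -> halfline_integrable h ->
  test_fun phi a b -> action s phi = \int[leb]_x (phi x * h x).
Proof.
move=> [sp sn] [mh ih] tphi; have [_ a0 _] := tphi.
have mab : measurable (`[a, b]%classic : set T) by exact: measurable_itv.
have mphi := measurable_test_fun tphi.
have [mh' ih'] := halfline_integrableN (conj mh ih).
have I g : measurable_fun setT g -> leb.-integrable `[a, b] (EFin \o g) ->
    leb.-integrable setT (EFin \o (fun x => phi x * pos_density g x)).
  move=> mg ig; apply: (test_fun_mul_integrable tphi); first exact: measurable_pos_density.
  exact: pos_density_integrable.
have E g (m : posmeasure) : measurable_fun setT g -> is_density leb (pos_density g) m ->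
    \int[m]_x phi x = \int[leb]_x (phi x * pos_density g x).
  move=> mg mE; rewrite /Rintegral.
  by rewrite (integral_density (measurable_pos_density mg) (pos_density_ge0 g) mE measurableT).
rewrite /action (E _ _ mh sp) (E _ _ mh' sn) -RintegralB//; last 2 first.
- exact: I (ih _ _ a0).
- exact: I (ih' _ _ a0).
apply: eq_Rintegral => x _; rewrite -mulrBr.
have [xh|xh] := pselect (halfline x); first by rewrite pos_neg_density.
by rewrite (test_fun_le0 tphi) ?mul0r// leNgt; apply/negP; rewrite -halflineE.
Qed.

Lemma signed_density_le h s (E : set T) : measurable E -> measurable_fun setT h ->
  signed_density h s ->
  (rpos s E <= \int[leb]_(x in E) `|h x|%:E)%E /\ (rneg s E <= \int[leb]_(x in E) `|h x|%:E)%E.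
Proof.
move=> mE mh [sp sn].
have L g (m : posmeasure) : measurable_fun setT g -> is_density leb (pos_density g) m ->
    (m E <= \int[leb]_(x in E) `|g x|%:E)%E.
  move=> mg mE'; rewrite mE'//; apply: ge0_le_integral => //.
  - by move=> x _; rewrite lee_fin pos_density_ge0.
  - by apply/measurable_EFinP; apply: measurable_funTS; exact: measurable_pos_density.
  - by apply/measurable_EFinP; apply: measurable_funTS; exact: measurableT_comp.
  - by move=> x _; rewrite lee_fin pos_density_le.
split; first exact: L sp.
rewrite (_ : (\int[leb]_(x in E) _)%E = \int[leb]_(x in E) `|- h x|%:E)%E.
  by apply: L sn; exact: measurableT_comp.
by apply: eq_integral => x _; rewrite normrN.
Qed.

End signed_density.

(** * The transform of a complex measure *)
Section complex_transform.
Context {R : realType}.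
Local Notation T := (measurableTypeR R).
Local Notation posmeasure := {measure set T -> \bar R}.
Local Notation leb := (@lebesgue_measure R).
Local Notation Re := (@complex.Re R).
Local Notation Im := (@complex.Im R).
Implicit Types (r : rmeasure R) (mu : cmeasure R) (k : T -> R) (K : R -> R[i]) (phi : R -> R).

Definition kernel_re K : T -> R := (fun t => Re (K t)) \_ halfline.
Definition kernel_im K : T -> R := (fun t => Im (K t)) \_ halfline.

Definition rtransform k r u := kernel_transform k (rpos r) u - kernel_transform k (rneg r) u.

(** The real and imaginary part of the transform, with K and mu split into real
    parts. They are measurable on the whole line because the kernels vanish off
    (0, oo). *)
Definition transform_re K mu (u : T) : R :=
  rtransform (kernel_re K) (cre mu) u - rtransform (kernel_im K) (cim mu) u.
Definition transform_im K mu (u : T) : R :=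
  rtransform (kernel_im K) (cre mu) u + rtransform (kernel_re K) (cim mu) u.

Lemma halfline_div (x u : R) : 0 < u -> halfline (x / u) = halfline x :> Prop.
Proof. by move=> u0; rewrite !halflineE pmulr_lgt0// invr_gt0. Qed.

Lemma patch_halfline_div (f : R -> R) (x u : R) : 0 < u ->
  (f \_ halfline) (x / u) = ((fun x => f (x / u)) \_ halfline) x.
Proof.
move=> u0; rewrite /patch.
by have -> : (x / u \in halfline) = (x \in halfline) by apply/idP/idP; rewrite !inE (halfline_div x u0).
Qed.

Lemma transformE K mu u : 0 < u ->
  transform K mu u = (transform_re K mu u +i* transform_im K mu u)%C.
Proof.
move=> u0.
have E (f : R -> R) (m : posmeasure) :
    \int[m]_(x in halfline) f (x / u) = kernel_transform (f \_ halfline) m u.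
  rewrite Rintegral_mkcond /kernel_transform; apply: eq_Rintegral => x _.
  by rewrite patch_halfline_div.
rewrite /transform /radon_integral /cintegral.
rewrite !(E (fun t => Re (K t))) !(E (fun t => Im (K t))).
by rewrite /transform_re /transform_im /rtransform /=; simpc.
Qed.

Lemma kernel_admissible rho (f : R -> R) :
  measurable_fun (halfline : set T) (f : T -> R) ->
  leb.-integrable halfline
    (fun t : T => (t `^ (order_at_infinity rho - 1) * gamma rho t * f t)%:E) ->
  admissible (weight rho) (f \_ halfline).
Proof.
move=> mf fi; split.
- exact/(measurable_restrictT _ measurable_halfline).
- move=> x x0; rewrite patchE memNset// halflineE => x1.
  by move: x0; rewrite leNgt x1.
apply: eq_integrable fi => //; first exact: measurable_halfline.
move=> t; rewrite inE => th; rewrite patchE mem_set//.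
have t0 : 0 < t by rewrite -halflineE.
rewrite /weight powRD ?(gt_eqF t0) ?implybT// powR_inv1 ?ltW//.
by congr (_%:E); rewrite [RHS]mulrC; congr (_ * _); rewrite mulrAC.
Qed.

Lemma kernels_admissible rho K : borel_fun halfline K ->
  cintegrable leb halfline
    (fun t => (t `^ (order_at_infinity rho - 1) * gamma rho t)%:C%C * K t) ->
  admissible (weight rho) (kernel_re K) /\ admissible (weight rho) (kernel_im K).
Proof.
move=> [mr mi] [ir ii]; split; apply: kernel_admissible => //.
  apply: eq_integrable ir => //; first exact: measurable_halfline.
  by move=> t _; rewrite /=; case: (K t) => a b /=; rewrite mul0r subr0.
apply: eq_integrable ii => //; first exact: measurable_halfline.
by move=> t _; rewrite /=; case: (K t) => a b /=; rewrite mul0r addr0.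
Qed.

Section growth_class.
Variable w : R -> R.
Hypothesis w_ge0 : forall x, 0 < x -> 0 <= w x.
Hypothesis w_submul : forall x y, 0 < x -> 0 < y -> w (x * y) <= w x * w y.
Variables (C : R) (mu : cmeasure R) (K : R -> R[i]).
Hypotheses (C0 : 0 <= C) (gre : rgrowth w C (cre mu)) (gim : rgrowth w C (cim mu)).
Hypotheses (are : admissible w (kernel_re K)) (aim : admissible w (kernel_im K)).

Lemma transform_integrable_ae :
  {ae leb, forall u : R, halfline u -> transform_integrable K mu u}.
Proof.
have E (f : R -> R) (m : posmeasure) u : 0 < u ->
    m.-integrable setT (fun x : T => ((f \_ halfline) (x / u))%:E) ->
    m.-integrable halfline (EFin \o (fun x : T => f (x / u))).
  move=> u0 fi; apply/(integrable_mkcond _ measurable_halfline).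
  apply: eq_integrable fi => // x _; rewrite patch_halfline_div// /patch.
  by case: ifP.
have H m k := kernel_transform_ae w_ge0 w_submul C0 (m := m) (k := k).
pose P m := {ae leb, forall u : R, halfline u -> cintegrable m halfline (fun t => K (t / u))}.
have HP m : growth w C m -> P m.
  move=> gm; apply: (@filterS2 _ (almost_everywhere leb) _ _ _ _ _ (H m _ gm are) (H m _ gm aim)).
  move=> u h1 h2; rewrite halflineE => u0.
  by split; [exact: (E _ _ _ u0 (h1 u0))|exact: (E _ _ _ u0 (h2 u0))].
apply: (@filterS2 _ (almost_everywhere leb) _ _ _ _ _
  (@filterS2 _ (almost_everywhere leb) _ _ _ _ (fun u h1 h2 => conj h1 h2) (HP _ gre.1) (HP _ gre.2))
  (@filterS2 _ (almost_everywhere leb) _ _ _ _ (fun u h1 h2 => conj h1 h2) (HP _ gim.1) (HP _ gim.2))).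
by move=> u [h1 h2] [h3 h4] uh; split; auto.
Qed.

Lemma rtransform_halfline_integrable k r : admissible w k -> rgrowth w C r ->
  halfline_integrable (rtransform k r).
Proof.
move=> ak [g1 g2]; have [mk _ _] := ak.
apply: halfline_integrableB; split.
- exact: measurable_kernel_transform (growth_locally_finite w_ge0 w_submul C0 g1).
- by move=> a b a0; exact: integrable_kernel_transform C0 g1 ak.
- exact: measurable_kernel_transform (growth_locally_finite w_ge0 w_submul C0 g2).
- by move=> a b a0; exact: integrable_kernel_transform C0 g2 ak.
Qed.

Lemma transform_re_halfline_integrable : halfline_integrable (transform_re K mu).
Proof. by apply: halfline_integrableB; exact: rtransform_halfline_integrable. Qed.

Lemma transform_im_halfline_integrable : halfline_integrable (transform_im K mu).
Proof.
have h1 := rtransform_halfline_integrable aim gre.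
have h2 := halfline_integrableN (rtransform_halfline_integrable are gim).
have -> : transform_im K mu =
    fun u => rtransform (kernel_im K) (cre mu) u - (- rtransform (kernel_re K) (cim mu) u).
  by apply/funext => u; rewrite opprK.
exact: halfline_integrableB.
Qed.

Lemma rtransform_pairing phi a b k r : test_fun phi a b -> admissible w k -> rgrowth w C r ->
  leb.-integrable setT (fun u : T => (phi u * rtransform k r u)%:E) /\
  \int[leb]_u (phi u * rtransform k r u) = rpairing phi k r.
Proof.
move=> tphi ak [g1 g2]; have i1 := integrable_pairing w_ge0 w_submul tphi C0 g1 ak.
have i2 := integrable_pairing w_ge0 w_submul tphi C0 g2 ak.
have E u : phi u * rtransform k r u =
    phi u * kernel_transform k (rpos r) u - phi u * kernel_transform k (rneg r) u.
  by rewrite -mulrBr.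
split; first by apply: eq_integrable (integrableB measurableT i1 i2) => // u _; rewrite E EFinB.
by rewrite /rpairing /pairing -RintegralB//; apply: eq_Rintegral => u _; rewrite E.
Qed.

Lemma transform_re_pairing phi a b : test_fun phi a b ->
  \int[leb]_u (phi u * transform_re K mu u) =
  rpairing phi (kernel_re K) (cre mu) - rpairing phi (kernel_im K) (cim mu).
Proof.
move=> tphi; have [i1 <-] := rtransform_pairing tphi are gre.
have [i2 <-] := rtransform_pairing tphi aim gim.
by rewrite -RintegralB//; apply: eq_Rintegral => u _; rewrite -mulrBr.
Qed.

Lemma transform_im_pairing phi a b : test_fun phi a b ->
  \int[leb]_u (phi u * transform_im K mu u) =
  rpairing phi (kernel_im K) (cre mu) + rpairing phi (kernel_re K) (cim mu).
Proof.
move=> tphi; have [i1 <-] := rtransform_pairing tphi aim gre.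
have [i2 <-] := rtransform_pairing tphi are gim.
by rewrite -RintegralD//; apply: eq_Rintegral => u _; rewrite -mulrDr.
Qed.

End growth_class.
End complex_transform.

(** * Wide convergence of complex measures *)
Section complex_measures.
Context {R : realType}.
Local Notation T := (measurableTypeR R).
Local Notation posmeasure := {measure set T -> \bar R}.
Local Notation leb := (@lebesgue_measure R).
Local Notation Re := (@complex.Re R).
Local Notation Im := (@complex.Im R).
Local Notation normc := (@ComplexField.Normc.normc R).
Local Notation total_variation := (@Defs.total_variation R).
Implicit Types (r : rmeasure R) (mu nu : cmeasure R) (phi : R -> R) (rho : R -> R)
  (f g : R -> R[i]).

Lemma normc_ge0 (z : R[i]) : 0 <= normc z.
Proof. by case: z => a b; exact: sqrtr_ge0. Qed.

Lemma Re_le_normc (z : R[i]) : `|Re z| <= normc z.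
Proof. by case: z => a b /=; rewrite -sqrtr_sqr ler_wsqrtr// lerDl sqr_ge0. Qed.

Lemma Im_le_normc (z : R[i]) : `|Im z| <= normc z.
Proof. by case: z => a b /=; rewrite -sqrtr_sqr ler_wsqrtr// lerDr sqr_ge0. Qed.

Lemma normc_le (z : R[i]) : normc z <= `|Re z| + `|Im z|.
Proof.
case: z => a b /=; rewrite -[leRHS]ger0_norm ?addr_ge0// -sqrtr_sqr ler_wsqrtr//.
rewrite sqrrD !real_normK ?num_real// lerD2r lerDl.
by rewrite mulrn_wge0// mulr_ge0.
Qed.

Lemma ccvgP (z : nat -> R[i]) (l : R[i]) : ccvg z l <->
  (Re (z n) @[n --> \oo] --> Re l) /\ (Im (z n) @[n --> \oo] --> Im l).
Proof.
have ReB (x y : R[i]) : Re (x - y) = Re x - Re y by case: x y => ? ? [].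
have ImB (x y : R[i]) : Im (x - y) = Im x - Im y by case: x y => ? ? [].
split=> [/cvgr0Pnorm_lt H|[/cvgrPdist_lt h1 /cvgrPdist_lt h2]].
  by split; apply/cvgrPdist_lt => e e0; move: (H e e0); apply: filterS => n;
    rewrite ger0_norm ?normc_ge0// => zn; rewrite distrC; apply: le_lt_trans zn;
    rewrite -(ReB, ImB); (exact: Re_le_normc || exact: Im_le_normc).
apply/cvgr0Pnorm_lt => e e0; have e2 : 0 < e / 2 by rewrite divr_gt0.
move: (h1 _ e2) (h2 _ e2); apply: filterS2 => n; rewrite distrC => k1; rewrite distrC => k2.
rewrite ger0_norm ?normc_ge0//; apply: le_lt_trans (normc_le _) _.
by rewrite ReB ImB (splitr e) ltrD.
Qed.

Definition rfinite r := locally_finite (rpos r) /\ locally_finite (rneg r).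
Definition cfinite mu := rfinite (cre mu) /\ rfinite (cim mu).

Lemma complex_radon_finite mu : complex_radon mu -> cfinite mu.
Proof. by move=> [[? ? _] [? ? _]]; do 2!split; exact/positive_radonP. Qed.

Lemma radon_integral_test mu phi a b : cfinite mu -> test_fun phi a b ->
  radon_integral mu halfline (fun x => (phi x)%:C%C) =
  (action (cre mu) phi +i* action (cim mu) phi)%C.
Proof.
move=> [[l1 l2] [l3 l4]] tphi; rewrite /radon_integral /cintegral /=.
have E (m : posmeasure) : locally_finite m ->
    \int[m]_(x in halfline) phi x = \int[m]_x phi x.
  by move=> lm; rewrite -Rintegral_halfline//; [exact: lm.1|exact: test_fun_integrable tphi lm].
rewrite !E//.
have Z (m : posmeasure) : \int[m]_(x in halfline) (0 : R) = 0.
  by rewrite /Rintegral integral0.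
by rewrite !Z; simpc.
Qed.

Lemma wide_cvgP (mu_ : nat -> cmeasure R) nu :
  (forall n, cfinite (mu_ n)) -> cfinite nu ->
  wide_cvg mu_ nu <-> forall phi a b, test_fun phi a b ->
    (action (cre (mu_ n)) phi @[n --> \oo] --> action (cre nu) phi) /\
    (action (cim (mu_ n)) phi @[n --> \oo] --> action (cim nu) phi).
Proof.
move=> f_ f; split=> [H phi a b tphi|H phi cphi [C [cC Ch] phi0]].
  have [cphi a0 phi0] := tphi.
  have := H phi cphi (ex_intro2 _ _ `[a, b]%classic
    (conj (segment_compact (a := a) (b := b)) (segment_halfline a0)) phi0).
  rewrite (radon_integral_test f tphi) => /ccvgP[h1 h2].
  split; [apply: cvg_trans h1|apply: cvg_trans h2]; apply: near_eq_cvg; apply: nearW => n;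
    by rewrite (radon_integral_test (f_ n) tphi).
have [a [b [a0 ab Cab]]] := compact_in_segment cC Ch.
have tphi : test_fun phi a b by split=> // x nx; apply: phi0 => /Cab.
apply/ccvgP; rewrite (radon_integral_test f tphi).
have [h1 h2] := H _ _ _ tphi.
split; [apply: cvg_trans h1|apply: cvg_trans h2]; apply: near_eq_cvg; apply: nearW => n;
  by rewrite (radon_integral_test (f_ n) tphi).
Qed.

Definition rscale_signed rho t r := RMeasure (rscale rho t (rpos r)) (rscale rho t (rneg r)).

Lemma rscale_locally_finite rho t (m : posmeasure) : 0 < t -> locally_finite m ->
  locally_finite (rscale rho t m).
Proof.
move=> t0 lm; split; first exact: rscale_null t0 lm.1.
move=> a b a0; rewrite rscale_segment//.
have h : (m `[(a * t)%R, (b * t)%R]%classic < +oo)%E by apply: lm.2; rewrite mulr_gt0.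
by rewrite lte_mul_pinfty// lee_fin V_inv_ge0.
Qed.

Lemma azarin_scale_finite rho t mu : 0 < t -> cfinite mu -> cfinite (azarin_scale rho mu t).
Proof. by move=> t0 [[? ?] [? ?]]; do 2!split; exact: rscale_locally_finite. Qed.

Lemma action_rscale rho t r phi a b : 0 < t -> rfinite r -> test_fun phi a b ->
  action (rscale_signed rho t r) phi = (V rho t)^-1 * action r (fun x => phi (x / t)).
Proof.
by move=> t0 [l1 l2] tphi; rewrite /action/= !(Rintegral_rscale rho t0 tphi)// mulrBr.
Qed.

(** The finitely many times t n <= 0 of a sequence tending to +oo are replaced by
    1, so that every term of the rescaled sequence is a Radon measure. *)
Lemma limit_setP rho mu nu : cfinite mu -> limit_set rho mu nu <->
  complex_radon nu /\ exists2 t : nat -> R,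
    (forall n, 0 < t n) /\ t n @[n --> \oo] --> +oo &
    forall phi a b, test_fun phi a b ->
      (action (rscale_signed rho (t n) (cre mu)) phi @[n --> \oo] --> action (cre nu) phi) /\
      (action (rscale_signed rho (t n) (cim mu)) phi @[n --> \oo] --> action (cim nu) phi).
Proof.
move=> fmu; split=> -[rnu]; have fnu := complex_radon_finite rnu; last first.
  move=> [t [t0 tn] H]; split=> //; exists t => //.
  have f_ n := azarin_scale_finite rho (t0 n) fmu.
  exact: (wide_cvgP f_ fnu).2 H.
move=> [t tn H]; split=> //; pose u n := if 0 < t n then t n else 1.
have u0 n : 0 < u n by rewrite /u; case: ifP.
have ut : \forall n \near \oo, u n = t n.
  by move/cvgryPgt : tn => /(_ 0); apply: filterS => n; rewrite /u => ->.
exists u.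
  split=> //; apply: cvg_trans tn; apply: near_eq_cvg; move: ut; apply: filterS => n; exact: esym.
have f_ n := azarin_scale_finite rho (u0 n) fmu.
apply: (wide_cvgP f_ fnu).1.
move=> phi cphi sphi; apply: cvg_trans (H phi cphi sphi); apply: near_eq_cvg.
by move: ut; apply: filterS => n ->.
Qed.

(** * Total variation and the Radon classes *)
Lemma segment_relatively_compact (a b : R) (F : set R) : 0 < a -> F `<=` `[a, b] ->
  relatively_compact F.
Proof.
move=> a0 Fab; exists `[a, b]%classic => //; split; first exact: segment_compact.
exact: segment_halfline.
Qed.

Lemma normc_le_total_variation mu (E F : set T) : measurable F -> relatively_compact F ->
  F `<=` E -> ((normc (cvalue mu F))%:E <= total_variation mu E)%E.
Proof.
move=> mF rF FE; apply: ereal_sup_ubound; exists 1%N, (fun _ => F); split=> //.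
- by move=> i j _ _ _; rewrite (ord1 i) (ord1 j).
- by rewrite big_ord_recl big_ord0 addr0.
Qed.

(** A set separating the two singular parts cuts the segment into a piece where
    the measure equals its positive part and one where it equals minus its
    negative part. *)
Lemma rvalue_parts r (a b : R) : 0 < a -> real_radon r ->
  (exists F : set T, [/\ measurable F, F `<=` `[a, b] &
     rpos r `[a, b]%classic = `|rvalue r F|%:E]) /\
  (exists F : set T, [/\ measurable F, F `<=` `[a, b] &
     rneg r `[a, b]%classic = `|rvalue r F|%:E]).
Proof.
move=> a0 [/positive_radonP lp /positive_radonP ln [E mE [pE nE]]].
have mI : measurable (`[a, b]%classic : set T) by exact: measurable_itv.
have mEc := measurableC mE.
split; [exists (`[a, b]%classic `&` ~` E)|exists (`[a, b]%classic `&` E)]; split.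
- exact: measurableI.
- by move=> x [].
- rewrite /rvalue (measure_setI_null mI mEc nE) subr0 (measure_setIC_null mI mE pE).
  by rewrite ger0_norm ?fine_ge0// fineK// ge0_fin_numE// lp.2.
- exact: measurableI.
- by move=> x [].
- rewrite /rvalue (measure_setI_null mI mE pE) sub0r normrN.
  rewrite -[in RHS](setCK E) (measure_setIC_null mI mEc nE).
  by rewrite ger0_norm ?fine_ge0// fineK// ge0_fin_numE// ln.2.
Qed.

Definition signed_bound r (E : set T) (B : \bar R) := (rpos r E <= B)%E /\ (rneg r E <= B)%E.

Lemma total_variation_ge mu (a b : R) : 0 < a -> complex_radon mu ->
  signed_bound (cre mu) `[a, b]%classic (total_variation mu `[a, b]%classic) /\
  signed_bound (cim mu) `[a, b]%classic (total_variation mu `[a, b]%classic).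
Proof.
move=> a0 [r1 r2].
have L (F : set T) (x : R) : measurable F -> F `<=` `[a, b] -> `|x| <= normc (cvalue mu F) ->
    (`|x|%:E <= total_variation mu `[a, b]%classic)%E.
  move=> mF Fab xF; apply: (@le_trans _ _ (normc (cvalue mu F))%:E).
    by rewrite lee_fin.
  by apply: normc_le_total_variation => //; exact: segment_relatively_compact Fab.
rewrite /signed_bound.
have [[F1 [m1 s1 ->]] [F2 [m2 s2 ->]]] := rvalue_parts b a0 r1.
have [[F3 [m3 s3 ->]] [F4 [m4 s4 ->]]] := rvalue_parts b a0 r2.
split; split.
- exact: L m1 s1 (Re_le_normc (cvalue mu F1)).
- exact: L m2 s2 (Re_le_normc (cvalue mu F2)).
- exact: L m3 s3 (Im_le_normc (cvalue mu F3)).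
- exact: L m4 s4 (Im_le_normc (cvalue mu F4)).
Qed.

Lemma sum_disjoint_le (m : posmeasure) (E : set T) n (F : 'I_n -> set T) :
  measurable E -> (m E < +oo)%E -> (forall k, measurable (F k)) -> (forall k, F k `<=` E) ->
  trivIset setT F -> \sum_(k < n) fine (m (F k)) <= fine (m E).
Proof.
move=> mE fE mF FE tF.
have mU : measurable (\big[setU/set0]_(k < n) F k) by exact: bigsetU_measurable.
have fF k : m (F k) \is a fin_num.
  by rewrite ge0_fin_numE//; apply: le_lt_trans fE; apply: le_measure; rewrite ?inE.
rewrite -lee_fin fineK ?ge0_fin_numE// -sumEFin.
rewrite (eq_bigr (fun k => m (F k))) => [|k _]; last by rewrite fineK.
rewrite -measure_semi_additive_ord//; apply: le_measure; rewrite ?inE//.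
by elim/big_ind: _ => // A B hA hB x [/hA|/hB].
Qed.

Lemma total_variation_le mu (a b B : R) : 0 < a -> cfinite mu ->
  signed_bound (cre mu) `[a, b]%classic B%:E -> signed_bound (cim mu) `[a, b]%classic B%:E ->
  (total_variation mu `[a, b]%classic <= (4 * B)%:E)%E.
Proof.
move=> a0 [[l1 l2] [l3 l4]] [b1 b2] [b3 b4]; apply: ge_ereal_sup => _ [n [F [HF tF ->]]].
rewrite lee_fin.
have mI : measurable (`[a, b]%classic : set T) by exact: measurable_itv.
have S (m : posmeasure) : locally_finite m -> (m `[a, b]%classic <= B%:E)%E ->
    \sum_(k < n) fine (m (F k)) <= B.
  move=> lm mB; have fI := lm.2 a b a0.
  apply: (@le_trans _ _ (fine (m `[a, b]%classic))).
    by apply: sum_disjoint_le => // k; have [] := HF k.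
  by rewrite -lee_fin fineK// ge0_fin_numE.
have := lerD (lerD (S _ l1 b1) (S _ l2 b2)) (lerD (S _ l3 b3) (S _ l4 b4)).
rewrite -!big_split/= (_ : B + B + (B + B) = 4 * B); last by ring.
apply: le_trans; apply: ler_sum => k _; apply: (le_trans (normc_le (cvalue mu (F k)))).
have N (x y : R) : 0 <= x -> 0 <= y -> `|x - y| <= x + y.
  by move=> x0 y0; rewrite ler_norml; apply/andP; split; lra.
by apply: lerD; apply: N; apply: fine_ge0.
Qed.

Lemma radon_class_bound rho mu : radon_class rho mu -> exists2 C, 0 <= C &
  forall x, 0 < x -> signed_bound (cre mu) `[x, (expR 1 * x)%R]%classic (C * V rho x)%:E /\
                     signed_bound (cim mu) `[x, (expR 1 * x)%R]%classic (C * V rho x)%:E.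
Proof.
move=> [rmu]; set S := ereal_sup _ => Sfin.
have HS x : 0 < x -> (total_variation mu `[x, (expR 1 * x)%R]%classic * (V rho x)^-1%:E <= S)%E.
  by move=> x0; apply: ereal_sup_ubound; exists x => //; rewrite halflineE.
have tv0 x : (0 <= total_variation mu `[x, (expR 1 * x)%R]%classic)%E.
  apply: ereal_sup_ubound; exists 0%N, (fun _ => set0); split=> [[]//|[]//|].
  by rewrite big_ord0.
have S0 : (0 <= S)%E.
  by apply: le_trans (HS 1 ltr01); rewrite mule_ge0// lee_fin V_inv_ge0.
have SE : S = (fine S)%:E by rewrite fineK// ge0_fin_numE.
exists (fine S) => [|x x0]; first exact: fine_ge0.
have Vx : 0 < V rho x by exact: powR_gt0.
have le_tv : (total_variation mu `[x, (expR 1 * x)%R]%classic <= (fine S * V rho x)%:E)%E.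
  by rewrite EFinM -SE -lee_pdivrMr//; exact: HS.
have [[h1 h2] [h3 h4]] := total_variation_ge (expR 1 * x) x0 rmu.
by split; split; exact: le_trans le_tv.
Qed.

Lemma radon_class_intro rho mu C : complex_radon mu ->
  (forall x, 0 < x -> signed_bound (cre mu) `[x, (expR 1 * x)%R]%classic (C * V rho x)%:E /\
                      signed_bound (cim mu) `[x, (expR 1 * x)%R]%classic (C * V rho x)%:E) ->
  radon_class rho mu.
Proof.
move=> rmu H; split=> //; apply: (@le_lt_trans _ _ (4 * C)%:E); last exact: ltry.
apply: ge_ereal_sup => _ [x xh <-].
have x0 : 0 < x by rewrite -halflineE.
have Vx : 0 < V rho x by exact: powR_gt0.
rewrite lee_pdivrMr// -EFinM -mulrA; have [h1 h2] := H x x0.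
exact: total_variation_le (complex_radon_finite rmu) h1 h2.
Qed.

Lemma density_abs_continuous mu (f : R -> R[i]) : has_density mu f -> abs_continuous mu.
Proof.
move=> df E mE Eh E0; apply/eqP; rewrite eq_le; apply/andP; split.
  apply: ge_ereal_sup => _ [n [F [HF tF ->]]]; rewrite lee_fin big1// => k _.
  have [mF rF FE] := HF k; have [[i1 i2] ->] := df _ mF rF.
  have F0 : leb (F k) = 0%E.
    apply/eqP; rewrite eq_le measure_ge0 andbT -[leRHS]E0.
    by apply: le_measure; rewrite ?inE.
  rewrite /cintegral /Rintegral (null_set_integral mF (measurable_int _ i1) F0).
  rewrite (null_set_integral mF (measurable_int _ i2) F0) /=.
  by rewrite expr0n addr0 sqrtr0.
apply: ereal_sup_ubound; exists 0%N, (fun _ => set0); split=> [[]//|[]//|].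
by rewrite big_ord0.
Qed.

Lemma Rintegral_unique (f g : T -> R) :
  (forall E : set T, measurable E -> relatively_compact E ->
    [/\ leb.-integrable E (EFin \o f), leb.-integrable E (EFin \o g) &
        \int[leb]_(x in E) f x = \int[leb]_(x in E) g x]) ->
  {ae leb, forall x, halfline x -> f x = g x}.
Proof.
move=> H.
apply: ae_halfline => a b a0.
have mI : measurable (`[a, b]%classic : set T) by exact: measurable_itv.
have [i1 i2 _] := H _ mI (segment_relatively_compact a0 (@subset_refl _ _)).
have : ae_eq leb `[a, b]%classic (EFin \o f) (EFin \o g).
  apply: integral_ae_eq i1 (measurable_int _ i2) _ => // E EI mE.
  have [j1 j2 e] := H _ mE (segment_relatively_compact a0 EI).
  move: (congr1 EFin e); rewrite /Rintegral !fineK//; exact: integrable_fin_num.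
move=> Hfg; apply: (@filterS _ (almost_everywhere leb) _ _ _ _ Hfg) => u Hu uab.
exact: EFin_inj (Hu uab).
Qed.

(** * Densities of complex measures *)

Lemma relatively_compact_segment (E : set R) : relatively_compact E ->
  exists a b, 0 < a /\ E `<=` `[a, b].
Proof.
move=> [C [cC Ch] EC]; have [a [b [a0 ab Cab]]] := compact_in_segment cC Ch.
by exists a, b; split=> // x /EC/Cab.
Qed.

Lemma relatively_compact_halfline (E : set R) : relatively_compact E -> E `<=` halfline.
Proof. by move=> [C [cC Ch] EC] x /EC/Ch. Qed.

Lemma has_density_unique mu f g : has_density mu f -> has_density mu g ->
  ae_eq leb halfline f g.
Proof.
move=> df dg.
have hr : {ae leb, forall x, halfline x -> Re (f x) = Re (g x)}.
  apply: Rintegral_unique => E mE rE; have [[f1 f2] ef] := df _ mE rE.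
  have [[g1 g2] eg] := dg _ mE rE; split=> //.
  by move: ef; rewrite eg => -[/esym].
have hi : {ae leb, forall x, halfline x -> Im (f x) = Im (g x)}.
  apply: Rintegral_unique => E mE rE; have [[f1 f2] ef] := df _ mE rE.
  have [[g1 g2] eg] := dg _ mE rE; split=> //.
  by move: ef; rewrite eg => -[_ /esym].
apply: (@filterS2 _ (almost_everywhere leb) _ _ _ _ _ hr hi) => x h1 h2 xh.
move: (h1 xh) (h2 xh); case: (f x) => a b; case: (g x) => c d /=.
by move=> -> ->.
Qed.

Lemma integral_ae_eq_halfline (E : set T) (u v : T -> R) : measurable E -> E `<=` halfline ->
  measurable_fun halfline u -> {ae leb, forall x, halfline x -> u x = v x} ->
  leb.-integrable E (EFin \o v) ->
  leb.-integrable E (EFin \o u) /\ \int[leb]_(x in E) u x = \int[leb]_(x in E) v x.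
Proof.
move=> mE Eh mu_ uv /integrableP[mv iv].
have mu' : measurable_fun E (EFin \o u).
  apply/measurable_EFinP; apply: measurable_funS mu_ => //; exact: measurable_halfline.
have aeE : ae_eq leb E (EFin \o u) (EFin \o v).
  by apply: (@filterS _ (almost_everywhere leb) _ _ _ _ uv) => x h /Eh xh; rewrite /= h.
split; last by rewrite /Rintegral; congr fine; exact: ae_eq_integral.
apply/integrableP; split=> //.
rewrite (ae_eq_integral (fun x => `|(EFin \o v) x|)%E)//.
- exact: measurableT_comp.
- exact: measurableT_comp.
- by apply: (@filterS _ (almost_everywhere leb) _ _ _ _ aeE) => x h xE; rewrite h.
Qed.

Lemma has_density_ae mu f g : borel_fun halfline f -> ae_eq leb halfline f g ->
  has_density mu g -> has_density mu f.
Proof.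
move=> [m1 m2] fg dg E mE rE; have [[g1 g2] ->] := dg _ mE rE.
have Eh := relatively_compact_halfline rE.
have hr : {ae leb, forall x, halfline x -> Re (f x) = Re (g x)}.
  by apply: (@filterS _ (almost_everywhere leb) _ _ _ _ fg) => x h xh; rewrite h.
have hi : {ae leb, forall x, halfline x -> Im (f x) = Im (g x)}.
  by apply: (@filterS _ (almost_everywhere leb) _ _ _ _ fg) => x h xh; rewrite h.
have [i1 e1] := integral_ae_eq_halfline mE Eh m1 hr g1.
have [i2 e2] := integral_ae_eq_halfline mE Eh m2 hi g2.
by split; [split|rewrite /cintegral e1 e2].
Qed.

Lemma has_density_transform K mu s :
  halfline_integrable (transform_re K mu) -> halfline_integrable (transform_im K mu) ->
  signed_density (transform_re K mu) (cre s) -> signed_density (transform_im K mu) (cim s) ->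
  has_density s (transform K mu).
Proof.
move=> [mr ir] [mi ii] sr si E mE rE; have Eh := relatively_compact_halfline rE.
have [a [b [a0 Eab]]] := relatively_compact_segment rE.
have mab : measurable (`[a, b]%classic : set T) by exact: measurable_itv.
have I (h : T -> R) : leb.-integrable `[a, b] (EFin \o h) -> leb.-integrable E (EFin \o h).
  exact: integrableS.
have TE x : E x -> transform K mu x = (transform_re K mu x +i* transform_im K mu x)%C.
  by move=> /Eh; rewrite halflineE; exact: transformE.
have e1 : \int[leb]_(x in E) Re (transform K mu x) = \int[leb]_(x in E) transform_re K mu x.
  by apply: eq_Rintegral => x; rewrite inE => xE; rewrite TE.
have e2 : \int[leb]_(x in E) Im (transform K mu x) = \int[leb]_(x in E) transform_im K mu x.
  by apply: eq_Rintegral => x; rewrite inE => xE; rewrite TE.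
split; [split|].
- by apply: eq_integrable (I _ (ir a b a0)) => // x; rewrite inE => xE;
    rewrite -[RHS]/((Re (transform K mu x))%:E) TE.
- by apply: eq_integrable (I _ (ii a b a0)) => // x; rewrite inE => xE;
    rewrite -[RHS]/((Im (transform K mu x))%:E) TE.
- rewrite /cintegral e1 e2 /cvalue (signed_density_rvalue sr mr mE Eh (I _ (ir a b a0))).
  by rewrite (signed_density_rvalue si mi mE Eh (I _ (ii a b a0))).
Qed.

End complex_measures.

(** * The measure whose density is the transform *)
Section transform_limits.
Context {R : realType}.
Local Notation T := (measurableTypeR R).
Local Notation posmeasure := {measure set T -> \bar R}.
Local Notation leb := (@lebesgue_measure R).
Variables (rho : R -> R) (K : R -> R[i]).
Hypothesis hrho : proximate_order rho.
Hypothesis are : admissible (weight rho) (kernel_re K).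
Hypothesis aim : admissible (weight rho) (kernel_im K).
Implicit Types (r : rmeasure R) (mu nu s : cmeasure R) (k : T -> R) (C : R).
Let rho1 (x : R) : R := rho x + 1.
Let w := weight rho.
Let w_ge0 := weight_ge0 hrho.
Let w_submul := weight_submul hrho.

Lemma V_add1 (x : R) : 0 < x -> V rho1 x = x * V rho x.
Proof.
move=> x0; rewrite /V /rho1 powRD ?(gt_eqF x0) ?implybT// powRr1 ?ltW//.
by rewrite mulrC.
Qed.

Definition cgrowth C mu := rgrowth w C (cre mu) /\ rgrowth w C (cim mu).

Definition V_bounded C r := rfinite r /\
  forall x, 0 < x -> signed_bound r `[x, (expR 1 * x)%R]%classic (C * V rho x)%:E.

Lemma V_bounded_rgrowth C r t : 0 <= C -> V_bounded C r -> 0 < t ->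
  rgrowth w C (rscale_signed rho t r).
Proof.
move=> C0 [[l1 l2] H] t0; split; apply: growth_rscale => //.
- exact: l1.1.
- by move=> x /H[].
- exact: l2.1.
- by move=> x /H[].
Qed.

Lemma V_bounded_growth C r : 0 <= C -> V_bounded C r -> rgrowth w C r.
Proof.
move=> C0 [[l1 l2] H]; split; apply: growth_V => //.
- exact: l1.1.
- by move=> x /H[].
- exact: l2.1.
- by move=> x /H[].
Qed.

(** m([x v, e x v]) <= C V(x v) <= C V(x) w(v), so the estimate of the double
    integral over [x, e x] carries a factor V(x); the factor e x in front of it
    raises the order by one. *)
Lemma kernel_transform_V C (m : posmeasure) k x : 0 <= C -> locally_finite m ->
  (forall x, 0 < x -> (m `[x, (expR 1 * x)%R]%classic <= (C * V rho x)%:E)%E) ->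
  admissible w k -> 0 < x ->
  (\int[leb]_(u in `[x, (expR 1 * x)%R]) `|kernel_transform k m u|%:E <=
    (expR 1 * C * fine (kernel_norm w k) * V rho1 x)%:E)%E.
Proof.
move=> C0 lm mV ak x0; have [mk _ _] := ak; have [_ fk] := admissible_norm w_ge0 ak.
have mkt := measurable_kernel_transform mk lm.
apply: (@le_trans _ _ (\int[leb]_(u in `[x, (expR 1 * x)%R]) \int[m]_y `|k (y / u)|%:E)%E).
  apply: ge0_le_integral => //.
  - by apply/measurable_EFinP; apply: measurable_funTS; exact: measurableT_comp.
  - by apply: measurable_funTS; exact: measurable_abs_transform.
  - by move=> u _; exact: kernel_transform_le.
have CV0 : 0 <= C * V rho x by rewrite mulr_ge0// powR_ge0.
apply: le_trans (kernel_bound_segment w_ge0 x0 CV0 lm _ ak) _.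
  move=> v v0; rewrite -mulrA; apply: le_trans (mV _ (mulr_gt0 x0 v0)) _.
  by rewrite lee_fin -mulrA ler_wpM2l// [leRHS]mulrC; exact: V_le_weight.
rewrite -[kernel_norm w k]fineK ?ge0_fin_numE ?kernel_norm_ge0//= -EFinM lee_fin.
rewrite (ger0_norm (mulr_ge0 (expR_ge0 1) (ltW x0))) V_add1//.
by rewrite le_eqVlt; apply/orP; left; apply/eqP; ring.
Qed.

Lemma integral_abs_le (E : set T) (f g h : T -> R) (A B : R) : measurable E ->
  measurable_fun setT f -> measurable_fun setT g -> measurable_fun setT h ->
  (forall x, `|h x| <= `|f x| + `|g x|) ->
  (\int[leb]_(x in E) `|f x|%:E <= A%:E)%E -> (\int[leb]_(x in E) `|g x|%:E <= B%:E)%E ->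
  (\int[leb]_(x in E) `|h x|%:E <= (A + B)%:E)%E.
Proof.
move=> mE mf mg mh hfg fA gB.
have M (u : T -> R) : measurable_fun setT u -> measurable_fun E (fun x => `|u x|%:E).
  by move=> mu_; apply/measurable_EFinP; apply: measurable_funTS; exact: measurableT_comp.
apply: (@le_trans _ _ (\int[leb]_(x in E) (`|f x|%:E + `|g x|%:E))%E).
  apply: ge0_le_integral => //; [exact: M| |].
    by apply: emeasurable_funD; exact: M.
  by move=> x _; rewrite -EFinD lee_fin.
by rewrite ge0_integralD//; [rewrite EFinD; exact: leeD|exact: M|exact: M].
Qed.

Lemma rtransform_V C r k x : 0 <= C -> V_bounded C r -> admissible w k -> 0 < x ->
  measurable_fun setT (rtransform k r : T -> R) /\
  (\int[leb]_(u in `[x, (expR 1 * x)%R]) `|rtransform k r u|%:E <=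
    (2 * (expR 1 * C * fine (kernel_norm w k)) * V rho1 x)%:E)%E.
Proof.
move=> C0 [[l1 l2] H] ak x0; have [mk _ _] := ak.
have m1 := measurable_kernel_transform mk l1; have m2 := measurable_kernel_transform mk l2.
split; first exact: measurable_funB.
have b1 := kernel_transform_V C0 l1 (fun x x0 => (H x x0).1) ak x0.
have b2 := kernel_transform_V C0 l2 (fun x x0 => (H x x0).2) ak x0.
rewrite (_ : 2 * _ * _ = expR 1 * C * fine (kernel_norm w k) * V rho1 x +
  expR 1 * C * fine (kernel_norm w k) * V rho1 x); last by ring.
apply: (integral_abs_le _ m1 m2 _ _ b1 b2) => //; first exact: measurable_funB.
by move=> u; exact: ler_normB.
Qed.

Definition transform_measure mu s :=
  signed_density (transform_re K mu) (cre s) /\ signed_density (transform_im K mu) (cim s).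

Lemma transform_measure_exists C mu : 0 <= C -> cgrowth C mu ->
  exists s, [/\ transform_measure mu s, complex_radon s & has_density s (transform K mu)].
Proof.
move=> C0 [g1 g2].
have lr := transform_re_halfline_integrable w_ge0 w_submul C0 g1 g2 are aim.
have li := transform_im_halfline_integrable w_ge0 w_submul C0 g1 g2 are aim.
have [sr srE] := signed_density_exists lr.1; have [si siE] := signed_density_exists li.1.
exists (CMeasure sr si); split=> //.
- by split; [exact: signed_density_radon lr srE|exact: signed_density_radon li siE].
- exact: has_density_transform.
Qed.

Lemma transform_measure_radon_class C mu s : 0 <= C -> V_bounded C (cre mu) ->
  V_bounded C (cim mu) -> complex_radon s -> transform_measure mu s -> radon_class rho1 s.
Proof.
move=> C0 b1 b2 rs [sr si]; pose N k := 2 * (expR 1 * C * fine (kernel_norm w k)).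
apply: (@radon_class_intro _ rho1 s (N (kernel_re K) + N (kernel_im K))) => // x x0.
have mI : measurable (`[x, (expR 1 * x)%R]%classic : set T) by exact: measurable_itv.
have [m1 i1] := rtransform_V C0 b1 are x0; have [m2 i2] := rtransform_V C0 b2 aim x0.
have [m3 i3] := rtransform_V C0 b1 aim x0; have [m4 i4] := rtransform_V C0 b2 are x0.
have mre : measurable_fun setT (transform_re K mu) by exact: measurable_funB.
have mim : measurable_fun setT (transform_im K mu) by exact: measurable_funD.
have hr := integral_abs_le mI m1 m2 mre (fun u => ler_normB _ _) i1 i2.
have hi := integral_abs_le mI m3 m4 mim (fun u => ler_normD _ _) i3 i4.
rewrite -mulrDl in hr; rewrite -mulrDl addrC in hi.
have [s1 s2] := signed_density_le mI mre sr; have [s3 s4] := signed_density_le mI mim si.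
by split; split; (exact: le_trans hr || exact: le_trans hi).
Qed.

Lemma rpairing_scale C C' r t phi a b k : 0 <= C -> 0 <= C' -> rgrowth w C r -> 0 < t ->
  rgrowth w C' (rscale_signed rho t r) -> test_fun phi a b -> admissible w k ->
  rpairing (fun x => phi (x / t)) k r = V rho1 t * rpairing phi k (rscale_signed rho t r).
Proof.
move=> C0 C'0 [g1 g2] t0 [h1 h2] tphi ak; rewrite V_add1// /rpairing mulrBr.
have Vt : V rho t != 0 by rewrite gt_eqF// powR_gt0.
rewrite (pairing_scale w_ge0 w_submul t0 tphi C0 C'0 g1 h1 ak Vt).
by rewrite (pairing_scale w_ge0 w_submul t0 tphi C0 C'0 g2 h2 ak Vt).
Qed.

(** Lebesgue measure contributes the factor t, so that the normalisation t V(t) of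
    s is matched by the normalisation V(t) of mu. *)
Lemma action_transform_scale C mu s t phi a b : 0 <= C -> V_bounded C (cre mu) ->
  V_bounded C (cim mu) -> transform_measure mu s -> complex_radon s -> 0 < t -> test_fun phi a b ->
  let r := rscale_signed rho t (cre mu) in let i := rscale_signed rho t (cim mu) in
  action (rscale_signed rho1 t (cre s)) phi =
    rpairing phi (kernel_re K) r - rpairing phi (kernel_im K) i /\
  action (rscale_signed rho1 t (cim s)) phi =
    rpairing phi (kernel_im K) r + rpairing phi (kernel_re K) i.
Proof.
move=> C0 b1 b2 [sr si] /complex_radon_finite[f1 f2] t0 tphi /=.
have g1 := V_bounded_growth C0 b1; have g2 := V_bounded_growth C0 b2.
have h1 := V_bounded_rgrowth C0 b1 t0; have h2 := V_bounded_rgrowth C0 b2 t0.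
have lr := transform_re_halfline_integrable w_ge0 w_submul C0 g1 g2 are aim.
have li := transform_im_halfline_integrable w_ge0 w_submul C0 g1 g2 are aim.
have tphi' := test_fun_dilate t0 tphi.
have Vt : V rho1 t != 0 by rewrite gt_eqF// powR_gt0.
rewrite (action_rscale rho1 t0 f1 tphi) (action_rscale rho1 t0 f2 tphi).
rewrite (signed_density_action sr lr tphi') (signed_density_action si li tphi').
rewrite (transform_re_pairing w_ge0 w_submul C0 g1 g2 are aim tphi').
rewrite (transform_im_pairing w_ge0 w_submul C0 g1 g2 are aim tphi').
rewrite !(rpairing_scale C0 C0 g1 t0 h1 tphi)// !(rpairing_scale C0 C0 g2 t0 h2 tphi)//.
by rewrite -mulrBr -mulrDr !mulKf.
Qed.

Definition scaled_cvg rho' mu (t : nat -> R) nu := forall phi a b, test_fun phi a b ->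
  (action (rscale_signed rho' (t n) (cre mu)) phi @[n --> \oo] --> action (cre nu) phi) /\
  (action (rscale_signed rho' (t n) (cim mu)) phi @[n --> \oo] --> action (cim nu) phi).

Lemma scaled_cvg_growth : exists2 D, 0 <= D & forall C mu t nu, 0 <= C ->
  V_bounded C (cre mu) -> V_bounded C (cim mu) -> (forall n, 0 < t n) -> complex_radon nu ->
  scaled_cvg rho mu t nu -> cgrowth (C * D) nu.
Proof.
have [D D0 HD] := signed_limit_growth w_ge0 w_submul.
exists D => // C mu t nu C0 b1 b2 t0 [r1 r2] H; split.
  apply: (HD C (fun n => rscale_signed rho (t n) (cre mu))) => //.
    by move=> n; exact: V_bounded_rgrowth.
  by move=> phi a b /H[].
apply: (HD C (fun n => rscale_signed rho (t n) (cim mu))) => //.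
  by move=> n; exact: V_bounded_rgrowth.
by move=> phi a b /H[].
Qed.

(** Testing the rescaled measures s_t means pairing with the rescaled measures
    mu_t, and these pairings are continuous for wide convergence. *)
Lemma transform_scaled_cvg C mu s t nu sigma C' : 0 <= C ->
  V_bounded C (cre mu) -> V_bounded C (cim mu) -> transform_measure mu s -> complex_radon s ->
  (forall n, 0 < t n) -> complex_radon nu -> scaled_cvg rho mu t nu ->
  0 <= C' -> cgrowth C' nu -> transform_measure nu sigma -> scaled_cvg rho1 s t sigma.
Proof.
move=> C0 b1 b2 ms rs t0 [r1 r2] H C'0 [g1 g2] [sr si] phi a b tphi.
have lr := transform_re_halfline_integrable w_ge0 w_submul C'0 g1 g2 are aim.
have li := transform_im_halfline_integrable w_ge0 w_submul C'0 g1 g2 are aim.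
rewrite (signed_density_action sr lr tphi) (signed_density_action si li tphi).
rewrite (transform_re_pairing w_ge0 w_submul C'0 g1 g2 are aim tphi).
rewrite (transform_im_pairing w_ge0 w_submul C'0 g1 g2 are aim tphi).
have P1 k := rpairing_cvg w_ge0 w_submul C0 (fun n => V_bounded_rgrowth C0 b1 (t0 n)) r1
  (fun phi a b tphi => (H phi a b tphi).1) (k := k) tphi.
have P2 k := rpairing_cvg w_ge0 w_submul C0 (fun n => V_bounded_rgrowth C0 b2 (t0 n)) r2
  (fun phi a b tphi => (H phi a b tphi).2) (k := k) tphi.
have E n := action_transform_scale C0 b1 b2 ms rs (t0 n) tphi.
split.
  apply: cvg_trans (cvgB (P1 _ are) (P2 _ aim)); apply: near_eq_cvg; apply: nearW => n.
  by rewrite (E n).1.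
apply: cvg_trans (cvgD (P1 _ aim) (P2 _ are)); apply: near_eq_cvg; apply: nearW => n.
by rewrite (E n).2.
Qed.

End transform_limits.

(** * Limit sets *)
Section limit_sets.
Context {R : realType}.
Local Notation T := (measurableTypeR R).
Local Notation leb := (@lebesgue_measure R).
Variables (rho : R -> R) (K : R -> R[i]) (mu s : cmeasure R) (C : R).
Hypothesis hrho : proximate_order rho.
Hypothesis are : admissible (weight rho) (kernel_re K).
Hypothesis aim : admissible (weight rho) (kernel_im K).
Hypotheses (C0 : 0 <= C) (bre : V_bounded rho C (cre mu)) (bim : V_bounded rho C (cim mu)).
Hypotheses (ms : transform_measure K mu s) (rs : complex_radon s).
Implicit Types (nu sigma : cmeasure R).
Let rho1 (x : R) : R := rho x + 1.
Let w_ge0 := weight_ge0 hrho.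
Let w_submul := weight_submul hrho.
Let fmu : cfinite mu := conj bre.1 bim.1.

Lemma limit_set_growth : exists2 D, 0 <= D & forall nu, limit_set rho mu nu ->
  cgrowth rho D nu.
Proof.
have [D D0 HD] := scaled_cvg_growth hrho.
exists (C * D); first by rewrite mulr_ge0.
by move=> nu /(limit_setP _ _ fmu)[rnu [t [t0 _] H]]; exact: HD rnu H.
Qed.

Lemma limit_set_transform nu : limit_set rho mu nu ->
  exists2 sigma, limit_set rho1 s sigma & has_density sigma (transform K nu).
Proof.
have [D D0 HD] := limit_set_growth; move=> nul; have g := HD _ nul.
have [sigma [msi rsi dsi]] := transform_measure_exists hrho are aim D0 g.
exists sigma => //; apply/(limit_setP _ _ (complex_radon_finite rs)).
have [rnu [t [t0 tn] H]] := (limit_setP _ _ fmu).1 nul.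
split=> //; exists t => //.
exact: (transform_scaled_cvg hrho are aim C0 bre bim ms rs t0 rnu H D0 g msi).
Qed.

(** The real and the imaginary part are selected one after the other, to get a
    common subsequence. *)
Lemma scaled_selection (t : nat -> R) : (forall n, 0 < t n) ->
  exists eta : nat -> nat, (forall j, (j <= eta j)%N) /\
  exists2 nu, complex_radon nu & scaled_cvg rho mu (t \o eta) nu.
Proof.
move=> t0.
have [e1 [he1 [n1 rn1 H1]]] := signed_selection w_ge0 w_submul C0
  (fun n => V_bounded_rgrowth hrho C0 bre (t0 n)).
have [e2 [he2 [n2 rn2 H2]]] := signed_selection w_ge0 w_submul C0
  (fun n => V_bounded_rgrowth hrho C0 bim (t0 (e1 n))).
exists (e1 \o e2); split=> [j|]; first exact: leq_trans (he2 j) (he1 _).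
exists (CMeasure n1 n2) => // phi a b tphi; split; last exact: H2 tphi.
exact: (cvg_comp _ _ (ge_id_cvg he2) (H1 phi a b tphi)).
Qed.

Lemma test_fun_value_unique sigma tau (E : set T) : complex_radon sigma -> complex_radon tau ->
  (forall phi a b, test_fun phi a b -> action (cre sigma) phi = action (cre tau) phi /\
     action (cim sigma) phi = action (cim tau) phi) ->
  measurable E -> relatively_compact E -> cvalue sigma E = cvalue tau E.
Proof.
move=> /complex_radon_finite[[l1 l2] [l3 l4]] /complex_radon_finite[[k1 k2] [k3 k4]] H mE rE.
have [a [b [a0 Eab]]] := relatively_compact_segment rE.
have fin (m : {measure set T -> \bar R}) : locally_finite m -> m E = (fine (m E))%:E.
  move=> lm; rewrite fineK// ge0_fin_numE//; apply: le_lt_trans (lm.2 a b a0).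
  by apply: le_measure; rewrite ?inE//; exact: measurable_itv.
have e1 := test_fun_difference_unique l1 l2 k1 k2 (fun phi a b tphi => (H phi a b tphi).1) mE.
have e2 := test_fun_difference_unique l3 l4 k3 k4 (fun phi a b tphi => (H phi a b tphi).2) mE.
rewrite (fin _ l1) (fin _ l2) (fin _ k1) (fin _ k2) -!EFinD in e1.
rewrite (fin _ l3) (fin _ l4) (fin _ k3) (fin _ k4) -!EFinD in e2.
move: e1 e2 => [e1] [e2]; rewrite /cvalue /rvalue; congr (_ +i* _)%C; lra.
Qed.

(** Along a subsequence the measures mu_t converge to some nu. Then sigma and the
    measure with density the transform of nu are limits of the same sequence. *)
Lemma limit_set_transform_converse sigma : limit_set rho1 s sigma ->
  exists2 nu, limit_set rho mu nu & has_density sigma (transform K nu).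
Proof.
move=> /(limit_setP _ _ (complex_radon_finite rs))[rsigma [t [t0 tn] H]].
have [eta [heta [nu rnu Hnu]]] := scaled_selection t0.
have te0 n : 0 < (t \o eta) n by exact: t0.
have nul : limit_set rho mu nu.
  apply/(limit_setP _ _ fmu); split=> //; exists (t \o eta) => //; split=> //.
  exact: (cvg_comp _ _ (ge_id_cvg heta) tn).
exists nu => //.
have [D D0 HD] := limit_set_growth; have g := HD _ nul.
have [tau [mtau rtau dtau]] := transform_measure_exists hrho are aim D0 g.
have Htau := transform_scaled_cvg hrho are aim C0 bre bim ms rs te0 rnu Hnu D0 g mtau.
move=> E mE rE; have [i <-] := dtau _ mE rE; split=> //.
apply: test_fun_value_unique => // phi a b tphi.
have [h1 h2] := H _ _ _ tphi; have [h3 h4] := Htau _ _ _ tphi.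
split.
  exact: (norm_cvg_unique (cvg_comp _ _ (ge_id_cvg heta) h1) h3).
exact: (norm_cvg_unique (cvg_comp _ _ (ge_id_cvg heta) h2) h4).
Qed.

End limit_sets.

Local Open Scope complex_scope.

Theorem theorem4p8 (R : realType) (rho : R -> R) (mu : cmeasure R)
    (K : R -> R[i])
    (hrho : proximate_order rho)
    (hmu : radon_class rho mu)
    (hK : borel_fun halfline K)
    (hL1 : cintegrable lebesgue_measure halfline
       (fun t => (t `^ (order_at_infinity rho - 1) * gamma rho t)%:C * K t)) :
  let rho1 : R -> R := fun r => rho r + 1 in
  {ae lebesgue_measure,
     forall r : R, halfline r -> transform_integrable K mu r} /\
  (exists s : cmeasure R,
    [/\ has_density s (transform K mu),
        radon_class rho1 s,
        forall sigma, limit_set rho1 s sigma -> abs_continuous sigma,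
        forall nu, limit_set rho mu nu ->
          {ae lebesgue_measure,
             forall u : R, halfline u -> transform_integrable K nu u}
      & forall f : R -> R[i], borel_fun halfline f ->
          ((exists2 sigma, limit_set rho1 s sigma & has_density sigma f) <->
           (exists2 nu, limit_set rho mu nu &
              ae_eq lebesgue_measure halfline f (transform K nu)))]).
Proof.
move=> rho1.
have [are aim] := kernels_admissible hK hL1.
have [C C0 HC] := radon_class_bound hmu.
have [fre fim] := complex_radon_finite hmu.1.
have bre : V_bounded rho C (cre mu) by split=> // x /HC[].
have bim : V_bounded rho C (cim mu) by split=> // x /HC[].
have wg := weight_ge0 hrho; have ws := weight_submul hrho.
have gre := V_bounded_growth hrho C0 bre; have gim := V_bounded_growth hrho C0 bim.
split; first exact: (transform_integrable_ae wg ws C0 gre gim are aim).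
have [s [ms rs ds]] := transform_measure_exists hrho are aim C0 (conj gre gim).
have fwd sigma := limit_set_transform_converse hrho are aim C0 bre bim ms rs (sigma := sigma).
exists s; split=> //.
- exact: (transform_measure_radon_class hrho are aim C0 bre bim rs ms).
- by move=> sigma /fwd[nu _]; exact: density_abs_continuous.
- move=> nu nul; have [D D0 HD] := limit_set_growth hrho C0 bre bim.
  have [g1 g2] := HD _ nul; exact: (transform_integrable_ae wg ws D0 g1 g2 are aim).
- move=> f bf; split=> [[sigma /fwd[nu nul dnu] df]|[nu nul fnu]].
    by exists nu => //; exact: has_density_unique df dnu.
  have [sigma sl dsigma] := limit_set_transform hrho are aim C0 bre bim ms rs nul.
  by exists sigma => //; exact: has_density_ae fnu dsigma.
Qed.
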